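(* Let $M=\Omega/\Gamma$ be a compact manifold with a strictly convex projective structure, let $\varphi^t$ be the geodesic flow of its Hilbert metric on $HM$, with generator $X$, and let $$E^u=\{Y+H_X(Y):\ Y\in VHM\},\qquad E^s=\{Y-H_X(Y):\ Y\in VHM\}.$$ Then $\varphi^t$ is an Anosov flow with decomposition $$THM=\mathbb{R}X\oplus E^s\oplus E^u,$$ that is, (for a Riemannian norm $\|\cdot\|$ on $HM$) there exist constants $C,\alpha,\beta>0$ such that for any $w\in HM$ and $t\ge0$, $$\|d\varphi^t(Z^s)\|\le Ce^{-\alpha t}\|Z^s\|,\quad Z^s\in E^s(w),$$ $$\|d\varphi^{-t}(Z^u)\|\le Ce^{-\beta t}\|Z^u\|,\quad Z^u\in E^u(w),$$ and the decomposition is invariant under the flow.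
   Context: A compact manifold with a strictly convex projective structure is a compact quotient manifold $M=\Omega/\Gamma$, with $\Omega\subset\mathbb{P}^n(\mathbb{R})$ a strictly convex open set which is bounded in some affine chart, and $\Gamma\subset PGL(n+1,\mathbb{R})$ preserving $\Omega$ (acting freely and properly discontinuously); $\partial\Omega$ is then known to be $C^1$. In an affine chart in which $\Omega$ is bounded, for $x\in\Omega$ and $\xi\neq0$, let $x^+,x^-$ be the intersections with $\partial\Omega$ of the line through $x$ directed by $\xi$ (in directions $\xi$, $-\xi$). The Hilbert metric is the $\Gamma$-invariant Finsler metric $F(x,\xi)=\frac{|\xi|}2\left(\frac1{xx^+}+\frac1{xx^-}\right)$ (Euclidean lengths); it descends to $M$. $HM=(TM\setminus\{0\})/\mathbb{R}^*_+$, $H\Omega$ likewise, with projection $\pi$ to the base. On $H\Omega$, $X^e$ is the generator of the Euclidean geodesic flow (unit-speed motion on straight lines), $m(x,[\xi])=2\,\frac{xx^+\,xx^-}{x^+x^-}$, and $\tilde X=mX^e$ is the generator of the geodesic flow of the Hilbert metric (motion along straight lines at unit $F$-speed). It is $\Gamma$-invariant and descends to the generator $X$ of the geodesic flow $\varphi^t$ on $HM$. Vertical distribution: $VH\Omega=\ker d\pi$. For a local basis $Y_1,\dots,Y_{n-1}$ of $VH\Omega$, the fields $\tilde X,Y_i,[\tilde X,Y_i]$ form a basis of $TH\Omega$; the vertical operator $v_{\tilde X}$ is the endomorphism with $v_{\tilde X}(\tilde X)=v_{\tilde X}(Y)=0$, $v_{\tilde X}([\tilde X,Y])=-Y$ for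 $Y$ vertical. The horizontal operator is $H_{\tilde X}(Y)=-[\tilde X,Y]-\frac12v_{\tilde X}([\tilde X,[\tilde X,Y]])$ for $Y$ vertical (linear over functions). These objects are $\Gamma$-invariant and descend to $VHM$, $v_X$, $H_X$ on $HM$. *)

(* Defs.v *)
(* A manifold M = Omega / Gamma with a strictly convex projective structure is
   given by Omega, a subset of R^n seen as an affine chart of P^n(R) in which
   Omega is bounded, and by Gamma.  An object on HM (flow, vector field,
   subbundle, Riemannian metric) is a Gamma-invariant object on HOmega. *)
From HB Require Import structures.
From mathcomp Require Import all_boot all_order all_algebra.
From mathcomp Require Import all_classical all_reals all_analysis.

Set Implicit Arguments.
Unset Strict Implicit.
Unset Printing Implicit Defensive.

Import Order.TTheory GRing.Theory Num.Theory.
Import numFieldNormedType.Exports.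

Local Open Scope classical_set_scope.
Local Open Scope ring_scope.

(* The library norm on row vectors is the sup norm, hence these two. *)
Definition dotp (R : realType) (n : nat) (x y : 'rV[R]_n) : R :=
  (x *m y^T) 0 0.

Definition enorm (R : realType) (n : nat) (x : 'rV[R]_n) : R :=
  Num.sqrt (dotp x x).

(* C^k on an open set D; only the values of f on D matter. *)
Fixpoint Ck (R : realType) (E F : normedModType R) (k : nat) (D : set E)
    (f : E -> F) : Prop :=
  match k with
  | 0%N => forall x, D x -> {for x, continuous f}
  | k'.+1 => (forall x, D x -> differentiable f x) /\
             forall v, Ck k' D (fun x => 'D_v f x)
  end.

Definition smooth_on (R : realType) (E F : normedModType R) (D : set E)
    (f : E -> F) : Prop := forall k, Ck k D f.

Definition frontier (T : topologicalType) (A : set T) : set T :=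
  closure A `\` interior A.

Definition strictly_convex_domain (R : realType) (n : nat)
    (Omega : set 'rV[R]_n) : Prop :=
  [/\ open Omega, bounded_set Omega, convex_set Omega &
      forall x y, x != y ->
        ~ (forall t : R, 0 <= t <= 1 ->
             frontier Omega ((1 - t) *: x + t *: y))].

(* A subgroup of PGL(n+1,R) is given by its inverse image in GL(n+1,R). *)
Definition PGL_subgroup (R : realType) (n : nat)
    (Gamma : set 'M[R]_(n + 1)) : Prop :=
  [/\ forall g, Gamma g -> g \in unitmx,
      Gamma 1%:M,
      forall g h, Gamma g -> Gamma h -> Gamma (g *m h),
      forall g, Gamma g -> Gamma (invmx g) &
      forall (c : R) g, c != 0 -> Gamma g -> Gamma (c *: g)].

(* Homogeneous coordinates [x : 1], with matrices acting on row vectors. *)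
Definition homog (R : realType) (n : nat) (g : 'M[R]_(n + 1))
    (x : 'rV[R]_n) : 'rV[R]_(n + 1) := row_mx x 1%:M *m g.

Definition pact (R : realType) (n : nat) (g : 'M[R]_(n + 1))
    (x : 'rV[R]_n) : 'rV[R]_n :=
  (rsubmx (homog g x) 0 0)^-1 *: lsubmx (homog g x).

(* The denominator condition says that the image of x lies in the chart. *)
Definition preserves (R : realType) (n : nat) (Gamma : set 'M[R]_(n + 1))
    (Omega : set 'rV[R]_n) : Prop :=
  forall g x, Gamma g -> Omega x ->
    rsubmx (homog g x) 0 0 != 0 /\ Omega (pact g x).

(* The identity of PGL(n+1,R) is the class of scalar matrices. *)
Definition acts_freely (R : realType) (n : nat) (Gamma : set 'M[R]_(n + 1))
    (Omega : set 'rV[R]_n) : Prop :=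
  forall g x, Gamma g -> Omega x -> pact g x = x -> is_scalar_mx g.

(* Finiteness is that of a set of classes in PGL(n+1,R). *)
Definition acts_properly_discontinuously (R : realType) (n : nat)
    (Gamma : set 'M[R]_(n + 1)) (Omega : set 'rV[R]_n) : Prop :=
  forall K : set 'rV[R]_n, K `<=` Omega -> compact K ->
    exists s : seq 'M[R]_(n + 1),
      forall g, Gamma g -> (pact g @` K) `&` K !=set0 ->
        exists2 h, h \in s & exists c : R, g = c *: h.

Definition orbit (R : realType) (n : nat) (Gamma : set 'M[R]_(n + 1))
    (x : 'rV[R]_n) : set 'rV[R]_n := [set pact g x | g in Gamma].

(* Compactness (by open covers) of the set of orbits of points of Omega, for
   the quotient topology. *)
Definition compact_quotient (R : realType) (n : nat)
    (Gamma : set 'M[R]_(n + 1)) (Omega : set 'rV[R]_n) : Prop :=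
  forall (I : choiceType) (D : set I) (f : I -> set (set 'rV[R]_n)),
    (forall i, D i -> open (Omega `&` orbit Gamma @^-1` f i)) ->
    orbit Gamma @` Omega `<=` cover D f ->
    finite_subset_cover D f (orbit Gamma @` Omega).

Definition compact_strictly_convex_projective (R : realType) (n : nat)
    (Omega : set 'rV[R]_n) (Gamma : set 'M[R]_(n + 1)) : Prop :=
  [/\ strictly_convex_domain Omega,
      PGL_subgroup Gamma /\ preserves Gamma Omega,
      acts_freely Gamma Omega,
      acts_properly_discontinuously Gamma Omega &
      compact_quotient Gamma Omega].

(* The point x^+ for the direction xi; x^- is the one for - xi. *)
Definition exit_point (R : realType) (n : nat) (Omega : set 'rV[R]_n)
    (x xi : 'rV[R]_n) : 'rV[R]_n :=
  xget 0 [set p | frontier Omega p /\ exists2 s : R, 0 < s & p = x + s *: xi].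

Definition hilbertF (R : realType) (n : nat) (Omega : set 'rV[R]_n)
    (x xi : 'rV[R]_n) : R :=
  enorm xi / 2 * ((enorm (x - exit_point Omega x xi))^-1 +
                  (enorm (x - exit_point Omega x (- xi)))^-1).

(* HOmega = (TOmega \ {0}) / R^*_+, where the class of (x, xi) is represented
   by (x, xi / |xi|).  So HOmega is the submanifold Omega x S^{n-1} of
   R^n x R^n, and its tangent space at (x, u) is the set of the (a, b) such that b is orthogonal to u. *)
Definition normalize (R : realType) (n : nat)
    (w : 'rV[R]_n * 'rV[R]_n) : 'rV[R]_n * 'rV[R]_n :=
  (w.1, (enorm w.2)^-1 *: w.2).

Definition TOmega0 (R : realType) (n : nat) (Omega : set 'rV[R]_n) :
    set ('rV[R]_n * 'rV[R]_n) := [set w | Omega w.1 /\ w.2 != 0].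

Definition HOmega (R : realType) (n : nat) (Omega : set 'rV[R]_n) :
    set ('rV[R]_n * 'rV[R]_n) := [set w | Omega w.1 /\ enorm w.2 = 1].

Definition tangent (R : realType) (n : nat) (w : 'rV[R]_n * 'rV[R]_n) :
    set ('rV[R]_n * 'rV[R]_n) := [set Z | dotp Z.2 w.2 = 0].

(* ker (d pi), where pi (x, u) = x *)
Definition vertical (R : realType) (n : nat) (w : 'rV[R]_n * 'rV[R]_n) :
    set ('rV[R]_n * 'rV[R]_n) := [set Z | tangent w Z /\ Z.1 = 0].

(* Derivative along a vector Z tangent to HOmega of a map defined on HOmega,
   the map being extended to TOmega \ {0} by homogeneity.  It is a directional
   derivative: the fields [X, Y] below are in general only continuous, but they
   have a derivative along X. *)
Definition dH (R : realType) (n : nat) (E : normedModType R)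
    (f : 'rV[R]_n * 'rV[R]_n -> E) (w Z : 'rV[R]_n * 'rV[R]_n) : E :=
  'D_Z (f \o @normalize R n) w.

Definition bracket (R : realType) (n : nat)
    (A B : 'rV[R]_n * 'rV[R]_n -> 'rV[R]_n * 'rV[R]_n)
    (w : 'rV[R]_n * 'rV[R]_n) : 'rV[R]_n * 'rV[R]_n :=
  dH B w (A w) - dH A w (B w).

Definition smooth_field (R : realType) (n : nat) (Omega : set 'rV[R]_n)
    (A : 'rV[R]_n * 'rV[R]_n -> 'rV[R]_n * 'rV[R]_n) : Prop :=
  (forall w, HOmega Omega w -> tangent w (A w)) /\
  smooth_on (TOmega0 Omega) (A \o @normalize R n).

Definition smooth_vertical_field (R : realType) (n : nat)
    (Omega : set 'rV[R]_n)
    (Y : 'rV[R]_n * 'rV[R]_n -> 'rV[R]_n * 'rV[R]_n) : Prop :=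
  smooth_field Omega Y /\ forall w, HOmega Omega w -> vertical w (Y w).

Definition hact (R : realType) (n : nat) (g : 'M[R]_(n + 1))
    (w : 'rV[R]_n * 'rV[R]_n) : 'rV[R]_n * 'rV[R]_n :=
  normalize (pact g w.1, 'D_(w.2) (pact g) w.1).

Definition riemannian_metric (R : realType) (n : nat) (Omega : set 'rV[R]_n)
    (Gamma : set 'M[R]_(n + 1))
    (G : 'rV[R]_n * 'rV[R]_n -> 'rV[R]_n * 'rV[R]_n ->
         'rV[R]_n * 'rV[R]_n -> R) : Prop :=
  [/\ forall w Z Z', HOmega Omega w -> tangent w Z -> tangent w Z' ->
        G w Z Z' = G w Z' Z,
      forall w (c : R) Z Z1 Z2, HOmega Omega w ->
        tangent w Z -> tangent w Z1 -> tangent w Z2 ->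
        G w Z (c *: Z1 + Z2) = c * G w Z Z1 + G w Z Z2,
      forall w Z, HOmega Omega w -> tangent w Z -> Z != 0 -> 0 < G w Z Z,
      forall A B, smooth_field Omega A -> smooth_field Omega B ->
        smooth_on (TOmega0 Omega)
          ((fun w => G w (A w) (B w) : R^o) \o @normalize R n) &
      forall g w Z Z', Gamma g -> HOmega Omega w ->
        tangent w Z -> tangent w Z' ->
        G (hact g w) (dH (hact g) w Z) (dH (hact g) w Z') = G w Z Z'].

Definition rnorm (R : realType) (n : nat)
    (G : 'rV[R]_n * 'rV[R]_n -> 'rV[R]_n * 'rV[R]_n ->
         'rV[R]_n * 'rV[R]_n -> R)
    (w Z : 'rV[R]_n * 'rV[R]_n) : R := Num.sqrt (G w Z Z).

Definition euclidean_spray (R : realType) (n : nat)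
    (w : 'rV[R]_n * 'rV[R]_n) : 'rV[R]_n * 'rV[R]_n := (w.2, 0).

Definition hilbert_m (R : realType) (n : nat) (Omega : set 'rV[R]_n)
    (w : 'rV[R]_n * 'rV[R]_n) : R :=
  let xp := exit_point Omega w.1 w.2 in
  let xm := exit_point Omega w.1 (- w.2) in
  2 * (enorm (w.1 - xp) * enorm (w.1 - xm) / enorm (xp - xm)).

Definition Xfield (R : realType) (n : nat) (Omega : set 'rV[R]_n)
    (w : 'rV[R]_n * 'rV[R]_n) : 'rV[R]_n * 'rV[R]_n :=
  hilbert_m Omega w *: euclidean_spray w.

(* Straight lines at unit speed for F; c is the Euclidean speed. *)
Definition hilbert_geodesic_flow (R : realType) (n : nat)
    (Omega : set 'rV[R]_n)
    (phi : R -> 'rV[R]_n * 'rV[R]_n -> 'rV[R]_n * 'rV[R]_n) : Prop :=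
  forall w, HOmega Omega w ->
    phi 0 w = w /\
    forall t : R,
      [/\ HOmega Omega (phi t w),
          (phi t w).2 = w.2 &
          exists c : R,
            [/\ 0 < c,
                is_derive (t : R^o) (1 : R^o) (fun s : R^o => (phi s w).1)
                  (c *: w.2) &
                hilbertF Omega (phi t w).1 (c *: w.2) = 1]].

(* v_X is determined by its values on X, on vertical vectors and on the
   [X, Y] with Y vertical, which together span the tangent space. *)
Definition vertical_op (R : realType) (n : nat) (Omega : set 'rV[R]_n)
    (w Z : 'rV[R]_n * 'rV[R]_n) : 'rV[R]_n * 'rV[R]_n :=
  xget 0 [set V | exists (a : R) Y0 Y,
    [/\ vertical w Y0, smooth_vertical_field Omega Y,
        Z = a *: Xfield Omega w + Y0 + bracket (Xfield Omega) Y w &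
        V = - Y w]].

Definition horizontal_op (R : realType) (n : nat) (Omega : set 'rV[R]_n)
    (Y : 'rV[R]_n * 'rV[R]_n -> 'rV[R]_n * 'rV[R]_n)
    (w : 'rV[R]_n * 'rV[R]_n) : 'rV[R]_n * 'rV[R]_n :=
  - bracket (Xfield Omega) Y w
  - (2^-1 : R) *: vertical_op Omega w
      (bracket (Xfield Omega) (bracket (Xfield Omega) Y) w).

Definition Eu (R : realType) (n : nat) (Omega : set 'rV[R]_n)
    (w : 'rV[R]_n * 'rV[R]_n) : set ('rV[R]_n * 'rV[R]_n) :=
  [set Y w + horizontal_op Omega Y w | Y in smooth_vertical_field Omega].

Definition Es (R : realType) (n : nat) (Omega : set 'rV[R]_n)
    (w : 'rV[R]_n * 'rV[R]_n) : set ('rV[R]_n * 'rV[R]_n) :=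
  [set Y w - horizontal_op Omega Y w | Y in smooth_vertical_field Omega].

Definition linear_subspace (R : realType) (n : nat)
    (w : 'rV[R]_n * 'rV[R]_n) (E : set ('rV[R]_n * 'rV[R]_n)) : Prop :=
  [/\ E `<=` tangent w, E 0 &
      forall (c : R) Z Z', E Z -> E Z' -> E (c *: Z + Z')].

(* T_w HOmega = R X0 (+) E1 (+) E2, with X0 <> 0 *)
Definition direct_sum_at (R : realType) (n : nat)
    (w X0 : 'rV[R]_n * 'rV[R]_n) (E1 E2 : set ('rV[R]_n * 'rV[R]_n)) : Prop :=
  [/\ tangent w X0, linear_subspace w E1, linear_subspace w E2 &
      forall Z, tangent w Z ->
        exists! p : R * (('rV[R]_n * 'rV[R]_n) * ('rV[R]_n * 'rV[R]_n)),
          [/\ E1 p.2.1, E2 p.2.2 & Z = p.1 *: X0 + p.2.1 + p.2.2]].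

Definition invariant_under (R : realType) (n : nat) (Omega : set 'rV[R]_n)
    (f X : 'rV[R]_n * 'rV[R]_n -> 'rV[R]_n * 'rV[R]_n)
    (E1 E2 : 'rV[R]_n * 'rV[R]_n -> set ('rV[R]_n * 'rV[R]_n)) : Prop :=
  forall w, HOmega Omega w ->
    [/\ dH f w (X w) = X (f w),
        dH f w @` E1 w = E1 (f w) &
        dH f w @` E2 w = E2 (f w)].

(* Main.v *)
(* Let tau(x, xi) be the Minkowski functional of Omega - x, so that the Hilbert
   norm is half of N(x, xi) = tau(x, xi) + tau(x, - xi).  A projective map changes
   tau by a linear form in xi, whence N is invariant.  A corner of the boundary
   would blow up, by a compactness argument under Gamma, to a Hilbert norm that is
   not strictly convex; so tau is C^1, and the convexity of the domain gives
   d tau = mu(d xi) + tau mu(d x), with mu the differential of tau(x, .) at xi.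
   The definition of H_X then yields the two subbundles as graphs over the same
   space {z | mu(x, u) z = mu(x, - u) z}, namely
     E^s = {(z, - tau(x, u) P z)}  and  E^u = {(z, tau(x, - u) P z)},
   P being the projection to the orthogonal of u.  The flow is explicit, and on E^s
   it acts on z by z_t = (1 - th) (z - s mu(z) u), where th = s tau(x, u) and s is
   the displacement.  Strict convexity of Omega gives N(x_t, z_t) < N(x, z) for
   t > 0: the exit points of z_t lie on the open segments joining those of z to the
   end point of the geodesic.  Compactness modulo Gamma makes this uniform at t = 1,
   and z |-> N(x, z) is equivalent to the Riemannian norm on each subbundle. *)
Require Import Defs.
From HB Require Import structures.
From mathcomp Require Import all_boot all_order all_algebra.
From mathcomp Require Import all_classical all_reals all_analysis.
From mathcomp Require Import ring lra.

Set Implicit Arguments.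
Unset Strict Implicit.
Unset Printing Implicit Defensive.

Import Order.TTheory GRing.Theory Num.Theory.
Import numFieldNormedType.Exports.

Local Open Scope classical_set_scope.
Local Open Scope ring_scope.

(** * Differential calculus *)

Section Differentials.
Context {R : realType}.

(** The obstacle is regularity. The boundary is only C^1, so [tau] and X are only C^1 and [X, Y]
    only continuous, while H_X requires [X, [X, Y]]. The second bracket differentiates [X, Y] along
    X alone, and along a geodesic the covector mu keeps its direction, because all points of the
    line share the tangent hyperplane at the end point. Writing mu there as a fixed vector times a
    ratio of gauges makes [X, Y] differentiable along the line. Joint differentiability of [tau] in
    x and xi has to be proved as well: the supporting hyperplane at one exit point bounds [tau] at
    every other base point, and exchanging the two points sandwiches the increment between two
    linear expressions. Backward data are the forward data of the reversed direction, so E^u is E^s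
    after reversal of direction and time. No contraction rate is computed: the strict decrease of N
    over unit time becomes uniform on a compact set of vectors of sup norm 1, and the constant C
    pays for the fractional part of t and for the comparison of the norms. *)

Lemma is_diff_epsP (V W : normedModType R) (f : V -> W) (df : {linear V -> W}) x :
  continuous df ->
  (forall e : R, 0 < e ->
     \forall h \near (0 : V), `|f (h + x) - f x - df h| <= e * `|h|) ->
  is_diff x f df.
Proof.
move=> cdf fdf.
have fo : f \o shift x = cst (f x) + df +o_ (0 : V) id.
  by apply/eqaddoP => e e0; near do rewrite !fctE opprD addrA; exact: fdf.
have dE := diff_unique cdf fo.
by apply: DiffDef => //; apply/diff_locallyP; rewrite dE.
Unshelve. all: by end_near. Qed.

Lemma near_is_diff (V W : normedModType R) (f g : V -> W) (df : V -> W) x :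
  (\forall y \near x, f y = g y) -> is_diff x f df -> is_diff x g df.
Proof.
move=> fg [fx dfE]; rewrite -dfE; apply: is_diff_epsP => [|e e0].
  exact: diff_continuous.
have /eqaddoP := diff_locally fx; move=> /(_ e e0) he.
have fgx : f x = g x by exact: nbhs_singleton fg.
have fg0 : \forall h \near (0 : V), f (h + x) = g (h + x).
  by move: fg; rewrite (near_shift 0 x) /=; apply: filterS => h; rewrite /= subr0.
apply: filterS2 fg0 he => h; rewrite !fctE /= fgx => ->.
by rewrite opprD addrA.
Qed.

Lemma is_diff_derive (V W : normedModType R) (f : V -> W) df x v :
  is_diff x f df -> 'D_v f x = df v.
Proof. by move=> fx; rewrite deriveE ?diff_val. Qed.

Lemma scaler_is_bilinear (W : normedModType R) :
  bilinear_for
    (GRing.Scale.Law.clone _ _ *:%R _) (GRing.Scale.Law.clone _ _ *:%R _)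
    (@GRing.scale R W).
Proof.
split=> [u'|u] a x y /=; first by rewrite scalerDl scalerA.
by rewrite scalerDr !scalerA mulrC.
Qed.
HB.instance Definition _ (W : normedModType R) :=
  bilinear_isBilinear.Build R R W W _ _ (@GRing.scale R W) (scaler_is_bilinear W).

Lemma is_diff_scale (V W : normedModType R) (k : V -> R) (f : V -> W) dk df x :
  is_diff x k dk -> is_diff x f df ->
  is_diff x (fun y => k y *: f y) (fun h => k x *: df h + dk h *: f x).
Proof.
move=> kx fx.
have sc : continuous (fun p : R * W => p.1 *: p.2) by move=> ?; exact: scale_continuous.
refine (@is_diff_comp R V _ W (fun y => (k y, f y)) (fun h => (dk h, df h))
  (fun p => p.1 *: p.2) (fun q => k x *: q.2 + q.1 *: f x) x
  (is_diff_pair kx fx) _).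
have h := @diff_bilin R R W W (@GRing.scale R W) (k x, f x) sc.
apply: DiffDef; last exact: h.
exact: (@differentiable_bilin R R W W (@GRing.scale R W) (k x, f x) sc).
Qed.

Lemma is_diff_mul (V : normedModType R) (k f : V -> R) dk df x :
  is_diff x k dk -> is_diff x f df ->
  is_diff x (fun y => k y * f y) (fun h => k x * df h + dk h * f x).
Proof.
move=> kx fx; have := is_diffM kx fx => /is_diff_eq; apply.
by rewrite funeqE => h; rewrite !fctE /= /GRing.scale /= [dk h * _]mulrC.
Qed.

Lemma is_diff_add (V W : normedModType R) (k f : V -> W) dk df x :
  is_diff x k dk -> is_diff x f df ->
  is_diff x (fun y => k y + f y) (fun h => dk h + df h).
Proof. exact: is_diffD. Qed.

Lemma is_diff_opp (V W : normedModType R) (f : V -> W) df x :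
  is_diff x f df -> is_diff x (fun y => - f y) (fun h => - df h).
Proof. exact: is_diffN. Qed.

Lemma is_diff_sub (V W : normedModType R) (k f : V -> W) dk df x :
  is_diff x k dk -> is_diff x f df ->
  is_diff x (fun y => k y - f y) (fun h => dk h - df h).
Proof. exact: is_diffB. Qed.

Lemma is_diff_const (V W : normedModType R) (c : W) (x : V) :
  is_diff x (fun=> c) (fun=> 0).
Proof. exact: is_diff_cst. Qed.

Lemma is_diff_inv (V : normedModType R) (f : V -> R) df x : f x != 0 ->
  is_diff x f df ->
  is_diff x (fun y => (f y)^-1) (fun h => - (f x) ^- 2 * df h).
Proof.
move=> fx0 fx.
have := @is_diff_comp R V _ _ f df (fun y => y^-1) (fun h => - (f x) ^- 2 * h) x fx.
apply; apply: DiffDef; first exact: differentiable_Rinv.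
by rewrite diff_Rinv //; apply/funext => h; rewrite /= /GRing.scale /= mulrC.
Qed.

Lemma is_diff_lin (V W : normedModType R) (f : {linear V -> W}) x :
  continuous f -> is_diff x f f.
Proof.
move=> fc; apply: DiffDef; [exact: linear_differentiable|exact: diff_lin].
Qed.

Lemma is_diff_fst (U V W : normedModType R) (f : U -> V * W) df x :
  is_diff x f df -> is_diff x (fun y => (f y).1) (fun h => (df h).1).
Proof.
move=> fx; apply: (@is_diff_comp _ _ _ _ f df (fun p => p.1) (fun p => p.1) x) => //.
by apply: is_diff_lin => p; exact: cvg_fst.
Qed.

Lemma is_diff_snd (U V W : normedModType R) (f : U -> V * W) df x :
  is_diff x f df -> is_diff x (fun y => (f y).2) (fun h => (df h).2).
Proof.
move=> fx; apply: (@is_diff_comp _ _ _ _ f df (fun p => p.2) (fun p => p.2) x) => //.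
by apply: is_diff_lin => p; exact: cvg_snd.
Qed.

Lemma is_diff_idfun (V : normedModType R) (x : V) : is_diff x (fun y => y) (fun h => h).
Proof. exact: is_diff_id. Qed.

End Differentials.

(** * The gauge of a strictly convex domain *)

Lemma cvg_scale (R : realType) (T : Type) (F : set_system T) {FF : Filter F}
    (W : normedModType R) (a : R) (f : T -> W) (l : W) :
  f @ F --> l -> (fun x => a *: f x) @ F --> a *: l.
Proof. by move=> fl; apply: cvgZ => //; exact: cvg_cst. Qed.

Lemma cont_affine (R : realType) (W : normedModType R) (b : W) (a : R) (z : W) :
  {for z, continuous (fun z' : W => b + a *: z')}.
Proof. by apply: cvgD; [exact: cvg_cst|exact: scaler_continuous]. Qed.

Lemma near_open (T U : topologicalType) (f : T -> U) (A : set U) a :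
  {for a, continuous f} -> open A -> A (f a) -> \forall y \near a, A (f y).
Proof. by move=> cf oA Aa; apply: cf; exact: open_nbhs_nbhs. Qed.

Lemma closure_meets (T U : topologicalType) (f : T -> U) (A : set T) (B : set U) a :
  {for a, continuous f} -> open B -> B (f a) -> closure A a -> exists2 y, A y & B (f y).
Proof. by move=> cf oB Ba /(_ _ (near_open cf oB Ba))[y [Ay By]]; exists y. Qed.

(** The gauge is known through its strict upper bounds ([tau_ltP]), so equalities between gauges are
    proved by comparing these. *)
Lemma lt_iff_eq (R : realType) (a b : R) : 0 <= a -> 0 <= b ->
  (forall t, 0 < t -> a < t <-> b < t) -> a = b.
Proof.
move=> a0 b0 ab; apply/eqP; rewrite eq_le; apply/andP; split; apply/ler_addgt0Pr => e e0.
- by apply/ltW/(iffRL (ab _ _)); rewrite ?ltrDl// ltr_wpDl.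
- by apply/ltW/(iffLR (ab _ _)); rewrite ?ltrDl// ltr_wpDl.
Qed.

(* [tau Omega (x, xi)] is the Minkowski functional at [xi] of [Omega - x], that is the Funk metric of [Omega]: the exit point is [x + xi / tau]. *)
HB.lock Definition tau (R : realType) (n : nat) (Omega : set 'rV[R]_n)
    (w : 'rV[R]_n * 'rV[R]_n) : R :=
  inf [set t : R | 0 < t /\ Omega (w.1 + t^-1 *: w.2)].

Section Gauge.
Context {R : realType} {n : nat} (Omega : set 'rV[R]_n).
Hypothesis dom : strictly_convex_domain Omega.
Implicit Types x y z u v xi eta : 'rV[R]_n.

Local Notation tau := (tau Omega).

Let oOmega : open Omega. Proof. by case: dom. Qed.

Lemma cont_line x v (s : R) : {for s, continuous (fun s : R => x + s *: v)}.
Proof.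
by apply: cvgD; [exact: cvg_cst|apply: cvgZr_tmp; exact: cvg_id].
Qed.

Lemma domain_convex x y (s : R) :
  Omega x -> Omega y -> 0 <= s -> s <= 1 -> Omega ((1 - s) *: x + s *: y).
Proof.
case: dom => _ _ cv _ Ox Oy s0 s1.
have s01 : Itv.spec (@Itv.num_sem R) (Itv.Real `[0%Z, 1%Z]) (1 - s).
  by rewrite /Itv.spec /= /Itv.num_sem /= in_itv /= num_real; apply/andP; split; lra.
have := cv x y (Itv.mk s01); rewrite !inE => /(_ Ox Oy).
by rewrite /conv /= /unstable.onem subKr.
Qed.

Lemma domain_bounded : exists2 B : R, 0 < B & forall x, Omega x -> `|x| <= B.
Proof.
case: dom => _ /ex_strict_bound_gt0[B B0 hB] _ _; exists B => // x Ox.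
exact/ltW/hB.
Qed.

(** The map [f] recovers [x] from [w] and the end point. Moving [z] slightly to a point of [Omega]
    moves [x] slightly, so it stays in the open set [Omega], and [w] becomes a combination of two
    points of [Omega]. *)
Lemma domain_star x z (s : R) :
  Omega x -> closure Omega z -> 0 <= s -> s < 1 -> Omega ((1 - s) *: x + s *: z).
Proof.
move=> Ox Oz s0 s1; set w := (X in Omega X).
pose f (z' : 'rV[R]_n) := (1 - s)^-1 *: (w - s *: z').
have s1' : 1 - s != 0 by rewrite subr_eq0 gt_eqF.
have fz : f z = x by rewrite /f /w addrK scalerA mulVf ?scale1r.
have cf : {for z, continuous f}.
  have -> : f = (fun z' => (1 - s)^-1 *: w + (- ((1 - s)^-1 * s)) *: z').
    by apply/funext => z'; rewrite /f scalerBr scalerA scaleNr.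
  exact: cont_affine.
have Ofz : Omega (f z) by rewrite fz.
have [z' Oz' Ofz'] := closure_meets cf oOmega Ofz Oz.
have -> : w = (1 - s) *: f z' + s *: z'.
  by rewrite /f scalerA mulfV // scale1r subrK.
by apply: domain_convex => //; exact: ltW.
Qed.

Lemma closure_segment y z (s : R) : closure Omega y -> closure Omega z ->
  0 <= s -> s <= 1 -> closure Omega ((1 - s) *: y + s *: z).
Proof.
move=> Oy Oz s0 s1 B.
rewrite nbhsE => -[C [oC Cw] CB].
have [z' Oz' Cz'] : exists2 z', Omega z' & C ((1 - s) *: y + s *: z').
  apply: (closure_meets (f := fun z' => (1 - s) *: y + s *: z') _ oC Cw Oz).
  exact: cont_affine.
have [y' Oy' Cy'] : exists2 y', Omega y' & C (s *: z' + (1 - s) *: y').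
  apply: (closure_meets (f := fun y' => s *: z' + (1 - s) *: y') _ oC _ Oy).
    exact: cont_affine.
  by rewrite addrC.
exists (s *: z' + (1 - s) *: y'); split; last exact: CB.
rewrite addrC; exact: domain_convex.
Qed.

(** The definition of strict convexity only forbids whole segments in the frontier. One point of the
    segment inside [Omega] is enough: by [domain_star] it draws in every point between itself and an
    end point, hence the point at [s]. *)
Lemma segment_inside y z (s : R) : closure Omega y -> closure Omega z -> y != z ->
  0 < s -> s < 1 -> Omega ((1 - s) *: y + s *: z).
Proof.
move=> Oy Oz yz s0 s1; apply: contrapT => nO.
case: dom => _ _ _ /(_ y z yz); apply => r /andP[r0 r1].
split; first exact: closure_segment.
rewrite (iffLR (interior_id _) oOmega) => Or; apply: nO.
have [rs|rs|<-//] := ltgtP r s.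
- have d0 : 1 - r != 0 by rewrite subr_eq0 gt_eqF// (lt_trans rs).
  have -> : (1 - s) *: y + s *: z =
      (1 - (s - r) / (1 - r)) *: ((1 - r) *: y + r *: z) + ((s - r) / (1 - r)) *: z.
    by apply/rowP => i; rewrite !mxE; field.
  apply: domain_star => //; first by apply: divr_ge0; lra.
  rewrite ltr_pdivrMr; lra.
- have d0 : r != 0 by rewrite gt_eqF// (lt_trans s0).
  have -> : (1 - s) *: y + s *: z =
      (1 - (r - s) / r) *: ((1 - r) *: y + r *: z) + ((r - s) / r) *: y.
    by apply/rowP => i; rewrite !mxE; field.
  have r0' : 0 < r by lra.
  by apply: domain_star => //; [apply: divr_ge0; lra|rewrite ltr_pdivrMr; lra].
Qed.

(** Valid for every [w]: the infimum of an empty set is 0 by convention. *)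
Lemma tau_ge0 w : 0 <= tau w.
Proof.
rewrite tau.unlock; set S := (X in inf X).
have [->|/set0P[t St]] := eqVneq S set0; first by rewrite inf0.
by apply: lb_le_inf; [exists t|move=> ? [/ltW]].
Qed.

(** Convexity makes the set of admissible [t] upward closed and openness makes it open, so it is the
    open half-line above its infimum. *)
Lemma tau_ltP x xi (t : R) : Omega x -> 0 < t ->
  tau (x, xi) < t <-> Omega (x + t^-1 *: xi).
Proof.
move=> Ox t0.
have lb : has_lbound [set t : R | 0 < t /\ Omega (x + t^-1 *: xi)].
  by exists 0 => ? [/ltW].
have ne : [set t : R | 0 < t /\ Omega (x + t^-1 *: xi)] !=set0.
  have Ox0 : Omega (x + (0 : R) *: xi) by rewrite scale0r addr0.
  have /nbhs_ballP[e e0 he] := near_open (@cont_line x xi (0 : R)) oOmega Ox0.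
  exists (2 / e); split; first by rewrite divr_gt0.
  apply: he; rewrite /ball /= sub0r normrN invf_div ger0_norm ?divr_ge0 ?ltW//.
  by rewrite ltr_pdivrMr// ltr_pMr// ltr1n.
have -> : tau (x, xi) = inf [set t : R | 0 < t /\ Omega (x + t^-1 *: xi)].
  by rewrite tau.unlock.
split.
- move=> /(inf_lt ne)[s [s0 Os] /= st].
  have -> : x + t^-1 *: xi = (1 - s / t) *: x + (s / t) *: (x + s^-1 *: xi).
    by apply/rowP => i; rewrite !mxE; field; rewrite !gt_eqF.
  by apply: domain_convex => //; [rewrite divr_ge0 // ltW|rewrite ler_pdivrMr // mul1r ltW].
- move=> Ot.
  have /nbhs_ballP[e e0 he] := near_open (@cont_line x xi t^-1) oOmega Ot.
  pose s := (t^-1 + e / 2)^-1.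
  have ti0 : 0 < t^-1 by rewrite invr_gt0.
  have se0 : 0 < t^-1 + e / 2 by rewrite addr_gt0// divr_gt0.
  have s0 : 0 < s by rewrite invr_gt0.
  apply: (@le_lt_trans _ _ s).
    apply: ge_inf => //; split=> //; rewrite /s invrK; apply: he.
    rewrite /ball /= opprD addNKr normrN ger0_norm ?divr_ge0 ?ltW//.
    by rewrite ltr_pdivrMr// ltr_pMr// ltr1n.
  by rewrite /s invf_plt ?posrE// ltrDl divr_gt0.
Qed.

Lemma tau_leP x xi (t : R) : Omega x -> 0 < t ->
  tau (x, xi) <= t <-> closure Omega (x + t^-1 *: xi).
Proof.
move=> Ox t0; split.
- move=> tt B; rewrite nbhsE => -[C [oC Cw] CB].
  have /nbhs_ballP[e e0 he] := near_open (@cont_line x xi t^-1) oC Cw.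
  have ti0 : 0 < t^-1 by rewrite invr_gt0.
  (* A positive parameter strictly below [t^-1] and within [e] of it; the maximum with 0 covers the
     case where [e] exceeds [t^-1]. *)
  pose r := (t^-1 + Num.max 0 (t^-1 - e)) / 2.
  have mx : Num.max 0 (t^-1 - e) < t^-1 by rewrite gt_max ti0 /= ltrBlDr ltrDl.
  have m0 : 0 <= Num.max 0 (t^-1 - e) by rewrite le_max lexx.
  have m1 : t^-1 - e <= Num.max 0 (t^-1 - e) by rewrite le_max lexx orbT.
  have r0 : 0 < r by rewrite /r; lra.
  have rt : r < t^-1 by rewrite /r; lra.
  have re : t^-1 - r < e by rewrite /r; lra.
  exists (x + r *: xi); split; last first.
    by apply/CB/he; rewrite /ball /= ger0_norm // subr_ge0 ltW.
  have := (tau_ltP xi Ox (t := r^-1)); rewrite invr_gt0 r0 => /(_ isT).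
  rewrite invrK => -[+ _]; apply; apply: (le_lt_trans tt).
  by rewrite -[t]invrK ltf_pV2 ?posrE.
- move=> Ot; apply/ler_addgt0Pr => e e0.
  have te0 : 0 < t + e by rewrite addr_gt0.
  apply/ltW/tau_ltP => //.
  have -> : x + (t + e)^-1 *: xi = (1 - t / (t + e)) *: x + (t / (t + e)) *: (x + t^-1 *: xi).
    by apply/rowP => i; rewrite !mxE; field; rewrite !gt_eqF.
  apply: domain_star => //; first by rewrite divr_ge0 // ltW.
  by rewrite ltr_pdivrMr // mul1r ltrDl.
Qed.

(** Boundedness in the chart: [xi / t] is a difference of two points of [Omega] as soon as [t]
    exceeds the gauge. Definiteness of [tau] follows. *)
Lemma tau_lower : exists2 B : R, 0 < B &
  forall x xi, Omega x -> `|xi| <= B * tau (x, xi).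
Proof.
have [B B0 hB] := domain_bounded.
have B2 : 0 < 2 * B by rewrite mulr_gt0.
exists (2 * B) => // x xi Ox; rewrite mulrC -ler_pdivrMr //.
apply/ler_addgt0Pr => e e0; set t := _ + e.
have t0 : 0 < t by rewrite ltr_wpDl// tau_ge0.
have /tau_ltP -/(_ Ox t0) /hB h : tau (x, xi) < t by rewrite ltrDl.
rewrite ler_pdivrMr //.
have -> : xi = t *: ((x + t^-1 *: xi) - x).
  by rewrite addrC addKr scalerA mulfV ?scale1r // gt_eqF.
rewrite normrZ gtr0_norm // ler_pM2l //.
by rewrite (le_trans (ler_normB _ _))// mulr_natl mulr2n lerD // hB.
Qed.

Lemma tau_gt0 x xi : Omega x -> xi != 0 -> 0 < tau (x, xi).
Proof.
move=> Ox xi0; have [B B0 /(_ x xi Ox) h] := tau_lower.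
have : 0 < B * tau (x, xi) by rewrite (lt_le_trans _ h) // normr_gt0.
by rewrite pmulr_rgt0.
Qed.

Lemma tau0 x : Omega x -> tau (x, 0) = 0.
Proof.
move=> Ox; apply: lt_iff_eq => [|//|t t0]; first exact: tau_ge0.
by split=> // _; apply/tau_ltP => //; rewrite scaler0 addr0.
Qed.

Lemma frontier_tau x xi (t : R) : Omega x -> 0 < t ->
  frontier Omega (x + t^-1 *: xi) <-> tau (x, xi) = t.
Proof.
move=> Ox t0; rewrite /frontier (iffLR (interior_id _) oOmega) /=; split.
- move=> -[/(tau_leP xi Ox t0) h1 h2]; apply/eqP; rewrite eq_le h1 /= leNgt.
  by apply/negP => /(tau_ltP xi Ox t0).
- move=> tE; split; first by apply/tau_leP; rewrite ?tE.
  by move=> /(tau_ltP xi Ox t0); rewrite tE ltxx.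
Qed.

Lemma tau_frontier x xi : Omega x -> xi != 0 ->
  frontier Omega (x + (tau (x, xi))^-1 *: xi).
Proof. by move=> Ox xi0; apply/frontier_tau => //; exact: tau_gt0. Qed.

Lemma tauZ x xi (c : R) : Omega x -> 0 < c -> tau (x, c *: xi) = c * tau (x, xi).
Proof.
move=> Ox c0; apply: lt_iff_eq => [||t t0]; rewrite ?mulr_ge0 ?tau_ge0 ?(ltW c0) //.
rewrite mulrC -ltr_pdivlMr //.
have tc : 0 < t / c by rewrite divr_gt0.
split.
- move=> /(tau_ltP (c *: xi) Ox t0) h; apply/tau_ltP => //.
  by rewrite invf_div mulrC -scalerA.
- move=> /(tau_ltP _ Ox tc) h; apply/tau_ltP => //.
  by move: h; rewrite invf_div mulrC -scalerA.
Qed.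

Lemma tauD x xi eta : Omega x -> tau (x, xi + eta) <= tau (x, xi) + tau (x, eta).
Proof.
move=> Ox; apply/ler_addgt0Pr => e e0.
set a := tau (x, xi) + e / 2; set b := tau (x, eta) + e / 2.
have a0 : 0 < a by rewrite ltr_wpDl ?tau_ge0// divr_gt0.
have b0 : 0 < b by rewrite ltr_wpDl ?tau_ge0// divr_gt0.
have ab0 : 0 < a + b by rewrite addr_gt0.
have -> : tau (x, xi) + tau (x, eta) + e = a + b by rewrite /a /b; field.
have /(tau_ltP _ Ox a0) Oa : tau (x, xi) < a by rewrite ltrDl divr_gt0.
have /(tau_ltP _ Ox b0) Ob : tau (x, eta) < b by rewrite ltrDl divr_gt0.
apply/ltW/tau_ltP => //.
have -> : x + (a + b)^-1 *: (xi + eta) =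
    (1 - b / (a + b)) *: (x + a^-1 *: xi) + (b / (a + b)) *: (x + b^-1 *: eta).
  by apply/rowP => i; rewrite !mxE; field; rewrite !gt_eqF.
apply: domain_convex => //; first by rewrite divr_ge0 // ltW.
by rewrite ler_pdivrMr // mul1r lerDr ltW.
Qed.

(** With [a] and [b] the two gauges, [x + (xi + eta) / (a + b)] is the combination of the two exit
    points with weights [a / (a + b)] and [b / (a + b)]. The exit points differ, so strict convexity
    puts it inside. *)
Lemma tau_strict x xi eta : Omega x -> xi != 0 -> eta != 0 ->
  (tau (x, xi))^-1 *: xi != (tau (x, eta))^-1 *: eta ->
  tau (x, xi + eta) < tau (x, xi) + tau (x, eta).
Proof.
move=> Ox xi0 eta0 ne.
set a := tau (x, xi) in ne *; set b := tau (x, eta) in ne *.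
have a0 : 0 < a by exact: tau_gt0.
have b0 : 0 < b by exact: tau_gt0.
have ab0 : 0 < a + b by rewrite addr_gt0.
apply/tau_ltP => //.
have -> : x + (a + b)^-1 *: (xi + eta) =
    (1 - b / (a + b)) *: (x + a^-1 *: xi) + (b / (a + b)) *: (x + b^-1 *: eta).
  by apply/rowP => i; rewrite !mxE; field; rewrite !gt_eqF.
apply: segment_inside; [exact/tau_leP|exact/tau_leP| | |].
- by rewrite (inj_eq (addrI _)).
- by rewrite divr_gt0.
- by rewrite ltr_pdivrMr // mul1r ltrDr.
Qed.

(** The exit point is common to the whole line: it lies at parameter [1 / tau] from [x], hence
    [1 / tau - s] from the shifted point. *)
Lemma tau_line x xi (s : R) : Omega x -> xi != 0 -> Omega (x + s *: xi) ->
  s * tau (x, xi) < 1 -> tau (x + s *: xi, xi) = tau (x, xi) / (1 - s * tau (x, xi)).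
Proof.
move=> Ox xi0 Oxs s1; have t0 := tau_gt0 Ox xi0.
have d0 : 0 < 1 - s * tau (x, xi) by rewrite subr_gt0.
apply/frontier_tau => //; first by rewrite divr_gt0.
rewrite (_ : _ + _ = x + (tau (x, xi))^-1 *: xi); first exact: tau_frontier.
by apply/rowP => i; rewrite !mxE; field; rewrite !gt_eqF.
Qed.

Lemma tau_line_lt x xi (s : R) : Omega x -> xi != 0 ->
  Omega (x + s *: xi) -> s * tau (x, xi) < 1.
Proof.
move=> Ox xi0 Os; have t0 := tau_gt0 Ox xi0.
have [s0|s0] := ltrP 0 s; last by rewrite (@le_lt_trans _ _ 0) // mulr_le0_ge0 // ltW.
have /tau_ltP : Omega (x + s^-1^-1 *: xi) by rewrite invrK.
by rewrite invr_gt0 => /(_ Ox s0); rewrite -ltr_pdivlMl // mulr1.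
Qed.

Lemma tau_line_in x xi (s : R) : Omega x -> xi != 0 ->
  s * tau (x, xi) < 1 -> - s * tau (x, - xi) < 1 -> Omega (x + s *: xi).
Proof.
move=> Ox xi0 s1 s2.
have [s0|s0|<-] := ltrgtP 0 s; last by rewrite scale0r addr0.
- rewrite -[s]invrK; apply/tau_ltP => //; first by rewrite invr_gt0.
  by rewrite -[ltRHS]mulr1 ltr_pdivlMl.
- rewrite -[s]opprK scaleNr -scalerN -[- s]invrK; apply/tau_ltP => //.
    by rewrite invr_gt0 oppr_gt0.
  by rewrite -[ltRHS]mulr1 ltr_pdivlMl // oppr_gt0.
Qed.

(** The upper estimate comes from openness of [Omega], the lower one from openness of the complement
    of its closure. *)
Lemma tau_continuous x xi : Omega x -> {for (x, xi), continuous tau}.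
Proof.
move=> Ox; apply/cvgrPdist_le => e e0.
have near1 : \forall w \near (x, xi), Omega w.1.
  exact: (@near_open ('rV[R]_n * 'rV[R]_n)%type _ fst Omega (x, xi) cvg_fst oOmega Ox).
have lin t : {for (x, xi), continuous (fun w : 'rV[R]_n * 'rV[R]_n => w.1 + t *: w.2)}.
  by apply: cvgD; [exact: cvg_fst|apply: (cvg_scale (f := snd)); exact: cvg_snd].
have t0 : 0 < tau (x, xi) + e by rewrite ltr_wpDl // tau_ge0.
have up : \forall w \near (x, xi), tau w < tau (x, xi) + e.
  have : \forall w \near (x, xi), Omega (w.1 + (tau (x, xi) + e)^-1 *: w.2).
    apply: (near_open (lin _)) => //; apply/tau_ltP => //; by rewrite ltrDl.
  by apply: filterS2 near1 => -[y eta] /= Oy; move/(tau_ltP eta Oy t0).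
have lo : \forall w \near (x, xi), tau (x, xi) - e <= tau w.
  have [te|te] := lerP (tau (x, xi) - e) 0.
    by near=> w; apply: (le_trans te); exact: tau_ge0.
  have nO : (~` closure Omega) (x + (tau (x, xi) - e)^-1 *: xi).
    by move=> /(tau_leP xi Ox te); rewrite leNgt ltrBlDr ltrDl e0.
  have oC : open (~` closure Omega) by apply/closed_openC/closed_closure.
  have := near_open (lin (tau (x, xi) - e)^-1) oC nO.
  apply: filterS2 near1 => -[y eta] /= Oy nOy; rewrite leNgt; apply/negP => lt.
  by apply: nOy; apply/tau_leP => //; exact: ltW.
near=> w; have h1 : tau w < tau (x, xi) + e by near: w.
have h2 : tau (x, xi) - e <= tau w by near: w.
by rewrite ler_distl; apply/andP; split; lra.
Unshelve. all: by end_near. Qed.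

Lemma exit_pointE x xi : Omega x -> xi != 0 ->
  exit_point Omega x xi = x + (tau (x, xi))^-1 *: xi.
Proof.
move=> Ox xi0; apply: xget_unique.
  split; first exact: tau_frontier.
  by exists (tau (x, xi))^-1 => //; rewrite invr_gt0 tau_gt0.
move=> y [+ [s s0 yE]]; rewrite {}yE -[s]invrK => /frontier_tau.
by rewrite invr_gt0 => /(_ Ox s0) ->; rewrite invrK.
Qed.

End Gauge.

(** * Projective maps and cocompactness *)

Section Compactness.
Context {R : realType}.

Lemma compact_lower (T : topologicalType) (A : set T) (f : T -> R) :
  compact A -> (forall a, A a -> {for a, continuous f}) ->
  (forall a, A a -> 0 < f a) -> exists2 d : R, 0 < d & forall a, A a -> d <= f a.
Proof.
move=> cA cf f0; have [->|/set0P A0] := eqVneq A set0; first by exists 1.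
have [|c /set_mem Ac hc] := compact_EVT_min (f := f) A0 cA.
  by apply: continuous_in_subspaceT => a /set_mem; exact: cf.
by exists (f c); [exact: f0|move=> a Aa; apply/hc/mem_set].
Qed.

Lemma compact_upper (T : topologicalType) (A : set T) (f : T -> R) :
  compact A -> (forall a, A a -> {for a, continuous f}) ->
  exists2 C : R, 0 < C & forall a, A a -> f a <= C.
Proof.
move=> cA cf; have [->|/set0P A0] := eqVneq A set0; first by exists 1.
have [|c /set_mem Ac hc] := compact_EVT_max (f := f) A0 cA.
  by apply: continuous_in_subspaceT => a /set_mem; exact: cf.
exists (Num.max (f c) 1); first by rewrite lt_max ltr01 orbT.
by move=> a Aa; rewrite le_max hc //; exact: mem_set.
Qed.

(** For [r = s] this is a sphere of the sup norm, to which homogeneous functions are reduced. *)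
Lemma compact_shell (n : nat) (r s : R) :
  compact [set v : 'rV[R]_n | r <= `|v| /\ `|v| <= s].
Proof.
apply: bounded_closed_compact.
  by exists s; split; [exact: num_real|move=> M sM v [_ /le_trans]; apply; exact: ltW].
have -> : [set v : 'rV[R]_n | r <= `|v| /\ `|v| <= s] =
    (fun v : 'rV[R]_n => `|v|) @^-1` [set t | r <= t] `&`
    (fun v : 'rV[R]_n => `|v|) @^-1` [set t | t <= s] by [].
apply: closedI; apply: closed_comp => [v _|]; try exact: norm_continuous.
  exact: closed_ge.
exact: closed_le.
Qed.

Lemma linear_rV_continuous (n : nat) (W : normedModType R) (f : {linear 'rV[R]_n -> W}) :
  continuous f.
Proof.
have -> : (f : 'rV[R]_n -> W) = (fun v => \sum_i v 0 i *: f (delta_mx 0 i)).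
  apply/funext => v; rewrite {1}[v]row_sum_delta raddf_sum.
  by apply: eq_bigr => i _; exact: linearZ.
apply: continuous_big => [|i _ v]; first exact: add_continuous.
by apply: continuousZr_tmp; exact: coord_continuous.
Qed.

Lemma is_diff_linear_rV (n : nat) (W : normedModType R) (f : 'rV[R]_n -> W) x :
  linear f -> is_diff x f f.
Proof.
move=> lf; pose fL := HB.pack_for {linear 'rV[R]_n -> W} f (GRing.isLinear.Build _ _ _ _ f lf).
exact: (is_diff_lin (f := fL) x (@linear_rV_continuous n W fL)).
Qed.

Lemma rV_continuous (T : topologicalType) (n : nat) (f : T -> 'rV[R]_n) a :
  (forall i, {for a, continuous (fun y => f y 0 i)}) -> {for a, continuous f}.
Proof.
move=> cf; apply/cvgrPdist_le => e e0.
have : \forall y \near a, forall i, `|f a 0 i - f y 0 i| <= e.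
  apply: filter_forall => i; have /cvgrPdist_le := cf i; exact.
apply: filterS => y hy; rewrite /Num.Def.normr /= mx_normrE.
by apply: (bigmax_le _ (ltW e0)) => -[i j] _; rewrite !mxE ord1; exact: hy.
Qed.

End Compactness.

(** * Projective maps in an affine chart *)

Section Projective.
Context {R : realType} {n : nat}.
Implicit Types (g : 'M[R]_(n + 1)) (x xi : 'rV[R]_n) (s : R).

Definition lin_part g xi : 'rV[R]_(n + 1) := row_mx xi (0 : 'rV_1) *m g.
Definition den g x : R := rsubmx (homog g x) 0 0.
Definition denlin g xi : R := rsubmx (lin_part g xi) 0 0.
(** The logarithmic derivative of the denominator, which is the linear form by which [g] changes the
    gauge. *)
Definition kap g x xi : R := denlin g xi / den g x.
(** The differential of [pact g] at [x], given by the quotient rule; the closed form allows exact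
    algebra along lines. *)
Definition dpact g x xi : 'rV[R]_n :=
  (den g x)^-1 *: (lsubmx (lin_part g xi) - denlin g xi *: pact g x).

Lemma homog_line g x xi s : homog g (x + s *: xi) = homog g x + s *: lin_part g xi.
Proof.
rewrite /homog /lin_part scalemxAl -mulmxDl; congr (_ *m _).
by rewrite scale_row_mx add_row_mx scaler0 addr0.
Qed.

Lemma lin_part_linear g : linear (lin_part g).
Proof.
move=> s x y; rewrite /lin_part scalemxAl -mulmxDl; congr (_ *m _).
by rewrite scale_row_mx add_row_mx scaler0 addr0.
Qed.

Lemma den_line g x xi s : den g (x + s *: xi) = den g x + s * denlin g xi.
Proof. by rewrite /den /denlin homog_line linearD linearZ !mxE. Qed.

(** A projective map sends lines to lines and reparametrises them by a homography, whose only
    coefficient is [kap]. *)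
Lemma pact_line g x xi s : den g x != 0 -> 1 + s * kap g x xi != 0 ->
  pact g (x + s *: xi) = pact g x + (s / (1 + s * kap g x xi)) *: dpact g x xi.
Proof.
move=> d0 k0; rewrite /pact /dpact -/(den _ _) -/(den _ _) den_line homog_line.
rewrite [den g x + _](_ : _ = den g x * (1 + s * kap g x xi)); last first.
  by rewrite /kap; field.
rewrite linearD linearZ /= /pact -/(den g x).
have sc (a b c d : R) : d != 0 -> 1 + s * (c / d) != 0 ->
  (d * (1 + s * (c / d)))^-1 * (a + s * b) =
  d^-1 * a + s / (1 + s * (c / d)) * (d^-1 * (b - c * (d^-1 * a))).
  move=> {}d0 {}k0; have e : 1 + s * (c / d) = (d + s * c) / d by field.
  move: k0; rewrite e mulf_eq0 negb_or => /andP[k0 _].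
  by field; rewrite d0 k0.
rewrite /kap in k0 *; move: (lsubmx (homog g x)) (lsubmx (lin_part g xi)) => A B.
move: (den g x) (denlin g xi) d0 k0 => d c d0 k0.
by apply/rowP => i; rewrite !mxE; exact: sc.
Qed.

Lemma homogE g x : den g x != 0 ->
  homog g x = den g x *: row_mx (pact g x) 1%:M.
Proof.
move=> d0; rewrite -[LHS]hsubmxK scale_row_mx /pact -/(den g x) scalerA mulfV // scale1r.
by congr row_mx; rewrite [LHS]mx11_scalar scalemx1.
Qed.

Lemma lin_partE g x xi : den g x != 0 ->
  lin_part g xi = den g x *: row_mx (dpact g x xi) 0 + denlin g xi *: row_mx (pact g x) 1%:M.
Proof.
move=> d0; rewrite -[LHS]hsubmxK !scale_row_mx add_row_mx scaler0 add0r.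
rewrite /dpact scalerA mulfV // scale1r subrK.
by congr row_mx; rewrite [LHS]mx11_scalar scalemx1.
Qed.

Lemma homog_inv g x : g \in unitmx -> den g x != 0 ->
  homog (invmx g) (pact g x) = (den g x)^-1 *: row_mx x 1%:M.
Proof.
move=> gu d0; rewrite /homog.
have -> : row_mx (pact g x) 1%:M = (den g x)^-1 *: homog g x.
  by rewrite homogE // scalerA mulVf // scale1r.
by rewrite /homog -scalemxAl mulmxK.
Qed.

Lemma den_inv g x : g \in unitmx -> den g x != 0 ->
  den (invmx g) (pact g x) = (den g x)^-1.
Proof.
by move=> gu d0; rewrite {1}/den homog_inv // linearZ /= row_mxKr !mxE eqxx mulr1.
Qed.

Lemma pact_inv g x : g \in unitmx -> den g x != 0 -> pact (invmx g) (pact g x) = x.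
Proof.
move=> gu d0; rewrite {1}/pact -/(den _ _) den_inv // homog_inv // linearZ /= row_mxKl.
by rewrite scalerA invrK mulfV // scale1r.
Qed.

Lemma lin_part_inv g x xi : g \in unitmx -> den g x != 0 ->
  lin_part (invmx g) (dpact g x xi) =
  (den g x)^-1 *: (row_mx xi 0 - kap g x xi *: row_mx x 1%:M).
Proof.
move=> gu d0; rewrite /lin_part.
have -> : row_mx (dpact g x xi) 0 =
    (den g x)^-1 *: (lin_part g xi - kap g x xi *: homog g x) :> 'rV_(n + 1).
  rewrite (lin_partE xi d0) homogE // /kap scalerA divfK // addrK scalerA mulVf //.
  by rewrite scale1r.
by rewrite -scalemxAl mulmxBl -scalemxAl !mulmxK.
Qed.

Lemma denlin_inv g x xi : g \in unitmx -> den g x != 0 ->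
  denlin (invmx g) (dpact g x xi) = - (kap g x xi / den g x).
Proof.
move=> gu d0; rewrite /denlin lin_part_inv // linearZ linearB linearZ /= !row_mxKr !mxE.
by rewrite eqxx sub0r mulr1 mulrN mulrC.
Qed.

Lemma kap_inv g x xi : g \in unitmx -> den g x != 0 ->
  kap (invmx g) (pact g x) (dpact g x xi) = - kap g x xi.
Proof.
move=> gu d0; rewrite {1}/kap denlin_inv // den_inv //; by field; rewrite d0.
Qed.

Lemma dpact_inv g x xi : g \in unitmx -> den g x != 0 ->
  dpact (invmx g) (pact g x) (dpact g x xi) = xi.
Proof.
move=> gu d0; rewrite {1}/dpact den_inv // pact_inv // denlin_inv // lin_part_inv //.
have -> : lsubmx ((den g x)^-1 *: (row_mx xi 0 - kap g x xi *: row_mx x 1%:M)) =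
    (den g x)^-1 *: (xi - kap g x xi *: x).
  by rewrite linearZ linearB linearZ /= !row_mxKl.
by apply/rowP => i; rewrite !mxE; field; rewrite d0.
Qed.

Lemma denlin_linear g : linear (denlin g : 'rV[R]_n -> R^o).
Proof. by move=> s x y; rewrite /denlin lin_part_linear linearD linearZ !mxE. Qed.

Lemma dpact_linear g x : linear (dpact g x).
Proof.
move=> s u v; rewrite /dpact (denlin_linear g s u v) lin_part_linear linearD linearZ /=.
by apply/rowP => i; rewrite !mxE /GRing.scale /=; ring.
Qed.

Lemma kap_linear g x : linear (kap g x : 'rV[R]_n -> R^o).
Proof.
by move=> s u v; rewrite /kap (denlin_linear g s u v) mulrDl /GRing.scale /= mulrA.
Qed.

Lemma is_diff_homog g x : is_diff x (homog g) (lin_part g).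
Proof.
have -> : homog g = (fun x => homog g 0 + lin_part g x).
  by apply/funext => y; rewrite -[in LHS](add0r y) -[in LHS](scale1r y) homog_line scale1r.
apply: (is_diff_eq (is_diff_add (is_diff_const (homog g 0) x)
  (is_diff_linear_rV x (lin_part_linear g)))).
by apply/funext => h; rewrite add0r.
Qed.

Lemma is_diff_den g x : is_diff x (den g) (denlin g).
Proof.
apply: (@is_diff_comp _ _ _ _ (homog g) (lin_part g)
  (fun v => rsubmx v 0 0) (fun v => rsubmx v 0 0)).
  exact: is_diff_homog.
apply: (@is_diff_linear_rV R _ R) => s u v.
by rewrite linearD linearZ !mxE.
Qed.

Lemma is_diff_pact g x : den g x != 0 -> is_diff x (pact g) (dpact g x).
Proof.
move=> d0; apply: is_diff_eq; first apply: (is_diff_scale (k := fun x => (den g x)^-1)).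
- by apply: is_diff_inv => //; exact: is_diff_den.
- apply: (@is_diff_comp _ _ _ _ (homog g) (lin_part g) lsubmx lsubmx).
    exact: is_diff_homog.
  by apply: is_diff_linear_rV => s u v; rewrite linearD linearZ.
- apply/funext => h; rewrite /dpact /pact -/(den g x); apply/rowP => i.
  by rewrite !mxE /=; field.
Qed.

End Projective.

(** * The gauge under projective maps *)

Section ProjectiveGauge.
Context {R : realType} {n : nat} (Omega : set 'rV[R]_n).
Hypothesis dom : strictly_convex_domain Omega.
Local Notation tau := (tau Omega).

Definition preserved (g : 'M[R]_(n + 1)) : Prop :=
  forall x, Omega x -> den g x != 0 /\ Omega (pact g x).

(** Otherwise the denominator, affine along the line and nonzero at [x], would vanish between [x]
    and [x + s xi], at a point of [Omega] by convexity; but [g] keeps [Omega] in the chart. *)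
Lemma kap_gt g x xi (s : R) : preserved g -> Omega x -> 0 <= s ->
  Omega (x + s *: xi) -> 0 < 1 + s * kap g x xi.
Proof.
move=> pg Ox s0 Os; rewrite ltNge; apply/negP => h.
have [d0 _] := pg _ Ox.
have k0 : kap g x xi < 0.
  by rewrite ltNge; apply/negP => k0; have := mulr_ge0 s0 k0; lra.
have [] := pg (x + (- (kap g x xi)^-1) *: xi); last first.
  move=> + _; rewrite den_line; apply/negP; rewrite negbK; apply/eqP.
  rewrite /kap; field; rewrite d0 /=.
  by apply: contraTneq k0 => c0; rewrite /kap c0 mul0r ltxx.
have sp : 0 < s.
  by rewrite lt_neqAle s0 andbT; apply/eqP => s00; move: h; rewrite -s00 mul0r; lra.
set r := - _^-1.
have r0 : 0 < r by rewrite oppr_gt0 invr_lt0.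
have rs : r / s <= 1.
  rewrite ler_pdivrMr // mul1r /r -(ler_nM2l k0) mulrN mulfV ?lt_eqF //.
  by rewrite mulrC; lra.
have -> : x + r *: xi = (1 - r / s) *: x + (r / s) *: (x + s *: xi).
  by apply/rowP => i; rewrite !mxE; field; rewrite gt_eqF.
by apply: domain_convex => //; rewrite divr_ge0 // ltW.
Qed.

(** The homography of [pact_line] sends the parameter [1 / t] to [1 / (t + kap)], so an admissible
    [t] for [xi] gives the admissible [t + kap] for its image. *)
Lemma tau_pact_le g x xi : preserved g -> Omega x ->
  tau (pact g x, dpact g x xi) <= tau (x, xi) + kap g x xi.
Proof.
move=> pg Ox; have [d0 Ogx] := pg _ Ox; apply/ler_addgt0Pr => e e0.
pose t := tau (x, xi) + e.
have t0 : 0 < t by rewrite ltr_wpDl ?tau_ge0.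
have /(tau_ltP dom xi Ox t0) Ot : tau (x, xi) < t by rewrite ltrDl.
have ti0 : 0 <= t^-1 by rewrite invr_ge0 ltW.
have k0 := kap_gt pg Ox ti0 Ot.
have [_] := pg _ Ot; rewrite pact_line //; last by rewrite gt_eqF.
have tk : 0 < t + kap g x xi.
  by rewrite -[t](mulr1) -[X in _ + X](mulVKf (lt0r_neq0 t0)) -mulrDr mulr_gt0.
have -> : t^-1 / (1 + t^-1 * kap g x xi) = (t + kap g x xi)^-1.
  have d1 : t + kap g x xi != 0 by rewrite gt_eqF.
  have d2 : t != 0 by rewrite gt_eqF.
  by field; rewrite d1 d2.
by move/(tau_ltP dom _ Ogx tk)/ltW; rewrite /t; lra.
Qed.

(** The converse inequality is [tau_pact_le] for the inverse map, for which [kap] changes sign. *)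
Lemma tau_pact g x xi : g \in unitmx -> preserved g -> preserved (invmx g) ->
  Omega x -> tau (pact g x, dpact g x xi) = tau (x, xi) + kap g x xi.
Proof.
move=> gu pg pg' Ox; apply/eqP; rewrite eq_le tau_pact_le //=.
have [d0 Ogx] := pg _ Ox.
have := tau_pact_le (dpact g x xi) pg' Ogx.
by rewrite pact_inv // dpact_inv // kap_inv //; lra.
Qed.

End ProjectiveGauge.

(** * Orbits and a compact set meeting all of them *)

Section Orbits.
Context {R : realType} {n : nat} (Omega : set 'rV[R]_n) (Gamma : set 'M[R]_(n + 1)).
Hypothesis dom : strictly_convex_domain Omega.
Hypothesis gam : PGL_subgroup Gamma.
Hypothesis pres : preserves Gamma Omega.
Implicit Types (g h : 'M[R]_(n + 1)) (x y : 'rV[R]_n).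

Lemma gamma_unit g : Gamma g -> g \in unitmx.
Proof. by case: gam => + _ _ _ _; apply. Qed.

Lemma gamma_inv g : Gamma g -> Gamma (invmx g).
Proof. by case: gam => _ _ _ + _; apply. Qed.

Lemma gamma_preserved g : Gamma g -> preserved Omega g.
Proof. by move=> Gg x; exact: pres. Qed.

(** Matrices act on row vectors, so the left factor acts first. *)
Lemma pact_comp g h x : den g x != 0 -> pact h (pact g x) = pact (g *m h) x.
Proof.
move=> d0; have hE : homog (g *m h) x = den g x *: homog h (pact g x).
  rewrite /homog mulmxA -[row_mx x 1%:M *m g]/(homog g x) homogE //.
  by rewrite -scalemxAl.
rewrite [RHS]/pact hE.
have -> : lsubmx (den g x *: homog h (pact g x)) =
  den g x *: lsubmx (homog h (pact g x)) by rewrite linearZ.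
have -> : rsubmx (den g x *: homog h (pact g x)) 0 0 = den g x * den h (pact g x).
  by rewrite linearZ /= [LHS]mxE.
by rewrite scalerA invfM mulrC mulrA mulfV // mul1r.
Qed.

Lemma pact1 x : pact 1%:M x = x.
Proof.
rewrite /pact /homog mulmx1 row_mxKl row_mxKr mxE eqxx.
by rewrite invr1 scale1r.
Qed.

Lemma orbit_self x : Defs.orbit Gamma x x.
Proof. by exists 1%:M; [case: gam|exact: pact1]. Qed.

Lemma orbit_pact g x : Gamma g -> Omega x -> Defs.orbit Gamma (pact g x) = Defs.orbit Gamma x.
Proof.
move=> Gg Ox; have [d0 Ogx] := pres Gg Ox.
have mulG := (let: And5 _ _ h _ _ := gam in h).
apply/seteqP; split => _ [h Gh <-].
  by exists (g *m h); [exact: mulG|rewrite pact_comp].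
exists (invmx g *m h); first by apply: mulG => //; exact: gamma_inv.
have [d0' _] := pres (gamma_inv Gg) Ogx.
by rewrite -pact_comp // pact_inv //; exact: gamma_unit.
Qed.

Lemma pact_continuous g x : Gamma g -> Omega x -> {for x, continuous (pact g)}.
Proof.
move=> Gg Ox; have [d0 _] := pres Gg Ox; apply: differentiable_continuous.
by have [] := is_diff_pact d0.
Qed.

(** The points at distance at least [r] from the complement: as [r] decreases to 0, an exhaustion of
    [Omega] by compact sets. *)
Definition inner_core (r : R) : set 'rV[R]_n :=
  [set x | forall z, `|z - x| < r -> Omega z].

Lemma inner_core_sub r : 0 < r -> inner_core r `<=` Omega.
Proof. by move=> r0 x; apply; rewrite subrr normr0. Qed.

Lemma inner_core_compact r : 0 < r -> compact (inner_core r).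
Proof.
move=> r0; apply: bounded_closed_compact.
  have [B B0 hB] := domain_bounded dom.
  exists B; split; first exact: num_real.
  by move=> M BM x /(inner_core_sub r0)/hB/le_trans; apply; exact: ltW.
have -> : inner_core r = \bigcap_(z in ~` Omega) [set x | r <= `|z - x|].
  apply/seteqP; split => x hx z.
    by move=> nOz /=; rewrite leNgt; apply/negP => /hx.
  by move=> zx; apply: contrapT => /hx /=; rewrite leNgt zx.
apply: closed_bigI => z _.
have -> : [set x | r <= `|z - x|] = (fun x => `|z - x|) @^-1` [set t | r <= t] by [].
apply: closed_comp; last exact: closed_ge.
move=> x _; apply: (@cvg_norm _ _ _ (nbhs x) _ (fun x : 'rV[R]_n => z - x)).
by apply: cvgB; [exact: cvg_cst|exact: cvg_id].
Qed.

Lemma inner_core_exhausts x : Omega x ->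
  exists k : nat, interior (inner_core (k.+1%:R^-1)) x.
Proof.
move=> Ox; have oO : open Omega by case: dom.
have /nbhs_ballP[e /= e0 he] := open_nbhs_nbhs (conj oO Ox).
have e2 : 0 < e / 2 by rewrite divr_gt0.
have [k hk] := ltr_add_invr e2; exists k; rewrite add0r in hk.
apply/nbhs_ballP; exists (e / 2) => //= y; rewrite -ball_normE /= => xy z zy.
apply: he; rewrite -ball_normE /=.
have -> : x - z = (x - y) - (z - y) by rewrite opprB addrA subrK.
by rewrite (le_lt_trans (ler_normB _ _)) // (splitr e) ltrD // (lt_trans zy).
Qed.

Lemma inner_core_le (r s : R) : r <= s -> inner_core s `<=` inner_core r.
Proof. by move=> rs x hx z zx; apply: hx; exact: lt_le_trans zx rs. Qed.

(** The interiors of the inner cores project to an increasing open cover of the orbit space, so a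
    single core meets every orbit. *)
Lemma cocompact : compact_quotient Gamma Omega ->
  exists K : set 'rV[R]_n, [/\ compact K, K `<=` Omega &
    forall x, Omega x -> exists2 g, Gamma g & K (pact g x)].
Proof.
move=> cq; pose U (k : nat) := interior (inner_core (k.+1%:R^-1)).
have r0 (k : nat) : 0 < k.+1%:R^-1 :> R by [].
have UO k x : U k x -> Omega x by move=> /interior_subset/(inner_core_sub (r0 k)).
have [||D _ hD] := cq nat setT (fun k => Defs.orbit Gamma @` U k).
- move=> k _; rewrite openE => x [Ox [y Uy yx]].
  have [g Gg gxy] : Defs.orbit Gamma x y by rewrite -yx; exact: orbit_self.
  have oO : open Omega by case: dom.
  have n1 := open_nbhs_nbhs (conj oO Ox).
  have n2 : nbhs x (fun x' => U k (pact g x')).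
    apply: (near_open (f := pact g) (A := U k)); last by rewrite gxy.
      exact: pact_continuous.
    exact: open_interior.
  apply: filterS2 n1 n2 => x' Ox' Ux'; split=> //.
  by exists (pact g x') => //; exact: orbit_pact.
- move=> _ [x Ox <-]; have [k Ukx] := inner_core_exhausts Ox.
  by exists k => //; exists x.
(* Cores grow with the index, so the largest index of the subcover suffices. An empty subcover gives
   [N = 0], and then [Omega] is empty. *)
pose N := (\max_(i <- finmap.enum_fset D) i)%N.
exists (inner_core (N.+1%:R^-1)); split.
- exact: inner_core_compact.
- exact: inner_core_sub.
move=> x Ox; have [|k /= kD [y Uy yx]] := hD (Defs.orbit Gamma x); first by exists x.
have [g Gg gxy] : Defs.orbit Gamma x y by rewrite -yx; exact: orbit_self.
exists g => //; rewrite gxy; move: Uy => /interior_subset; apply: inner_core_le.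
by rewrite lef_pV2 ?posrE // ler_nat ltnS; exact: leq_bigmax_seq.
Qed.

End Orbits.

(** * Regularity of the gauge *)

Definition hilb (R : realType) (n : nat) (Omega : set 'rV[R]_n)
    (w : 'rV[R]_n * 'rV[R]_n) : R :=
  tau Omega w + tau Omega (w.1, - w.2).

Definition quot (R : realType) (n : nat) (Omega : set 'rV[R]_n)
    (x xi w : 'rV[R]_n) (h : R) : R :=
  (tau Omega (x, xi + h *: w) - tau Omega (x, xi)) / h.

(* By convexity of [tau (x, _)] this infimum is its one-sided derivative at [xi]. *)
HB.lock Definition dirD (R : realType) (n : nat) (Omega : set 'rV[R]_n)
    (x xi w : 'rV[R]_n) : R :=
  inf [set quot Omega x xi w h | h in [set h | 0 < h]].

Section Directional.
Context {R : realType} {n : nat} (Omega : set 'rV[R]_n).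
Hypothesis dom : strictly_convex_domain Omega.
Local Notation tau := (tau Omega).
Implicit Types (x xi v w eta : 'rV[R]_n) (h t c : R).

Local Notation quot := (quot Omega).
Local Notation dirD := (dirD Omega).

(** Slopes of a convex function from a fixed point increase. Convexity comes from [tauD] applied to
    [k (xi + h w) = h (xi + k w) + (k - h) xi]. *)
Lemma quot_mono x xi w (h k : R) : Omega x -> 0 < h -> h <= k ->
  quot x xi w h <= quot x xi w k.
Proof.
move=> Ox h0 hk; have k0 : 0 < k by exact: lt_le_trans hk.
rewrite /quot ler_pdivrMr // mulrAC ler_pdivlMr //.
have hk0 : 0 <= k - h by rewrite subr_ge0.
suff : k * tau (x, xi + h *: w) <= h * tau (x, xi + k *: w) + (k - h) * tau (x, xi) by nra.
rewrite -(tauZ dom _ Ox k0) -(tauZ dom _ Ox h0).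
have [->|kh] := eqVneq k h; first by rewrite subrr mul0r addr0.
have kh0 : 0 < k - h by rewrite lt_neqAle hk0 andbT eq_sym subr_eq0.
rewrite -(tauZ dom xi Ox kh0); apply: le_trans (tauD dom _ _ Ox).
rewrite le_eqVlt; apply/orP; left; apply/eqP; congr (tau (x, _)).
by apply/rowP => i; rewrite !mxE; ring.
Qed.

Lemma quot_ge x xi w h : Omega x -> 0 < h -> - tau (x, - w) <= quot x xi w h.
Proof.
move=> Ox h0; rewrite /quot ler_pdivlMr // mulNr mulrC -tauZ // lerNl opprB lerBlDl.
apply: le_trans (tauD dom _ _ Ox).
by rewrite scalerN addrK.
Qed.

Lemma dirD_le_quot x xi w h : Omega x -> 0 < h -> dirD x xi w <= quot x xi w h.
Proof.
move=> Ox h0; rewrite dirD.unlock; apply: ge_inf; last by exists h.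
by exists (- tau (x, - w)) => _ [k /= k0 <-]; exact: quot_ge.
Qed.

Lemma dirD_lt x xi w t : Omega x -> dirD x xi w < t ->
  exists2 k : R, 0 < k & forall h, 0 < h -> h <= k -> quot x xi w h < t.
Proof.
move=> Ox; rewrite dirD.unlock => /inf_lt; case=> [|_ [k /= k0 <-] kt].
  by exists (quot x xi w 1); exists 1 => //=.
by exists k => // h h0 hk; apply: le_lt_trans kt; exact: quot_mono.
Qed.

Lemma le_dirD x xi w t : (forall h, 0 < h -> t <= quot x xi w h) -> t <= dirD x xi w.
Proof.
move=> ht; rewrite dirD.unlock; apply: lb_le_inf; first by exists (quot x xi w 1); exists 1 => //=.
by move=> _ [h /= h0 <-]; exact: ht.
Qed.

Lemma dirD_le_tau x xi w : Omega x -> dirD x xi w <= tau (x, w).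
Proof.
move=> Ox; apply: (le_trans (dirD_le_quot xi w Ox ltr01)).
by rewrite /quot divr1 scale1r lerBlDl tauD.
Qed.

Lemma dirDZ x xi w c : Omega x -> 0 < c -> dirD x xi (c *: w) = c * dirD x xi w.
Proof.
move=> Ox c0; apply/eqP; rewrite eq_le; apply/andP; split.
- rewrite -ler_pdivrMl //; apply: le_dirD => h h0; rewrite ler_pdivrMl //.
  have hc : 0 < h / c by rewrite divr_gt0.
  apply: (le_trans (dirD_le_quot xi (c *: w) Ox hc)).
  rewrite /quot scalerA divfK ?gt_eqF // le_eqVlt; apply/orP; left; apply/eqP.
  by field; rewrite !gt_eqF.
- apply: le_dirD => h h0; have hc : 0 < h * c by rewrite mulr_gt0.
  rewrite -ler_pdivlMl //; apply: (le_trans (dirD_le_quot xi w Ox hc)).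
  rewrite /quot scalerA le_eqVlt; apply/orP; left; apply/eqP.
  by field; rewrite !gt_eqF.
Qed.

(** Midpoint convexity bounds the quotient of the sum at step [k / 2] by the two quotients at step
    [k], so one common step suffices. *)
Lemma dirDD x xi v w : Omega x -> dirD x xi (v + w) <= dirD x xi v + dirD x xi w.
Proof.
move=> Ox; apply/ler_addgt0Pr => e e0; have e2 : 0 < e / 2 by rewrite divr_gt0.
have [k1 k10 h1] : exists2 k : R, 0 < k & forall h, 0 < h -> h <= k ->
    quot x xi v h < dirD x xi v + e / 2 by apply: dirD_lt; rewrite // ltrDl.
have [k2 k20 h2] : exists2 k : R, 0 < k & forall h, 0 < h -> h <= k ->
    quot x xi w h < dirD x xi w + e / 2 by apply: dirD_lt; rewrite // ltrDl.
pose k := Num.min k1 k2; have k0 : 0 < k by rewrite lt_min k10.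
have kk1 : k <= k1 by rewrite ge_min lexx.
have kk2 : k <= k2 by rewrite ge_min lexx orbT.
have kh : 0 < k / 2 by rewrite divr_gt0.
apply: (le_trans (dirD_le_quot xi (v + w) Ox kh)).
have : quot x xi (v + w) (k / 2) <= quot x xi v k + quot x xi w k.
  rewrite /quot -mulrDl ler_pdivrMr // -mulrA [k^-1 * _]mulrA mulVf ?gt_eqF // mul1r.
  suff : tau (x, xi + (k / 2) *: (v + w)) * 2 <= tau (x, xi + k *: v) + tau (x, xi + k *: w).
    by lra.
  rewrite mulrC -tauZ //; apply: le_trans (tauD dom _ _ Ox).
  rewrite le_eqVlt; apply/orP; left; apply/eqP; congr (tau (x, _)).
  by apply/rowP => i; rewrite !mxE; field.
have := h1 k k0 kk1; have := h2 k k0 kk2; lra.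
Qed.

Lemma dirD0 x xi : Omega x -> dirD x xi 0 = 0.
Proof.
move=> Ox; apply/eqP; rewrite eq_le; apply/andP; split.
  by rewrite (le_trans (dirD_le_tau xi 0 Ox)) // tau0.
by apply: le_dirD => h h0; rewrite /quot scaler0 addr0 subrr mul0r.
Qed.

Lemma dirD_self x xi : Omega x -> dirD x xi xi = tau (x, xi).
Proof.
move=> Ox; apply/eqP; rewrite eq_le dirD_le_tau //=; apply: le_dirD => h h0.
have -> : tau (x, xi) = quot x xi xi h; last by [].
rewrite /quot (_ : xi + h *: xi = (1 + h) *: xi); last by rewrite scalerDl scale1r.
by rewrite tauZ ?addr_gt0 //; field; rewrite gt_eqF.
Qed.

Lemma dirDN_self x xi : Omega x -> dirD x xi (- xi) = - tau (x, xi).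
Proof.
(* At the step 1/2, [xi - h xi] is still a positive multiple of [xi], so homogeneity evaluates the
   quotient. *)
move=> Ox; have h0 : 0 < 2^-1 :> R by rewrite invr_gt0.
apply/eqP; rewrite eq_le; apply/andP; split.
  apply: (le_trans (dirD_le_quot xi (- xi) Ox h0)).
  rewrite /quot (_ : xi + 2^-1 *: - xi = 2^-1 *: xi); last first.
    by apply/rowP => i; rewrite !mxE; field.
  by rewrite tauZ // invrK; lra.
have := dirDD xi xi (- xi) Ox; rewrite subrr dirD0 // dirD_self //; lra.
Qed.

Lemma dirDZ_self x xi c : Omega x -> dirD x xi (c *: xi) = c * tau (x, xi).
Proof.
move=> Ox; have [c0|c0|<-] := ltrgtP 0 c.
- by rewrite dirDZ // dirD_self.
- have -> : c *: xi = (- c) *: (- xi) by rewrite scalerN scaleNr opprK.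
  by rewrite dirDZ ?oppr_gt0 // dirDN_self // mulrNN.
- by rewrite scale0r mul0r dirD0.
Qed.

(** The derivatives along [xi] and [- xi] are opposite by homogeneity, so subadditivity used in both
    directions becomes additivity along [xi]. *)
Lemma dirD_shift x xi w c : Omega x ->
  dirD x xi (w + c *: xi) = dirD x xi w + c * tau (x, xi).
Proof.
move=> Ox; apply/eqP; rewrite eq_le; apply/andP; split.
  by rewrite -(dirDZ_self xi c Ox) dirDD.
rewrite -lerBrDr -mulNr -(dirDZ_self xi (- c) Ox).
by apply: le_trans (dirDD _ _ _ Ox); rewrite scaleNr addrK.
Qed.

Lemma dirD_scale_base x xi w c : Omega x -> 0 < c -> dirD x (c *: xi) w = dirD x xi w.
Proof.
move=> Ox c0; have hq h : 0 < h -> quot x (c *: xi) w h = quot x xi w (h / c).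
  move=> h0; rewrite /quot (_ : c *: xi + h *: w = c *: (xi + (h / c) *: w)).
    by rewrite !tauZ //; field; rewrite !gt_eqF.
  by rewrite scalerDr scalerA mulrC divfK ?gt_eqF.
apply/eqP; rewrite eq_le; apply/andP; split; apply: le_dirD => h h0.
- have hc : 0 < h * c by rewrite mulr_gt0.
  by rewrite (le_trans (dirD_le_quot _ _ Ox hc)) // hq // mulfK ?gt_eqF.
- by rewrite hq // dirD_le_quot // divr_gt0.
Qed.

(* Blow-up at the boundary point [x + xi]: after rescaling, [Omega] seen from [x + (1 - e) xi] tends to its tangent cone. *)
Lemma tau_blowup x xi v (d : R) : Omega x -> tau (x, xi) = 1 -> 0 < d ->
  exists2 e0 : R, 0 < e0 & forall e, 0 < e -> e <= e0 ->
    Omega (x + (1 - e) *: xi) /\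
    `|tau (x + (1 - e) *: xi, e *: v) - Num.max (dirD x xi v) 0| <= d.
Proof.
move=> Ox t1 d0; set D := dirD x xi v; set m := Num.max D 0.
have m0 : 0 <= m by rewrite le_max lexx orbT.
have mD : D <= m by rewrite le_max lexx.
have Oe e : 0 < e -> e <= 1 -> Omega (x + (1 - e) *: xi).
  move=> e0 e1; have [->|ne1] := eqVneq e 1; first by rewrite subrr scale0r addr0.
  have e1' : 0 < 1 - e by rewrite subr_gt0 lt_neqAle ne1.
  rewrite -[1 - e]invrK; apply/tau_ltP; rewrite ?invr_gt0 // t1.
  by rewrite invf_gt1 //; lra.
(* Factoring [1 - e] out of the tested point [x + (1 - e) xi + (e / t) v] turns its membership in
   [Omega] into a bound on the difference quotient at [xi] with step [e / ((1 - e) t)]. *)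
have key e t : 0 < e -> e < 1 -> 0 < t ->
    tau (x + (1 - e) *: xi, e *: v) < t <-> quot x xi v (e / ((1 - e) * t)) < t.
  move=> e0 e1 tp; have e1' : 0 < 1 - e by rewrite subr_gt0.
  have Oxe := Oe _ e0 (ltW e1).
  set k := e / _; have k0 : 0 < k by rewrite divr_gt0 // mulr_gt0.
  have qE : quot x xi v k < t <-> tau (x, xi + k *: v) < (1 - e)^-1.
    rewrite /quot ltr_pdivrMr // t1 ltrBlDr.
    rewrite (_ : t * k + 1 = (1 - e)^-1) // /k; field.
    by rewrite !gt_eqF.
  have pe : 0 < (1 - e)^-1 by rewrite invr_gt0.
  apply: (iff_trans (tau_ltP dom _ Oxe tp)).
  apply: (iff_trans _ (iff_sym qE)).
  apply: (iff_trans _ (iff_sym (tau_ltP dom _ Ox pe))).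
  rewrite (_ : x + (1 - e) *: xi + t^-1 *: (e *: v) = x + (1 - e)^-1^-1 *: (xi + k *: v)) //.
  by apply/rowP => i; rewrite !mxE invrK /k; field; rewrite !gt_eqF.
have [k k0 hk] : exists2 k : R, 0 < k & forall h, 0 < h -> h <= k -> quot x xi v h < m + d.
  by apply: dirD_lt => //; rewrite (le_lt_trans mD) // ltrDl.
have md : 0 < m + d by rewrite ltr_wpDl.
(* With [e <= 1/2], the second bound makes the step [e / ((1 - e) (m + d))] at most [k]. *)
exists (Num.min 2^-1 (k * (m + d) / 2)).
  by rewrite lt_min invr_gt0 ltr0n /= divr_gt0 // mulr_gt0.
move=> e e0; rewrite le_min => /andP[e2 ek].
have e1 : e < 1 by lra.
split; first by apply: Oe => //; exact: ltW.
rewrite ler_distl; apply/andP; split; last first.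
  apply/ltW/key => //; apply: hk; first by rewrite divr_gt0 // mulr_gt0 // subr_gt0.
  rewrite ler_pdivrMr; last by rewrite mulr_gt0 // subr_gt0.
  nra.
(* The lower bound holds without error for every such [e], since each difference quotient is at
   least [dirD]. *)
rewrite lerBlDr; suff mt : m <= tau (x + (1 - e) *: xi, e *: v) by lra.
rewrite /m ge_max tau_ge0 andbT leNgt; apply/negP => tD.
have D0 : 0 < D by apply: le_lt_trans tD; exact: tau_ge0.
move: tD => /(key e D e0 e1 D0); apply/negP; rewrite -leNgt dirD_le_quot //.
by rewrite divr_gt0 // mulr_gt0 // subr_gt0.
Qed.

End Directional.

(** * Rules for continuity at a point *)

Section ContinuityAtPoint.
Context {R : realType} {T : topologicalType}.
Implicit Types (p : T).

Lemma cont_id p : {for p, continuous (fun q : T => q)}.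
Proof. exact: cvg_id. Qed.

Lemma cont_cst (U : topologicalType) (c : U) p : {for p, continuous (fun _ : T => c)}.
Proof. exact: cvg_cst. Qed.

Lemma cont_pair (U W : topologicalType) (f : T -> U) (g : T -> W) p :
  {for p, continuous f} -> {for p, continuous g} ->
  {for p, continuous (fun q => (f q, g q))}.
Proof. by move=> cf cg; apply: cvg_pair. Qed.

Lemma cont_fst (U W : topologicalType) (f : T -> U * W) p :
  {for p, continuous f} -> {for p, continuous (fun q => (f q).1)}.
Proof. by move=> cf; apply: (@continuous_comp _ _ _ f fst) => //; exact: cvg_fst. Qed.

Lemma cont_snd (U W : topologicalType) (f : T -> U * W) p :
  {for p, continuous f} -> {for p, continuous (fun q => (f q).2)}.
Proof. by move=> cf; apply: (@continuous_comp _ _ _ f snd) => //; exact: cvg_snd. Qed.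

Lemma cont_comp (U W : topologicalType) (f : T -> U) (g : U -> W) p :
  {for p, continuous f} -> {for f p, continuous g} -> {for p, continuous (fun q => g (f q))}.
Proof. exact: continuous_comp. Qed.

Lemma cont_add (W : normedModType R) (f g : T -> W) p :
  {for p, continuous f} -> {for p, continuous g} -> {for p, continuous (fun q => f q + g q)}.
Proof. by move=> cf cg; apply: cvgD. Qed.

Lemma cont_opp (W : normedModType R) (f : T -> W) p :
  {for p, continuous f} -> {for p, continuous (fun q => - f q)}.
Proof. by move=> cf; apply: cvgN. Qed.

Lemma cont_sub (W : normedModType R) (f g : T -> W) p :
  {for p, continuous f} -> {for p, continuous g} -> {for p, continuous (fun q => f q - g q)}.
Proof. by move=> cf cg; apply: cvgB. Qed.

Lemma cont_scale (W : normedModType R) (k : T -> R) (f : T -> W) p :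
  {for p, continuous k} -> {for p, continuous f} -> {for p, continuous (fun q => k q *: f q)}.
Proof. by move=> cf cg; apply: cvgZ. Qed.

Lemma cont_mul (k f : T -> R) p :
  {for p, continuous k} -> {for p, continuous f} -> {for p, continuous (fun q => k q * f q)}.
Proof. by move=> cf cg; apply: cvgM. Qed.

Lemma cont_inv (f : T -> R) p : f p != 0 ->
  {for p, continuous f} -> {for p, continuous (fun q => (f q)^-1)}.
Proof. by move=> f0 cf; apply: cvgV. Qed.

Lemma cont_norm (W : normedModType R) (f : T -> W) p :
  {for p, continuous f} -> {for p, continuous (fun q => `|f q|)}.
Proof. by move=> cf; apply: cvg_norm. Qed.

Lemma near_neq0 (W : normedModType R) (f : T -> W) p :
  {for p, continuous f} -> f p != 0 -> \forall q \near p, f q != 0.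
Proof.
move=> cf f0; have oN : open [set v : W | v != 0].
  have -> : [set v : W | v != 0] = ~` [set 0] by apply/seteqP; split => v /= /eqP.
  by apply: closed_openC; apply: accessible_closed_set1; apply: hausdorff_accessible; exact: norm_hausdorff.
exact: (near_open cf oN f0).
Qed.

End ContinuityAtPoint.

(** * The Euclidean scalar product *)

Section DotProduct.
Context {R : realType} {n : nat}.
Implicit Types x y z : 'rV[R]_n.

Lemma dotpE x y : dotp x y = \sum_i x 0 i * y 0 i.
Proof. by rewrite /dotp mxE; apply: eq_bigr => i _; rewrite mxE. Qed.

Lemma dotpC x y : dotp x y = dotp y x.
Proof. by rewrite !dotpE; apply: eq_bigr => i _; rewrite mulrC. Qed.

Lemma dotpDl x y z : dotp (x + y) z = dotp x z + dotp y z.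
Proof. by rewrite /dotp mulmxDl mxE. Qed.

Lemma dotpZl (a : R) x y : dotp (a *: x) y = a * dotp x y.
Proof. by rewrite /dotp -scalemxAl mxE. Qed.

Lemma dotpNl x y : dotp (- x) y = - dotp x y.
Proof. by rewrite -scaleN1r dotpZl mulN1r. Qed.

Lemma dotpBl x y z : dotp (x - y) z = dotp x z - dotp y z.
Proof. by rewrite dotpDl dotpNl. Qed.

Lemma dotpDr x y z : dotp x (y + z) = dotp x y + dotp x z.
Proof. by rewrite !(dotpC x) dotpDl. Qed.

Lemma dotpZr (a : R) x y : dotp x (a *: y) = a * dotp x y.
Proof. by rewrite !(dotpC x) dotpZl. Qed.

Lemma dotpBr x y z : dotp x (y - z) = dotp x y - dotp x z.
Proof. by rewrite !(dotpC x) dotpBl. Qed.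

Lemma dotp0l x : dotp 0 x = 0.
Proof. by rewrite /dotp mul0mx mxE. Qed.

Lemma dotp0r x : dotp x 0 = 0.
Proof. by rewrite dotpC dotp0l. Qed.

Lemma dotp_delta y i : dotp (delta_mx 0 i) y = y 0 i.
Proof.
rewrite dotpE (bigD1 i) //= mxE !eqxx mul1r big1 ?addr0 // => j ji.
by rewrite mxE eqxx (negbTE ji) mul0r.
Qed.

Lemma normr_coord x i : `|x 0 i| <= `|x|.
Proof.
rewrite [leRHS]/Num.Def.normr /= mx_normrE.
exact: (le_bigmax _ (fun i : 'I_1 * 'I_n => `|x i.1 i.2|) (0, i)).
Qed.

Lemma dotp_bound x y : `|dotp x y| <= n%:R * `|x| * `|y|.
Proof.
rewrite dotpE (le_trans (ler_norm_sum _ _ _)) //.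
have -> : n%:R * `|x| * `|y| = \sum_(i < n) `|x| * `|y|.
  by rewrite sumr_const card_ord -mulrA mulr_natl.
by apply: ler_sum => i _; rewrite normrM ler_pM // normr_coord.
Qed.

Lemma dotp_is_bilinear : bilinear_for
  (GRing.Scale.Law.clone _ _ *:%R _) (GRing.Scale.Law.clone _ _ *:%R _)
  (@dotp R n : 'rV[R]_n -> 'rV[R]_n -> R^o).
Proof.
split=> [u'|u] a x y /=; first by rewrite dotpDl dotpZl.
by rewrite dotpDr dotpZr.
Qed.
HB.instance Definition _ :=
  bilinear_isBilinear.Build R 'rV[R]_n 'rV[R]_n R^o _ _ (@dotp R n) dotp_is_bilinear.

Lemma dotp_continuous : continuous (fun p : 'rV[R]_n * 'rV[R]_n => dotp p.1 p.2).
Proof.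
have -> : (fun p : 'rV[R]_n * 'rV[R]_n => dotp p.1 p.2) = (fun p => \sum_i p.1 0 i * p.2 0 i).
  by apply/funext => p; rewrite dotpE.
apply: continuous_big => [|i _ p]; first exact: add_continuous.
have c1 : {for p, continuous (fun q : 'rV[R]_n * 'rV[R]_n => q.1 0 i)}.
  by apply: (continuous_comp (g := fun v : 'rV[R]_n => v 0 i)); [exact: cvg_fst|exact: coord_continuous].
have c2 : {for p, continuous (fun q : 'rV[R]_n * 'rV[R]_n => q.2 0 i)}.
  by apply: (continuous_comp (g := fun v : 'rV[R]_n => v 0 i)); [exact: cvg_snd|exact: coord_continuous].
exact: (continuousM c1 c2).
Qed.

Lemma is_diff_dotp (V : normedModType R) (f g : V -> 'rV[R]_n) df dg (x : V) :
  is_diff x f df -> is_diff x g dg ->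
  is_diff x (fun p => dotp (f p) (g p)) (fun h => dotp (f x) (dg h) + dotp (df h) (g x)).
Proof.
move=> fx gx.
refine (@is_diff_comp R V _ R (fun p => (f p, g p)) (fun h => (df h, dg h))
  (fun p => dotp p.1 p.2) (fun q => dotp (f x) q.2 + dotp q.1 (g x)) x
  (is_diff_pair fx gx) _).
have h := @diff_bilin R _ _ R^o (@dotp R n) (f x, g x) dotp_continuous.
apply: DiffDef; last exact: h.
exact: (@differentiable_bilin R _ _ R^o (@dotp R n) (f x, g x) dotp_continuous).
Qed.

End DotProduct.

(** * The Hilbert norm and its limits at the boundary *)

Section HilbertNorm.
Context {R : realType} {n : nat} (Omega : set 'rV[R]_n).
Hypothesis dom : strictly_convex_domain Omega.
Local Notation tau := (tau Omega).
Local Notation hilb := (hilb Omega).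
Implicit Types (x xi v w eta : 'rV[R]_n) (h t c : R).

Lemma hilb_ge0 p : 0 <= hilb p.
Proof. by rewrite addr_ge0 ?tau_ge0. Qed.

Lemma hilb_gt0 x v : Omega x -> v != 0 -> 0 < hilb (x, v).
Proof. by move=> Ox v0; rewrite ltr_wpDr ?tau_ge0 ?tau_gt0. Qed.

Lemma hilbZ x v c : Omega x -> 0 < c -> hilb (x, c *: v) = c * hilb (x, v).
Proof. by move=> Ox c0; rewrite /hilb /= -scalerN !tauZ // mulrDr. Qed.

Lemma hilbD x v w : Omega x -> hilb (x, v + w) <= hilb (x, v) + hilb (x, w).
Proof.
move=> Ox; rewrite /hilb /= opprD.
have := tauD dom v w Ox; have := tauD dom (- v) (- w) Ox.
move: (tau _) (tau _) (tau _) (tau _) (tau _) (tau _) => *; lra.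
Qed.

Lemma hilb0 x : Omega x -> hilb (x, 0) = 0.
Proof. by move=> Ox; rewrite /hilb /= oppr0 !tau0 // addr0. Qed.

(** The limit norm at a corner would violate this, having the same value at [w] and [v + w] and
    being additive on them. Two vectors with the same exit point are positively proportional, and
    equal norms would then give [v = 0]; so the exit points differ and [tau_strict] applies. *)
Lemma hilb_strict x v w : Omega x -> v != 0 ->
  hilb (x, w) = hilb (x, v + w) -> hilb (x, v + 2 *: w) < hilb (x, w) + hilb (x, v + w).
Proof.
move=> Ox v0 vw.
have w0 : w != 0.
  apply/eqP => w0; move: vw; rewrite w0 addr0 hilb0 // => h.
  by have := hilb_gt0 Ox v0; rewrite -h ltxx.
have vw0 : v + w != 0.
  apply/eqP => h; move: vw; rewrite h hilb0 //; apply/eqP.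
  by rewrite gt_eqF // hilb_gt0.
have -> : v + 2 *: w = w + (v + w) by apply/rowP => i; rewrite !mxE; ring.
have [e|ne] := eqVneq ((tau (x, w))^-1 *: w) ((tau (x, v + w))^-1 *: (v + w)).
  have tw := tau_gt0 dom Ox w0; have tvw := tau_gt0 dom Ox vw0.
  pose c := tau (x, v + w) / tau (x, w).
  have c0 : 0 < c by rewrite divr_gt0.
  have vwE : v + w = c *: w.
    by rewrite /c mulrC mulrC -scalerA e scalerA mulfV ?scale1r // gt_eqF.
  have c1 : c = 1.
    have hw := hilb_gt0 Ox w0; move: vw; rewrite vwE hilbZ // => h.
    by apply: (mulIf (lt0r_neq0 hw)); rewrite mul1r -h.
  have : v = 0 by apply: (addIr w); rewrite vwE c1 scale1r add0r.
  by move/eqP; rewrite (negbTE v0).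
have h1 := tau_strict dom Ox w0 vw0 ne.
have h2 := tauD dom (- w) (- (v + w)) Ox.
rewrite /hilb /= opprD; move: h1 h2.
by move: (tau _) (tau _) (tau _) (tau _) (tau _) (tau _) => *; lra.
Qed.

Lemma hilb_continuous x v : Omega x -> {for (x, v), continuous hilb}.
Proof.
move=> Ox; have cs := @cont_snd _ _ _ (fun p => p) (x, v) (@cont_id _ _).
have cf := @cont_fst _ _ _ (fun p => p) (x, v) (@cont_id _ _).
apply: cont_add; first exact: tau_continuous.
apply: (cont_comp (f := fun w : 'rV[R]_n * 'rV[R]_n => (w.1, - w.2))).
  exact: (cont_pair cf (cont_opp cs)).
exact: tau_continuous.
Qed.

Lemma tau_upper (K : set 'rV[R]_n) : compact K -> K `<=` Omega ->
  exists2 C : R, 0 < C & forall x v, K x -> tau (x, v) <= C * `|v|.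
Proof.
move=> cK KO.
have cKS := compact_setX cK (@compact_shell R n 1 1).
have [[x v] [/= /KO Ox _]|C C0 hC] := compact_upper (f := tau) cKS; first exact: tau_continuous.
exists C => // x v Kx; have [->|v0] := eqVneq v 0.
  by rewrite tau0 ?normr0 ?mulr0 //; exact: KO.
have nv : 0 < `|v| by rewrite normr_gt0.
pose u := `|v|^-1 *: v; have vE : v = `|v| *: u by rewrite scalerA mulfV ?gt_eqF // scale1r.
have u1 : `|u| = 1 by rewrite normrZ ger0_norm ?invr_ge0 // mulVf // gt_eqF.
have -> : tau (x, v) = `|v| * tau (x, u) by rewrite {1}vE tauZ //; exact: KO.
rewrite mulrC ler_pM2r //; apply: (hC (x, u)); split=> //=.
by rewrite u1.
Qed.

Lemma hilb_blowup x xi v (d : R) : Omega x -> tau (x, xi) = 1 -> 0 < d ->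
  exists2 e0 : R, 0 < e0 & forall e, 0 < e -> e <= e0 ->
    Omega (x + (1 - e) *: xi) /\
    `|hilb (x + (1 - e) *: xi, e *: v) -
      (Num.max (dirD Omega x xi v) 0 + Num.max (dirD Omega x xi (- v)) 0)| <= d.
Proof.
move=> Ox t1 d0; have d2 : 0 < d / 2 by rewrite divr_gt0.
have [e1 e10 h1] := tau_blowup dom v Ox t1 d2.
have [e2 e20 h2] := tau_blowup dom (- v) Ox t1 d2.
exists (Num.min e1 e2); first by rewrite lt_min e10.
move=> e e0; rewrite le_min => /andP[/(h1 e e0)[Oe +] /(h2 e e0)[_ +]] {h1 h2}.
rewrite /hilb /= -scalerN; move: (tau _) (tau _) (Num.max _ _) (Num.max _ _) => a b c c' h1 h2.
split=> //; have -> : b + a - (c' + c) = (b - c') + (a - c) by ring.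
by rewrite (le_trans (ler_normD _ _)) // (splitr d) lerD.
Qed.

End HilbertNorm.

(* The gauge has a two-sided derivative, i.e. there are no corners on the boundary. *)
Definition gauge_C1 (R : realType) (n : nat) (Omega : set 'rV[R]_n) : Prop :=
  forall x xi eta, Omega x -> xi != 0 ->
    dirD Omega x xi (- eta) = - dirD Omega x xi eta.

(** * Absence of corners on the boundary *)

Section Corners.
Context {R : realType} {n : nat} (Omega : set 'rV[R]_n).
Hypothesis dom : strictly_convex_domain Omega.
Local Notation V := 'rV[R]_n.
Local Notation tau := (tau Omega).
Local Notation hilb := (hilb Omega).
Local Notation dirD := (dirD Omega).
Implicit Types (x xi v w eta : 'rV[R]_n) (h t c : R).

Variable K : set 'rV[R]_n.
Hypotheses (cK : compact K) (KO : K `<=` Omega).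
(** What the corner argument uses of the group: the Hilbert norm at any point is carried linearly to
    the one at a point of [K]. *)
Hypothesis transport : forall x, Omega x -> exists (y : V) (A : V -> V),
  [/\ K y, linear A & forall v, hilb (y, A v) = hilb (x, v)].

(* A corner at the boundary point [x + xi] would blow up to a plane section on which the Hilbert norm is hexagonal, whereas cocompactness carries the blow-ups to a compact set, on which that norm is uniformly strictly convex. *)
Lemma dirD_symmetric x xi eta : Omega x -> tau (x, xi) = 1 ->
  dirD x xi eta + dirD x xi (- eta) = 0.
Proof.
move=> Ox t1; apply/eqP; rewrite eq_le; apply/andP; split; last first.
  by have := dirDD dom xi eta (- eta) Ox; rewrite subrr dirD0.
rewrite leNgt; apply/negP; move pE: (dirD x xi eta) => dp; move qE: (dirD x xi (- eta)) => dq s0.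
(* Adding a multiple of [xi] shifts the two one-sided slopes in opposite senses, so [c] makes them
   equal to their mean. This mean is positive at a corner and is scaled to 1. *)
pose c := (dq - dp) / 2; pose b := (2 / (dp + dq)) *: (eta + c *: xi).
have s2 : 0 < 2 / (dp + dq) by rewrite divr_gt0.
have b1 : dirD x xi b = 1.
  rewrite dirDZ // dirD_shift // t1 /c pE.
  by field; rewrite gt_eqF.
have b2 : dirD x xi (- b) = 1.
  rewrite /b -scalerN opprD -scaleNr dirDZ // dirD_shift // t1 /c qE.
  by field; rewrite gt_eqF.
clearbody b.
have Dab k : 0 <= k -> dirD x xi (xi + k *: b) = k + 1.
  rewrite le_eqVlt => /orP[/eqP<-|k0].
    by rewrite scale0r addr0 add0r dirD_self.
  have -> : xi + k *: b = k *: b + 1 *: xi by rewrite scale1r addrC.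
  by rewrite dirD_shift // dirDZ // b1 t1 mulr1 mul1r.
have DNab k : 0 <= k -> dirD x xi (- (xi + k *: b)) = k - 1.
  rewrite le_eqVlt => /orP[/eqP<-|k0].
    by rewrite scale0r addr0 add0r dirDN_self // t1.
  have -> : - (xi + k *: b) = k *: (- b) + (-1) *: xi by rewrite opprD addrC scalerN scaleN1r.
  by rewrite dirD_shift // dirDZ // b2 t1 mulr1 mulr1.
have max0 (r : R) : 0 <= r -> Num.max r 0 = r by move=> r0; apply/max_idPl.
have min0 (r : R) : r <= 0 -> Num.max r 0 = 0 by move=> r0; apply/max_idPr.
have Mx : Num.max (dirD x xi xi) 0 + Num.max (dirD x xi (- xi)) 0 = 1.
  by rewrite dirD_self // dirDN_self // t1 max0 // min0 ?lerN10 // addr0.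
have Mb : Num.max (dirD x xi b) 0 + Num.max (dirD x xi (- b)) 0 = 2.
  by rewrite b1 b2 max0.
have M1 : Num.max (dirD x xi (xi + 1 *: b)) 0 + Num.max (dirD x xi (- (xi + 1 *: b))) 0 = 2.
  by rewrite Dab // DNab // subrr max0 // min0 // addr0.
have M2 : Num.max (dirD x xi (xi + 2 *: b)) 0 + Num.max (dirD x xi (- (xi + 2 *: b))) 0 = 4.
  rewrite Dab // DNab // [2 - 1](_ : _ = 1); last by ring.
  by rewrite !max0 ?addr_ge0 //; ring.
have [B B0 hB] := tau_lower dom.
have [C C0 hC] := tau_upper dom cK KO.
(* The rescaled vectors will have norms N within 1/2 of 1 and 2 respectively. The comparison of N
   with the sup norm, by [B] from below and [2 C] from above, then gives these shells; the lower
   bound keeps the first vector away from 0. *)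
pose Q := K `*` ([set v : V | (4 * C)^-1 <= `|v| /\ `|v| <= 3 * B] `*`
                 [set v : V | 0 <= `|v| /\ `|v| <= 3 * B]).
have cQ : compact Q by apply: compact_setX => //; apply: compact_setX; exact: compact_shell.
(* The defect of additivity of N on the pair, plus the difference of the two norms. Both vanish for
   the limit norm at a corner, whereas [hilb_strict] makes the sum positive on [Q]. *)
pose Phi (p : V * (V * V)) := (hilb (p.1, p.2.2) + hilb (p.1, p.2.1 + p.2.2) -
  hilb (p.1, p.2.1 + 2 *: p.2.2)) + `|hilb (p.1, p.2.2) - hilb (p.1, p.2.1 + p.2.2)|.
have cPhi p : Q p -> {for p, continuous Phi}.
  move=> [/KO Op _].
  have c2 := @cont_snd _ _ _ (fun p : V * (V * V) => p) p (@cont_id _ _).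
  have c1 := @cont_fst _ _ _ (fun p : V * (V * V) => p) p (@cont_id _ _).
  have c21 := cont_fst c2; have c22 := cont_snd c2.
  have cc (i j : R) : {for p, continuous (fun p : V * (V * V) => hilb (p.1, i *: p.2.1 + j *: p.2.2))}.
    apply: (@cont_comp _ _ _ (fun p : V * (V * V) => (p.1, i *: p.2.1 + j *: p.2.2)) hilb p).
      apply: (cont_pair c1); apply: cont_add.
        by apply: cont_scale; [exact: cont_cst|exact: c21].
      by apply: cont_scale; [exact: cont_cst|exact: c22].
    exact: hilb_continuous.
  have c01 := cc 0 1; have c11 := cc 1 1; have c12 := cc 1 2.
  have -> : Phi = (fun p => (hilb (p.1, 0 *: p.2.1 + 1 *: p.2.2) +
      hilb (p.1, 1 *: p.2.1 + 1 *: p.2.2) - hilb (p.1, 1 *: p.2.1 + 2 *: p.2.2)) +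
      `|hilb (p.1, 0 *: p.2.1 + 1 *: p.2.2) - hilb (p.1, 1 *: p.2.1 + 1 *: p.2.2)|).
    by apply/funext => q; rewrite /Phi scale0r add0r !scale1r.
  have c3 := cont_sub (cont_add c01 c11) c12.
  exact: (cont_add c3 (cont_norm (cont_sub c01 c11))).
have Phi0 p : Q p -> 0 < Phi p.
  move=> [/KO Op [[/= a0 _] _]]; rewrite /Phi.
  have a1 : p.2.1 != 0.
    by rewrite -normr_gt0 (lt_le_trans _ a0) // invr_gt0 mulr_gt0.
  have [e|ne] := eqVneq (hilb (p.1, p.2.2)) (hilb (p.1, p.2.1 + p.2.2)).
    rewrite {2}e subrr normr0 addr0 subr_gt0; exact: hilb_strict.
  rewrite ltr_wpDl // ?normr_gt0 ?subr_eq0 // subr_ge0.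
  have -> : p.2.1 + 2 *: p.2.2 = p.2.2 + (p.2.1 + p.2.2).
    by apply/rowP => i; rewrite !mxE; ring.
  exact: hilbD.
have [de de0 hde] := compact_lower cQ cPhi Phi0.
(* The four approximations within [d] leave a defect of at most [3 d] and a difference of norms of
   at most [2 d], so [Phi <= 5 d < de]. *)
pose d := Num.min 2^-1 (de / 6).
have d0 : 0 < d by rewrite lt_min invr_gt0 ltr0n /= divr_gt0.
have dh : d <= 2^-1 by rewrite ge_min lexx.
have dd : d <= de / 6 by rewrite ge_min lexx orbT.
have [e1 e10 h1] := hilb_blowup dom xi Ox t1 d0.
have [e2 e20 h2] := hilb_blowup dom b Ox t1 d0.
have [e3 e30 h3] := hilb_blowup dom (xi + 1 *: b) Ox t1 d0.
have [e4 e40 h4] := hilb_blowup dom (xi + 2 *: b) Ox t1 d0.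
pose e := Num.min (Num.min e1 e2) (Num.min e3 e4).
have e0 : 0 < e by rewrite !lt_min e10 e20 e30.
have le1 : e <= e1 by rewrite /e !ge_min lexx.
have le2 : e <= e2 by rewrite /e !ge_min lexx !orbT.
have le3 : e <= e3 by rewrite /e !ge_min lexx !orbT.
have le4 : e <= e4 by rewrite /e !ge_min lexx !orbT.
have [Oe] := h1 e e0 le1; have [_] := h2 e e0 le2.
have [_] := h3 e e0 le3; have [_] := h4 e e0 le4.
rewrite Mx Mb M1 M2.
have [y [A [Ky lA hA]]] := transport Oe.
have A0 : A 0 = 0 by have := lA (-1) 0 0; rewrite scaler0 addr0 scaleN1r addNr.
have AD u v : A (u + v) = A u + A v by have := lA 1 u v; rewrite !scale1r.
have AZ k u : A (k *: u) = k *: A u by have := lA k u 0; rewrite A0 !addr0.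
have eb : e *: (2 *: b) = 2 *: (e *: b) by rewrite !scalerA mulrC.
rewrite -!hA scale1r !scalerDr !AD eb (AZ 2).
move: (A (e *: xi)) (A (e *: b)) => a' b'.
have Oy := KO Ky.
have hi v : tau (y, v) <= hilb (y, v) by rewrite /hilb /= lerDl tau_ge0.
have na : `|a'| <= B * hilb (y, a').
  by apply: (le_trans (hB y a' Oy)); rewrite ler_pM2l //; exact: hi.
have nb : `|b'| <= B * hilb (y, b').
  by apply: (le_trans (hB y b' Oy)); rewrite ler_pM2l //; exact: hi.
have na0 : hilb (y, a') <= 2 * C * `|a'|.
  rewrite -mulrA mulr_natl mulr2n /hilb /=; apply: lerD; first exact: hC.
  by rewrite -normrN; exact: hC.
have hQ : (4 * C)^-1 <= `|a'| -> `|a'| <= 3 * B -> `|b'| <= 3 * B -> de <= Phi (y, (a', b')).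
  by move=> q1 q2 q3; apply: hde; split=> //=; split=> /=; split.
move: na nb na0 hQ; rewrite /Phi /=.
move: (hilb (y, a')) (hilb (y, b')) (hilb (y, a' + b')) (hilb (y, a' + 2 *: b')) (`|a'|) (`|b'|).
clear b1 b2 Dab DNab Mx Mb M1 M2 pE qE t1 hi hA hB hC.
move=> ha hb hab hab2 ra rb na nb na0 hQ.
rewrite !ler_distl => /andP[k1 k2] /andP[k3 k4] /andP[k5 k6] /andP[k7 k8].
have q1 : (4 * C)^-1 <= ra.
  by rewrite -[leLHS]mul1r ler_pdivrMr ?mulr_gt0 //; lra.
have q2 : ra <= 3 * B by nra.
have q3 : rb <= 3 * B by nra.
have := hQ q1 q2 q3.
have : `|hb - hab| <= 2 * d.
  by clear - k1 k2 k3 k4 k5 k6 k7 k8; rewrite ler_norml; apply/andP; split; lra.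
lra.
Qed.

Lemma cocompact_gauge_C1 : gauge_C1 Omega.
Proof.
move=> x xi eta Ox xi0; have t0 := tau_gt0 dom Ox xi0.
have ti : 0 < (tau (x, xi))^-1 by rewrite invr_gt0.
rewrite -!(dirD_scale_base dom xi _ Ox ti); apply/eqP; rewrite -addr_eq0 addrC; apply/eqP.
by apply: dirD_symmetric => //; rewrite tauZ // mulVf // gt_eqF.
Qed.

End Corners.

(** The vector of one-sided partial derivatives; it represents [dirD] through the scalar product
    once [gauge_C1] makes [dirD] linear. *)
Definition tau_grad (R : realType) (n : nat) (Omega : set 'rV[R]_n)
    (p : 'rV[R]_n * 'rV[R]_n) : 'rV[R]_n :=
  \row_i dirD Omega p.1 p.2 (delta_mx 0 i).

(** * Joint differentiability of the gauge *)

Section Differentiability.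
Context {R : realType} {n : nat} (Omega : set 'rV[R]_n).
Hypothesis dom : strictly_convex_domain Omega.
Hypothesis dirD_opp : gauge_C1 Omega.
Local Notation V := 'rV[R]_n.
Local Notation tau := (tau Omega).
Local Notation dirD := (dirD Omega).
Local Notation tau_grad := (tau_grad Omega).
Implicit Types (x xi v w eta : 'rV[R]_n) (h t c : R).

Lemma dirD_add x xi v w : Omega x -> xi != 0 ->
  dirD x xi (v + w) = dirD x xi v + dirD x xi w.
Proof.
move=> Ox xi0; apply/eqP; rewrite eq_le dirDD //=.
have := dirDD dom xi (- v) (- w) Ox; rewrite -opprD !dirD_opp //; lra.
Qed.

Lemma dirD_scale x xi w c : Omega x -> xi != 0 -> dirD x xi (c *: w) = c * dirD x xi w.
Proof.
move=> Ox xi0; have [c0|c0|<-] := ltrgtP 0 c.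
- exact: dirDZ.
- have -> : c *: w = (- c) *: (- w) by rewrite scalerN scaleNr opprK.
  by rewrite dirDZ ?oppr_gt0 // dirD_opp // mulrNN.
- by rewrite scale0r mul0r dirD0.
Qed.

Lemma dirD_grad x xi w : Omega x -> xi != 0 -> dirD x xi w = dotp w (tau_grad (x, xi)).
Proof.
move=> Ox xi0; rewrite dotpE {1}[w]row_sum_delta.
elim/big_ind2: _ => [|a b u v <- <-|i _].
- exact: dirD0.
- exact: dirD_add.
- by rewrite dirD_scale // mxE.
Qed.

(** An infimum of continuous functions is upper semicontinuous. Applied to [w] and [- w], whose
    derivatives are opposite, this gives both estimates. *)
Lemma dirD_continuous x xi w : Omega x -> xi != 0 ->
  {for (x, xi), continuous (fun p => dirD p.1 p.2 w)}.
Proof.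
move=> Ox xi0; have oO : open Omega by case: dom.
have usc (v : V) e : 0 < e -> \forall p \near (x, xi), dirD p.1 p.2 v < dirD x xi v + e.
  move=> e0; have lt0 : dirD x xi v < dirD x xi v + e by rewrite ltrDl.
  have [h h0 /(_ h h0 (lexx h)) hq] := dirD_lt dom Ox lt0.
  have cs := @cont_snd _ _ _ (fun p => p) (x, xi) (@cont_id _ _).
  have cf := @cont_fst _ _ _ (fun p => p) (x, xi) (@cont_id _ _).
  have cq : {for (x, xi), continuous (fun p => quot Omega p.1 p.2 v h)}.
    have ct : {for (x, xi), continuous (fun p : V * V => tau (p.1, p.2 + h *: v))}.
      apply: (@cont_comp _ _ _ (fun p : V * V => (p.1, p.2 + h *: v)) tau).
        by apply: (cont_pair cf); apply: cont_add; [exact: cs|exact: cont_cst].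
      exact: tau_continuous.
    have ct' : {for (x, xi), continuous (fun p : V * V => tau (p.1, p.2))}.
      apply: (@cont_comp _ _ _ (fun p : V * V => (p.1, p.2)) tau).
        exact: (cont_pair cf cs).
      exact: tau_continuous.
    by apply: cont_mul; [exact: (cont_sub ct ct')|exact: cont_cst].
  have n1 : \forall p \near (x, xi), quot Omega p.1 p.2 v h < dirD x xi v + e.
    exact: (@near_open _ _ (fun p => quot Omega p.1 p.2 v h) [set t | t < dirD x xi v + e] _
      cq (@open_lt _ _) hq).
  have n2 : \forall p \near (x, xi), Omega p.1.
    exact: (@near_open (V * V)%type _ fst Omega (x, xi) cvg_fst oO Ox).
  near=> p; have Op : Omega p.1 by near: p.
  apply: (le_lt_trans (dirD_le_quot dom p.2 v Op h0)).
  by near: p.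
apply/cvgrPdist_le => e e0.
have n1 := usc w e e0; have n2 := usc (- w) e e0.
have n3 : \forall p \near (x, xi), Omega p.1.
  exact: (@near_open (V * V)%type _ fst Omega (x, xi) cvg_fst oO Ox).
have n4 : \forall p \near (x, xi), p.2 != 0.
  exact: (near_neq0 (@cont_snd _ _ _ (fun p => p) (x, xi) (@cont_id _ _)) xi0).
near=> p; have Op : Omega p.1 by near: p.
have p0 : p.2 != 0 by near: p.
have k1 : dirD p.1 p.2 w < dirD x xi w + e by near: p.
have k2 : dirD p.1 p.2 (- w) < dirD x xi (- w) + e by near: p.
rewrite !dirD_opp // in k2.
by rewrite ler_distl; apply/andP; split; lra.
Unshelve. all: by end_near. Qed.

Lemma tau_grad_continuous x xi : Omega x -> xi != 0 ->
  {for (x, xi), continuous tau_grad}.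
Proof.
move=> Ox xi0; apply: rV_continuous => i.
have -> : (fun p : V * V => tau_grad p 0 i) = (fun p => dirD p.1 p.2 (delta_mx 0 i)).
  by apply/funext => p; rewrite mxE.
exact: dirD_continuous.
Qed.

Lemma dotp_grad_le x xi v : Omega x -> xi != 0 -> dotp v (tau_grad (x, xi)) <= tau (x, v).
Proof. by move=> Ox xi0; rewrite -dirD_grad //; exact: dirD_le_tau. Qed.

Lemma dotp_grad_self x xi : Omega x -> xi != 0 -> dotp xi (tau_grad (x, xi)) = tau (x, xi).
Proof. by move=> Ox xi0; rewrite -dirD_grad // dirD_self. Qed.

(** The exit point of [(y, eta)] lies in the closed half-space bounded by the supporting hyperplane
    at the exit point of [(x, xi)]. Multiplying by [tau (y, eta)] clears the denominator. *)
Lemma tau_support x xi y eta : Omega x -> xi != 0 -> Omega y -> eta != 0 ->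
  dotp (eta - xi) (tau_grad (x, xi)) + tau (y, eta) * dotp (y - x) (tau_grad (x, xi))
  <= tau (y, eta) - tau (x, xi).
Proof.
move=> Ox xi0 Oy eta0; have t0 := tau_gt0 dom Oy eta0.
have : closure Omega (y + (tau (y, eta))^-1 *: eta) by apply/tau_leP.
set z := y + _ => Oz.
have z1 : tau (x, z - x) <= 1.
  by apply/(tau_leP dom _ Ox ltr01); rewrite invr1 scale1r addrC subrK.
have h1 := dotp_grad_le (z - x) Ox xi0.
have : dotp (z - x) (tau_grad (x, xi)) <= 1 by exact: le_trans h1 z1.
have -> : z - x = (y - x) + (tau (y, eta))^-1 *: eta by rewrite /z addrAC.
rewrite dotpDl dotpZl => h2.
have : tau (y, eta) * (dotp (y - x) (tau_grad (x, xi)) +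
    (tau (y, eta))^-1 * dotp eta (tau_grad (x, xi))) <= tau (y, eta) * 1.
  by rewrite ler_pM2l.
by rewrite (dotpBl eta xi) dotp_grad_self // mulrDr mulVKf ?gt_eqF // mulr1; lra.
Qed.

(** [tau_support] bounds the increment from below, and with the two points exchanged from above.
    Both bounds differ from the linear part by a product of increments, controlled by continuity of
    [tau] and [tau_grad]. *)
Lemma is_diff_tau x xi : Omega x -> xi != 0 ->
  is_diff (x, xi) tau (fun Z => dotp Z.2 (tau_grad (x, xi)) +
    tau (x, xi) * dotp Z.1 (tau_grad (x, xi))).
Proof.
move=> Ox xi0; have oO : open Omega by case: dom.
set G := tau_grad (x, xi); set L := fun Z => _.
have lL : linear (L : V * V -> R^o).
  by move=> c a b; rewrite /L /= !(dotpDl, dotpZl) /GRing.scale /=; ring.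
pose LL := HB.pack_for {linear (V * V)%type -> R^o} L (GRing.isLinear.Build _ _ _ _ L lL).
have cL : continuous LL.
  move=> p; have cs := @cont_snd _ _ _ (fun p : V * V => p) p (@cont_id _ _).
  have cf := @cont_fst _ _ _ (fun p : V * V => p) p (@cont_id _ _).
  have c1 : {for p, continuous (fun p : V * V => dotp p.2 G)}.
    apply: (@cont_comp _ _ _ (fun p : V * V => (p.2, G)) (fun q => dotp q.1 q.2)).
      by apply: (cont_pair cs); exact: cont_cst.
    exact: dotp_continuous.
  have c2 : {for p, continuous (fun p : V * V => dotp p.1 G)}.
    apply: (@cont_comp _ _ _ (fun p : V * V => (p.1, G)) (fun q => dotp q.1 q.2)).
      by apply: (cont_pair cf); exact: cont_cst.
    exact: dotp_continuous.
  by apply: (cont_add c1); apply: cont_mul c2; exact: cont_cst.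
apply: (@is_diff_epsP R _ R^o tau LL (x, xi) cL) => e e0.
have t0 := tau_gt0 dom Ox xi0.
pose N : R := n%:R + 1; have N0 : 0 < N by rewrite /N ltr_wpDl.
have dN (a b : V) : `|dotp a b| <= N * `|a| * `|b|.
  rewrite (le_trans (dotp_bound a b)) // -!mulrA ler_wpM2r ?mulr_ge0 // /N.
  by rewrite lerDl.
(* Chosen so that the errors of the lower and upper bounds are at most [e] times the increment; the
   added 1 keeps the denominators positive. *)
pose e1 := e / (N * (`|G| + 1)).
have e10 : 0 < e1 by rewrite divr_gt0 // mulr_gt0 // ltr_wpDl.
pose e2 := e / (N * (tau (x, xi) + 1)).
have e20 : 0 < e2 by rewrite divr_gt0 // mulr_gt0 // ltr_wpDl // ltW.
have ct : \forall p \near (x, xi), `|tau (x, xi) - tau p| <= e1.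
  by have /cvgrPdist_le := tau_continuous dom (xi := xi) Ox; apply.
have cg : \forall p \near (x, xi), `|G - tau_grad p| <= e2.
  by have /cvgrPdist_le := tau_grad_continuous Ox xi0; apply.
have n3 : \forall p \near (x, xi), Omega p.1.
  exact: (@near_open (V * V)%type _ fst Omega (x, xi) cvg_fst oO Ox).
have n4 : \forall p \near (x, xi), p.2 != 0.
  exact: (near_neq0 (@cont_snd _ _ _ (fun p => p) (x, xi) (@cont_id _ _)) xi0).
have nn : \forall p \near (x, xi), [/\ `|tau (x, xi) - tau p| <= e1,
    `|G - tau_grad p| <= e2, Omega p.1 & p.2 != 0].
  by near=> p; split; near: p.
move: nn; rewrite (near_shift 0 (x, xi)) subr0; apply: filterS => h nh.
pose p := h + (x, xi).
have {nh}[k1 k2 Op p0] : [/\ `|tau (x, xi) - tau p| <= e1,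
    `|G - tau_grad p| <= e2, Omega p.1 & p.2 != 0] by exact: nh.
rewrite -/p.
have hE : h = (p.1 - x, p.2 - xi) by rewrite /p; case: (h) => a b /=; rewrite !addrK.
clearbody p; have pE : (p.1, p.2) = p by case: (p).
have s1 := tau_support Ox xi0 Op p0.
have s2 := tau_support Op p0 Ox xi0.
rewrite !pE -/G in s1 s2.
have h1 : `|p.1 - x| <= `|h| by rewrite hE prod_normE /= le_max lexx.
have h2 : `|p.2 - xi| <= `|h| by rewrite hE prod_normE /= le_max lexx orbT.
have LE : L h = dotp (p.2 - xi) G + tau (x, xi) * dotp (p.1 - x) G by rewrite /L hE.
rewrite [LL h](_ : _ = L h) // LE.
have lo : `|(tau p - tau (x, xi)) * dotp (p.1 - x) G| <= e * `|h|.
  rewrite normrM distrC; apply: (@le_trans _ _ (e1 * (N * `|h| * (`|G| + 1)))).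
    apply: ler_pM => //; apply: (le_trans (dN _ _)).
    apply: ler_pM => //; first by rewrite mulr_ge0 // ltW.
      by rewrite ler_pM2l.
    by rewrite lerDl.
  rewrite /e1 le_eqVlt; apply/orP; left; apply/eqP; field.
  by rewrite !gt_eqF // ltr_wpDl.
have up : `|dotp (p.2 - xi) (tau_grad p - G) + tau (x, xi) * dotp (p.1 - x) (tau_grad p - G)| <= e * `|h|.
  rewrite (le_trans (ler_normD _ _)) // normrM (gtr0_norm t0).
  have b1 : `|dotp (p.2 - xi) (tau_grad p - G)| <= N * `|h| * e2.
    apply: (le_trans (dN _ _)); apply: ler_pM => //; first by rewrite mulr_ge0 // ltW.
      by rewrite ler_pM2l.
    by rewrite distrC.
  have b2 : `|dotp (p.1 - x) (tau_grad p - G)| <= N * `|h| * e2.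
    apply: (le_trans (dN _ _)); apply: ler_pM => //; first by rewrite mulr_ge0 // ltW.
      by rewrite ler_pM2l.
    by rewrite distrC.
  apply: (@le_trans _ _ (N * `|h| * e2 + tau (x, xi) * (N * `|h| * e2))).
    by apply: lerD => //; rewrite ler_pM2l.
  rewrite /e2 le_eqVlt; apply/orP; left; apply/eqP; field.
  by rewrite !gt_eqF // ltr_wpDl // ltW.
move: lo up; rewrite !ler_norml => /andP[lo1 lo2] /andP[up1 up2].
have E1 : dotp (p.2 - xi) (tau_grad p - G) = - dotp (xi - p.2) (tau_grad p) - dotp (p.2 - xi) G.
  by rewrite dotpBr -(opprB xi) dotpNl.
have E2 : dotp (p.1 - x) (tau_grad p - G) = - dotp (x - p.1) (tau_grad p) - dotp (p.1 - x) G.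
  by rewrite dotpBr -(opprB x) dotpNl.
rewrite E1 E2 in up1 up2.
by apply/andP; split; nra.
Unshelve. all: by end_near. Qed.

(* Uniqueness of the supporting hyperplane at the exit point, which is the same for all base points of the line. *)
Lemma tau_grad_line x xi (s : R) : Omega x -> xi != 0 -> Omega (x + s *: xi) ->
  tau_grad (x + s *: xi, xi) = (1 - s * tau (x, xi))^-1 *: tau_grad (x, xi).
Proof.
move=> Ox xi0 Os; have s1 := tau_line_lt dom Ox xi0 Os.
have d0 : 0 < 1 - s * tau (x, xi) by rewrite subr_gt0.
set y := x + s *: xi; set nu := _ *: tau_grad (x, xi).
have nu_le v : dotp v nu <= tau (y, v).
  have [->|v0] := eqVneq v 0; first by rewrite dotp0l tau0.
  rewrite /nu dotpZr ler_pdivrMl //.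
  have yx : y - x = s *: xi by rewrite /y addrAC subrr add0r.
  have := tau_support Ox xi0 Os v0; rewrite dotpBl dotp_grad_self // yx.
  by rewrite dotpZl dotp_grad_self //; lra.
have nu_xi : dotp xi nu = tau (y, xi).
  by rewrite /nu dotpZr dotp_grad_self // tau_line // mulrC.
have D_ge v : dotp v nu <= dirD y xi v.
  apply: le_dirD => h h0; rewrite /quot ler_pdivlMr // mulrC -nu_xi -dotpZl lerBrDl -dotpDl.
  exact: nu_le.
apply/rowP => i; rewrite [LHS]mxE /=.
have -> : nu 0 i = dotp (delta_mx 0 i) nu.
  by rewrite dotp_delta.
apply/eqP; rewrite eq_le D_ge andbT.
by have := D_ge (- delta_mx 0 i); rewrite dotpNl dirD_opp // lerN2.
Qed.

End Differentiability.

(** * The generator and the splitting on HOmega *)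

Section EuclideanNorm.
Context {R : realType} {n : nat}.
Local Notation V := 'rV[R]_n.
Implicit Types (x y xi u : V) (c : R) (w Z : V * V).

Lemma dotp_ge0 x : 0 <= dotp x x.
Proof. by rewrite dotpE; apply: sumr_ge0 => i _; rewrite -expr2 sqr_ge0. Qed.

Lemma dotp_eq0 x : dotp x x = 0 -> x = 0.
Proof.
rewrite dotpE => /eqP; rewrite psumr_eq0 => [/allP h|i _]; last by rewrite -expr2 sqr_ge0.
apply/rowP => i; rewrite mxE; apply/eqP.
by have := h i (mem_index_enum _); rewrite mulf_eq0 orbb.
Qed.

Lemma enorm_sqr x : enorm x ^+ 2 = dotp x x.
Proof. by rewrite sqr_sqrtr // dotp_ge0. Qed.

Lemma enorm_gt0 x : x != 0 -> 0 < enorm x.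
Proof.
move=> x0; rewrite sqrtr_gt0 lt_neqAle dotp_ge0 andbT eq_sym.
by apply: contraNneq x0 => /dotp_eq0 ->.
Qed.

Lemma enormZ c x : enorm (c *: x) = `|c| * enorm x.
Proof. by rewrite /enorm dotpZl dotpZr mulrA -expr2 sqrtrM ?sqr_ge0 // sqrtr_sqr. Qed.

Lemma enormN x : enorm (- x) = enorm x.
Proof. by rewrite -scaleN1r enormZ normrN1 mul1r. Qed.

Lemma unit_dotp u : enorm u = 1 -> dotp u u = 1.
Proof. by move=> u1; rewrite -enorm_sqr u1 expr1n. Qed.

Lemma unit_neq0 u : enorm u = 1 -> u != 0.
Proof.
move=> /unit_dotp u1; apply/eqP => u0; move: u1.
by rewrite u0 dotp0l => /esym/eqP; rewrite oner_eq0.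
Qed.

Lemma normalize_id w : enorm w.2 = 1 -> normalize w = w.
Proof. by case: w => x u /= u1; rewrite /normalize /= u1 invr1 scale1r. Qed.

Lemma normalize_scale x xi c : 0 < c -> normalize (x, c *: xi) = normalize (x, xi).
Proof.
move=> c0; rewrite /normalize /= enormZ gtr0_norm // invfM scalerA.
by rewrite [c^-1 * _]mulrC -mulrA mulVf ?gt_eqF // mulr1.
Qed.

Lemma enorm_normalize w : w.2 != 0 -> enorm (normalize w).2 = 1.
Proof.
move=> w0; rewrite /normalize /= enormZ ger0_norm ?invr_ge0 ?ltW ?enorm_gt0 //.
by rewrite mulVf // gt_eqF // enorm_gt0.
Qed.

(** Dividing by the square of [xi] makes the projection depend on the direction of [xi] only, as
    suits maps extended by homogeneity. *)
Definition orth xi y : V := y - (dotp y xi / dotp xi xi) *: xi.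

Lemma orth_unit u y : enorm u = 1 -> orth u y = y - dotp y u *: u.
Proof. by move=> /unit_dotp u1; rewrite /orth u1 divr1. Qed.

Lemma orthP u y : enorm u = 1 -> dotp (orth u y) u = 0.
Proof. by move=> u1; rewrite orth_unit // dotpBl dotpZl unit_dotp // mulr1 subrr. Qed.

Lemma orth_id u y : enorm u = 1 -> dotp y u = 0 -> orth u y = y.
Proof. by move=> u1 yu; rewrite orth_unit // yu scale0r subr0. Qed.

Lemma orth_linear xi : linear (orth xi).
Proof.
by move=> c y z; rewrite /orth dotpDl dotpZl; apply/rowP => i; rewrite !mxE; ring.
Qed.

Lemma orth_self xi : xi != 0 -> orth xi xi = 0.
Proof.
move=> x0; rewrite /orth mulfV ?scale1r ?subrr //.
by apply: contraNneq x0 => /dotp_eq0 ->.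
Qed.

Lemma orth_scale c xi y : c != 0 -> orth (c *: xi) y = orth xi y.
Proof.
move=> c0; rewrite /orth !dotpZl !dotpZr scalerA; congr (_ - _ *: _).
have [->|d0] := eqVneq (dotp xi xi) 0; first by rewrite !mulr0 invr0 !mulr0 mul0r.
by field; rewrite c0 d0.
Qed.

Lemma is_diff_enorm (U : normedModType R) (f : U -> V) df (p : U) : f p != 0 ->
  is_diff p f df ->
  is_diff p (fun q => enorm (f q)) (fun h => dotp (df h) (f p) / enorm (f p)).
Proof.
move=> fp0 fp; have e0 := enorm_gt0 fp0.
have d0 : 0 < dotp (f p) (f p) by rewrite -enorm_sqr exprn_gt0.
have sq : is_diff (dotp (f p) (f p)) (Num.sqrt : R -> R^o)
    (fun h => h * (2 * Num.sqrt (dotp (f p) (f p)))^-1).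
  have [sd sE] := is_derive1_sqrt d0.
  have sd' := sd; move/derivable1_diffP: sd' => sd'.
  apply: DiffDef => //; apply/funext => h.
  have -> : h = h *: (1 : R) by rewrite /GRing.scale /= mulr1.
  by rewrite linearZ -deriveE // sE /GRing.scale /= mulr1.
apply: is_diff_eq; first exact: (is_diff_comp (is_diff_dotp fp fp) sq).
apply/funext => h; rewrite /= (dotpC (f p) (df h)) -/(enorm (f p)).
by field; rewrite gt_eqF.
Qed.

Lemma is_diff_normalize w : w.2 != 0 ->
  is_diff w (@normalize R n) (fun Z => (Z.1, (enorm w.2)^-1 *: orth w.2 Z.2)).
Proof.
move=> w0; have e0 := enorm_gt0 w0.
have d2 := is_diff_snd (is_diff_idfun w); have d1 := is_diff_fst (is_diff_idfun w).
apply: is_diff_eq; first apply: (is_diff_pair d1).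
  apply: (is_diff_scale (k := fun q => (enorm q.2)^-1) _ d2).
  by apply: is_diff_inv; [rewrite gt_eqF|exact: is_diff_enorm].
apply/funext => Z; congr (_, _); rewrite /orth -enorm_sqr.
by apply/rowP => i; rewrite !mxE; field; rewrite gt_eqF.
Qed.

End EuclideanNorm.

Section DomainBundle.
Context {R : realType} {n : nat} (Omega : set 'rV[R]_n).
Hypothesis dom : strictly_convex_domain Omega.
Local Notation V := 'rV[R]_n.
Implicit Types (w Z : V * V).

Lemma HOmega_sub w : HOmega Omega w -> TOmega0 Omega w.
Proof. by case=> Ow w1; split=> //; exact: unit_neq0. Qed.

Lemma HOmega_id w : HOmega Omega w -> normalize w = w.
Proof. by case=> _; exact: normalize_id. Qed.

Lemma normalize_HOmega w : TOmega0 Omega w -> HOmega Omega (normalize w).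
Proof. by case=> Ow w0; split=> //; exact: enorm_normalize. Qed.

Lemma near_TOmega0 w : TOmega0 Omega w -> \forall q \near w, TOmega0 Omega q.
Proof.
case=> Ow w0; have oO : open Omega by case: dom.
have n1 : \forall q \near w, Omega q.1.
  exact: (@near_open (V * V)%type _ fst Omega w cvg_fst oO Ow).
have n2 : \forall q \near w, q.2 != 0.
  exact: (@near_neq0 R (V * V)%type V snd w cvg_snd w0).
by near=> q; split; near: q.
Unshelve. all: by end_near. Qed.

Lemma dH_is_diff (E : normedModType R) (f g : V * V -> E) dg w Z :
  TOmega0 Omega w ->
  (forall q, TOmega0 Omega q -> f (normalize q) = g q) ->
  is_diff w g dg -> dH f w Z = dg Z.
Proof.
move=> Tw fg gw; rewrite /dH; apply: is_diff_derive; apply: near_is_diff gw.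
by near=> q; rewrite /= fg //; near: q; exact: near_TOmega0.
Unshelve. all: by end_near. Qed.

End DomainBundle.

(** * The generator in terms of the gauge *)

Section HilbertField.
Context {R : realType} {n : nat} (Omega : set 'rV[R]_n).
Hypothesis dom : strictly_convex_domain Omega.
Hypothesis C1 : gauge_C1 Omega.
Local Notation V := 'rV[R]_n.
Local Notation tau := (tau Omega).
Local Notation hilb := (hilb Omega).
Local Notation gp := (tau_grad Omega).
Implicit Types (x xi u : V) (c s : R) (w Z : V * V).

(** The backward quantities [sig] and [gm] are the forward ones at the flipped vector, so each
    backward lemma follows from its forward twin. *)
Definition flip w : V * V := (w.1, - w.2).
Local Notation sig w := (tau (flip w)).
Local Notation gm w := (gp (flip w)).

Definition dtau w Z : R := dotp Z.2 (gp w) + tau w * dotp Z.1 (gp w).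
Definition dsig w Z : R := - dotp Z.2 (gm w) + sig w * dotp Z.1 (gm w).
(** The function m on unit vectors, extended with degree -1 so that [speed w] times [w.2] depends on
    the class of [w] only. *)
Definition speed w : R := 2 / hilb w.
Definition dspeed w Z : R := - (2 / hilb w ^+ 2) * (dtau w Z + dsig w Z).

Lemma TOmega0_flip w : TOmega0 Omega w -> TOmega0 Omega (flip w).
Proof. by case=> Ow w0; split=> //=; rewrite oppr_eq0. Qed.

Lemma tau_pos w : TOmega0 Omega w -> 0 < tau w.
Proof. by case: w => x xi [Ox xi0]; exact: tau_gt0. Qed.

Lemma sig_pos w : TOmega0 Omega w -> 0 < sig w.
Proof. by move=> /TOmega0_flip/tau_pos. Qed.

Lemma hilb_pos w : TOmega0 Omega w -> 0 < hilb w.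
Proof. by move=> Tw; apply: addr_gt0; [exact: tau_pos|exact: sig_pos]. Qed.

Lemma speed_pos w : TOmega0 Omega w -> 0 < speed w.
Proof. by move=> Tw; rewrite divr_gt0 // hilb_pos. Qed.

Lemma gp_self w : TOmega0 Omega w -> dotp w.2 (gp w) = tau w.
Proof. by case: w => x xi [Ox xi0]; exact: dotp_grad_self. Qed.

Lemma gm_self w : TOmega0 Omega w -> dotp w.2 (gm w) = - sig w.
Proof. by move=> /TOmega0_flip/gp_self <-; rewrite dotpNl opprK. Qed.

Lemma is_diff_tau_pair w : TOmega0 Omega w -> is_diff w tau (dtau w).
Proof. by case: w => x xi [Ox xi0]; exact: is_diff_tau. Qed.

Lemma is_diff_flip w : is_diff w flip flip.
Proof.
apply: is_diff_pair; first exact: (is_diff_fst (is_diff_idfun w)).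
exact: (is_diff_opp (is_diff_snd (is_diff_idfun w))).
Qed.

Lemma is_diff_sig w : TOmega0 Omega w -> is_diff w (fun w => sig w) (dsig w).
Proof.
move=> Tw; have Tf := TOmega0_flip Tw.
apply: (is_diff_eq (is_diff_comp (is_diff_flip w) (is_diff_tau_pair Tf))).
by apply/funext => Z; rewrite /= /dtau /dsig /= dotpNl.
Qed.

Lemma is_diff_hilb w : TOmega0 Omega w ->
  is_diff w hilb (fun Z => dtau w Z + dsig w Z).
Proof. by move=> Tw; apply: is_diff_add; [exact: is_diff_tau_pair|exact: is_diff_sig]. Qed.

Lemma is_diff_speed w : TOmega0 Omega w -> is_diff w speed (dspeed w).
Proof.
move=> Tw; have h0 := hilb_pos Tw.
have hn : hilb w != 0 by rewrite gt_eqF.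
apply: (is_diff_eq (is_diff_mul (@is_diff_const R _ R^o 2 w) (is_diff_inv hn (is_diff_hilb Tw)))).
by apply/funext => Z; rewrite /dspeed mul0r addr0; field; rewrite gt_eqF.
Qed.

Lemma tau_scale w c : TOmega0 Omega w -> 0 < c -> tau (w.1, c *: w.2) = c * tau w.
Proof. by case: w => x xi [Ox _] c0 /=; rewrite tauZ. Qed.

Lemma sig_scale w c : TOmega0 Omega w -> 0 < c -> tau (w.1, - (c *: w.2)) = c * sig w.
Proof. by move=> Tw c0; rewrite -scalerN; exact: (tau_scale (TOmega0_flip Tw)). Qed.

Lemma speed_scale w c : TOmega0 Omega w -> 0 < c ->
  speed (w.1, c *: w.2) = speed w / c.
Proof.
move=> Tw c0; rewrite /speed /hilb /= tau_scale // (sig_scale Tw c0) -/(flip w).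
by rewrite -mulrDr invfM mulrCA mulrC.
Qed.

Lemma hilbert_mE w : HOmega Omega w -> hilbert_m Omega w = speed w.
Proof.
move=> Hw; have Tw := HOmega_sub Hw; have tp := tau_pos Tw; have sp := sig_pos Tw.
case: w Hw Tw tp sp => x u [/= Ox u1] [_ u0] tp sp.
rewrite /hilbert_m /= !exit_pointE ?oppr_eq0 // /speed /hilb /=.
move: tp sp; rewrite /flip /=; move: (tau _) (tau _) => t s t0 s0.
have e (c : R) : 0 <= c -> enorm (c *: u) = c by move=> c0; rewrite enormZ u1 mulr1 ger0_norm.
have eN (c : R) : 0 <= c -> enorm (c *: - u) = c by move=> c0; rewrite scalerN enormN e.
have -> : enorm (x - (x + s^-1 *: u)) = s^-1.
  by rewrite opprD addNKr enormN e // invr_ge0 ltW.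
have -> : enorm (x - (x + t^-1 *: - u)) = t^-1.
  by rewrite opprD addNKr enormN eN // invr_ge0 ltW.
have -> : enorm (x + s^-1 *: u - (x + t^-1 *: - u)) = s^-1 + t^-1.
  rewrite opprD addrACA subrr add0r scalerN opprK -scalerDl e //.
  by rewrite addr_ge0 // invr_ge0 ltW.
by field; rewrite !gt_eqF // addr_gt0.
Qed.

Lemma Xfield_normalize w : TOmega0 Omega w ->
  Xfield Omega (normalize w) = (speed w *: w.2, 0).
Proof.
move=> Tw; rewrite /Xfield hilbert_mE; last exact: normalize_HOmega.
have e0 : 0 < (enorm w.2)^-1 by rewrite invr_gt0 enorm_gt0 //; case: Tw.
rewrite /normalize /euclidean_spray /= speed_scale //.
by congr (_, _); rewrite ?scaler0 //= scalerA divfK // gt_eqF.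
Qed.

Lemma XfieldE w : HOmega Omega w -> Xfield Omega w = (speed w *: w.2, 0).
Proof. by move=> Hw; rewrite -{1}(HOmega_id Hw) Xfield_normalize //; exact: HOmega_sub. Qed.

Lemma dH_Xfield w Z : TOmega0 Omega w ->
  dH (Xfield Omega) w Z = (speed w *: Z.2 + dspeed w Z *: w.2, 0).
Proof.
move=> Tw; have d2 := is_diff_snd (is_diff_idfun w).
have d := is_diff_pair (is_diff_scale (is_diff_speed Tw) d2) (is_diff_const (0 : V) w).
by rewrite (dH_is_diff dom Z Tw _ d) // => q Tq; exact: Xfield_normalize.
Qed.

Lemma tau_shift w s : TOmega0 Omega w -> Omega (w.1 + s *: w.2) ->
  tau (w.1 + s *: w.2, w.2) = tau w / (1 - s * tau w) /\ s * tau w < 1.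
Proof.
case: w => x u [Ox u0] /= Os; have s1 := tau_line_lt dom Ox u0 Os.
by rewrite tau_line.
Qed.

(** Stated with a ratio of gauges: the right-hand side is a differentiable function of the shifted
    vector, although [gp] is only continuous. *)
Lemma gp_shift w s : TOmega0 Omega w -> Omega (w.1 + s *: w.2) ->
  gp (w.1 + s *: w.2, w.2) = (tau (w.1 + s *: w.2, w.2) / tau w) *: gp w.
Proof.
move=> Tw Os; have [-> s1] := tau_shift Tw Os; have t0 := tau_pos Tw.
case: w Tw Os t0 s1 => x u [Ox u0] /= Os t0 s1; rewrite tau_grad_line //.
congr (_ *: _); move: (tau _) t0 s1 => t t0 s1.
have d0 : 1 - s * t != 0 by rewrite gt_eqF // subr_gt0.
by field; rewrite d0 gt_eqF.
Qed.

Lemma sig_shift w s : TOmega0 Omega w -> Omega (w.1 + s *: w.2) ->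
  tau (w.1 + s *: w.2, - w.2) = sig w / (1 + s * sig w) /\ 0 < 1 + s * sig w.
Proof.
move=> Tw; have -> : s *: w.2 = (- s) *: (flip w).2 by rewrite scalerN scaleNr opprK.
move=> Os; have [-> s1] := tau_shift (TOmega0_flip Tw) Os.
by rewrite mulNr opprK; split=> //; move: s1; rewrite mulNr; move: (s * _) => r; lra.
Qed.

Lemma gm_shift w s : TOmega0 Omega w -> Omega (w.1 + s *: w.2) ->
  gp (w.1 + s *: w.2, - w.2) = (tau (w.1 + s *: w.2, - w.2) / sig w) *: gm w.
Proof.
move=> Tw; have -> : s *: w.2 = (- s) *: (flip w).2 by rewrite scalerN scaleNr opprK.
by move=> Os; exact: (gp_shift (TOmega0_flip Tw) Os).
Qed.

End HilbertField.

(** * Rules for C^k maps on an open set *)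

Section CkCalculus.
Context {R : realType} {E : normedModType R} (D : set E).
Hypothesis oD : open D.

Lemma near_in (x : E) : D x -> \forall y \near x, D y.
Proof. by move=> Dx; exact: open_nbhs_nbhs. Qed.

Lemma Ck_ext (F : normedModType R) k (f g : E -> F) :
  (forall x, D x -> f x = g x) -> Ck k D f -> Ck k D g.
Proof.
elim: k f g => [|k IH] f g fg /=.
  move=> cf x Dx; have fgn : \forall y \near x, f y = g y.
    by apply: filterS (near_in Dx) => y Dy; exact: fg.
  have cfx : f y @[y --> x] --> g x by rewrite -(fg _ Dx); exact: (cf x Dx).
  by apply: cvg_trans cfx; exact: near_eq_cvg.
have fgn x : D x -> \forall y \near x, f y = g y.
  by move=> Dx; apply: filterS (near_in Dx) => y Dy; exact: fg.
move=> [df Df]; split=> [x Dx|v].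
  by have [] := near_is_diff (fgn x Dx) (differentiableP (df x Dx)).
apply: IH (Df v) => x Dx; exact: near_eq_derive (fgn x Dx).
Qed.

Lemma Ck_le (F : normedModType R) k (f : E -> F) : Ck k.+1 D f -> Ck k D f.
Proof.
elim: k f => [|k IH] f /= [df Df].
  by move=> x Dx; apply: differentiable_continuous; exact: df.
by split=> // v; apply: IH; exact: Df.
Qed.

Lemma Ck_cst (F : normedModType R) k (c : F) : Ck k D (fun=> c).
Proof.
elim: k c => [|k IH] c /=; first by move=> x _; exact: cvg_cst.
split=> [x _|v]; first by have [] := is_diff_const c x.
have -> : (fun x => 'D_v (fun=> c) x) = (fun=> 0 : F).
  by apply/funext => x; rewrite (is_diff_derive v (is_diff_const c x)).
exact: IH.
Qed.

Lemma Ck_lin (F : normedModType R) k (f : {linear E -> F}) : continuous f -> Ck k D f.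
Proof.
move=> cf; case: k => [|k] /=; first by move=> x _; exact: cf.
split=> [x _|v]; first by have [] := is_diff_lin x cf.
have -> : (fun x => 'D_v f x) = (fun=> f v).
  by apply/funext => x; rewrite (is_diff_derive v (is_diff_lin x cf)).
exact: Ck_cst.
Qed.

Lemma Ck_add (F : normedModType R) k (f g : E -> F) :
  Ck k D f -> Ck k D g -> Ck k D (fun x => f x + g x).
Proof.
elim: k f g => [|k IH] f g /=; first by move=> cf cg x Dx; apply: cvgD; [exact: cf|exact: cg].
move=> [df Df] [dg Dg]; have dfg x : D x -> is_diff x (fun x => f x + g x) (fun h => 'd f x h + 'd g x h).
  by move=> Dx; apply: is_diff_add; apply: differentiableP; [exact: df|exact: dg].
split=> [x Dx|v]; first by have [] := dfg x Dx.
apply: (Ck_ext _ (IH _ _ (Df v) (Dg v))) => x Dx.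
by rewrite (is_diff_derive v (dfg x Dx)) !deriveE //; [exact: dg|exact: df].
Qed.

Lemma Ck_scale (F : normedModType R) k (q : E -> R^o) (f : E -> F) :
  Ck k D q -> Ck k D f -> Ck k D (fun x => q x *: f x).
Proof.
elim: k q f => [|k IH] q f; first by move=> cf cg x Dx; apply: cvgZ; [exact: cf|exact: cg].
move=> Cq Cf; have [dq Dq] := Cq; have [df Df] := Cf.
have dfg x : D x -> is_diff x (fun x => q x *: f x) (fun h => q x *: 'd f x h + 'd q x h *: f x).
  by move=> Dx; apply: is_diff_scale; apply: differentiableP; [exact: dq|exact: df].
split=> [x Dx|v]; first by have [] := dfg x Dx.
apply: (Ck_ext _ (Ck_add (IH _ _ (Ck_le Cq) (Df v)) (IH _ _ (Dq v) (Ck_le Cf)))) => x Dx.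
by rewrite (is_diff_derive v (dfg x Dx)) !deriveE //; [exact: dq|exact: df].
Qed.

Lemma Ck_pair (F G : normedModType R) k (f : E -> F) (g : E -> G) :
  Ck k D f -> Ck k D g -> Ck k D (fun x => (f x, g x)).
Proof.
elim: k f g => [|k IH] f g /=.
  by move=> cf cg x Dx; apply: cont_pair; [exact: cf|exact: cg].
move=> [df Df] [dg Dg]; have dfg x : D x -> is_diff x (fun x => (f x, g x)) (fun h => ('d f x h, 'd g x h)).
  by move=> Dx; apply: is_diff_pair; apply: differentiableP; [exact: df|exact: dg].
split=> [x Dx|v]; first by have [] := dfg x Dx.
apply: (Ck_ext _ (IH _ _ (Df v) (Dg v))) => x Dx.
by rewrite (is_diff_derive v (dfg x Dx)) !deriveE //; [exact: dg|exact: df].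
Qed.

(** The derivative is [- q^-2] times that of [q], so the induction applies to the inverse itself
    while [q] is taken at one order more. *)
Lemma Ck_inv k (q : E -> R^o) : (forall x, D x -> q x != 0) ->
  (forall j, Ck j D q) -> Ck k D (fun x => (q x)^-1 : R^o).
Proof.
move=> q0 Cq; elim: k => [|k IH].
  by move=> x Dx; apply: cvgV; [exact: q0|exact: (Cq 0%N)].
have dq x : D x -> differentiable q x by move=> Dx; have [+ _] := Cq 1%N; apply.
have di x : D x -> is_diff x (fun x => (q x)^-1) (fun h => - (q x) ^- 2 * 'd q x h).
  by move=> Dx; apply: is_diff_inv; [exact: q0|apply: differentiableP; exact: dq].
split=> [x Dx|v]; first by have [] := di x Dx.
have Cv : Ck k D (fun x => 'D_v q x) by have [_] := Cq k.+1; apply.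
have Cn : Ck k D (fun x => (-1 : R) *: 'D_v q x).
  by apply: Ck_scale => //; exact: Ck_cst.
apply: (Ck_ext _ (Ck_scale IH (Ck_scale IH Cn))) => x Dx.
rewrite (is_diff_derive v (di x Dx)) deriveE; last exact: dq.
by rewrite /GRing.scale /=; field; exact: q0.
Qed.

End CkCalculus.

(** * Smooth vertical fields *)

Section VerticalFields.
Context {R : realType} {n : nat} (Omega : set 'rV[R]_n).
Hypothesis dom : strictly_convex_domain Omega.
Local Notation V := 'rV[R]_n.
Implicit Types (x xi u c : V) (s : R) (w q Z v : V * V).

Lemma open_TOmega0 : open (TOmega0 Omega).
Proof. by rewrite openE => w Tw; exact: (near_TOmega0 dom Tw). Qed.

Lemma snd_continuous : continuous (fun w : V * V => w.2).
Proof. by move=> w; exact: cvg_snd. Qed.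

Lemma Ck_dotp_snd k c : Ck k (TOmega0 Omega) (fun w => dotp c w.2 : R^o).
Proof.
have lf : linear (fun w : V * V => dotp c w.2 : R^o).
  by move=> s a b; rewrite /= dotpDr dotpZr.
pose f := HB.pack_for {linear (V * V)%type -> R^o} (fun w : V * V => dotp c w.2 : R^o)
  (GRing.isLinear.Build _ _ _ _ _ lf).
apply: (@Ck_lin R _ _ R^o k f) => w.
apply: (@cont_comp _ _ _ (fun w : V * V => (c, w.2)) (fun q => dotp q.1 q.2)).
  by apply: cont_pair; [exact: cont_cst|exact: cvg_snd].
exact: dotp_continuous.
Qed.

Lemma Ck_snd k : Ck k (TOmega0 Omega) (fun w : V * V => w.2).
Proof.
pose f := HB.pack_for {linear (V * V)%type -> V} (fun w : V * V => w.2)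
  (GRing.isLinear.Build R (V * V)%type V _ (fun w : V * V => w.2) (fun s a b => erefl)).
exact: (@Ck_lin R _ _ V k f snd_continuous).
Qed.

Lemma dotp_snd_sum w : dotp w.2 w.2 = \sum_i dotp (delta_mx 0 i) w.2 * dotp (delta_mx 0 i) w.2.
Proof. by rewrite [LHS]dotpE; apply: eq_bigr => i _; rewrite dotp_delta. Qed.

Lemma Ck_sqnorm k : Ck k (TOmega0 Omega) (fun w => dotp w.2 w.2 : R^o).
Proof.
apply: (Ck_ext open_TOmega0 (f := fun w =>
    \sum_i dotp (delta_mx 0 i) w.2 * dotp (delta_mx 0 i) w.2)).
  by move=> w _; rewrite dotp_snd_sum.
elim: (index_enum _) => [|i r IH].
  apply: (Ck_ext open_TOmega0 _ (Ck_cst _ k (0 : R^o))) => w _; by rewrite big_nil.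
apply: (Ck_ext open_TOmega0 _ (Ck_add open_TOmega0
  (Ck_scale open_TOmega0 (Ck_dotp_snd k (delta_mx 0 i)) (Ck_dotp_snd k (delta_mx 0 i))) IH)).
by move=> w _; rewrite big_cons.
Qed.

(** The projections of a fixed vector to the orthogonal of [w.2]: every vertical vector at a point
    extends in this way to a smooth vertical field, as the definitions of E^s and E^u require. *)
Definition vfield c w : V * V := (0, c - dotp c w.2 *: w.2).

Lemma vfield_normalize c w : w.2 != 0 -> vfield c (normalize w) = (0, orth w.2 c).
Proof.
move=> w0; have e0 := enorm_gt0 w0; rewrite /vfield /normalize /orth /= -enorm_sqr.
congr (_, _ - _); rewrite dotpZr scalerA; congr (_ *: _).
by field; rewrite gt_eqF.
Qed.

Lemma vfield_smooth c : smooth_vertical_field Omega (vfield c).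
Proof.
have tv w : HOmega Omega w -> tangent w (vfield c w).
  by case=> _ w1; rewrite /tangent /= dotpBl dotpZl unit_dotp // mulr1 subrr.
split; last by move=> w Hw; split=> //; exact: tv.
split=> // k; have q0 w : TOmega0 Omega w -> dotp w.2 w.2 != 0.
  by case=> _ w0; rewrite -enorm_sqr sqrf_eq0 gt_eqF // enorm_gt0.
have Ci := Ck_inv open_TOmega0 k q0 Ck_sqnorm.
have C1 := Ck_scale open_TOmega0 (Ck_scale open_TOmega0 Ci (Ck_dotp_snd k c)) (Ck_snd k).
have C2 := Ck_scale open_TOmega0 (Ck_cst (TOmega0 Omega) k (-1 : R^o)) C1.
have C3 := Ck_pair open_TOmega0 (Ck_cst (TOmega0 Omega) k (0 : V))
  (Ck_add open_TOmega0 (Ck_cst (TOmega0 Omega) k c) C2).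
apply: (Ck_ext open_TOmega0 _ C3) => w [Ow w0].
rewrite /= vfield_normalize // /orth; congr (_, _ + _).
by rewrite scaleN1r; congr (- (_ *: _)); rewrite /GRing.scale /= mulrC.
Qed.

Lemma const_field_smooth c : smooth_field Omega (fun=> (c, 0)).
Proof.
split=> [w _|k]; first by rewrite /tangent /= dotp0l.
exact: Ck_cst.
Qed.

Lemma vfield_at c w : dotp c w.2 = 0 -> vfield c w = (0, c).
Proof. by move=> cw; rewrite /vfield cw scale0r subr0. Qed.

(* Along a horizontal direction the conditions of being vertical and tangent are differentiated with [w.2] fixed. *)
Lemma derive_vertical (f : V * V -> V * V) w v : TOmega0 Omega w ->
  (forall q, TOmega0 Omega q -> (f q).1 = 0 /\ dotp (f q).2 q.2 = 0) ->
  v.2 = 0 -> differentiable f w ->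
  ('D_v f w).1 = 0 /\ dotp ('D_v f w).2 w.2 = 0.
Proof.
move=> Tw hf v0 df; have d := differentiableP df; rewrite deriveE //.
have d1 := is_diff_fst d.
have d2 := is_diff_dotp (is_diff_snd d) (is_diff_snd (is_diff_idfun w)).
have n1 : \forall q \near w, (f q).1 = 0.
  by apply: filterS (near_TOmega0 dom Tw) => q /hf[].
have n2 : \forall q \near w, dotp (f q).2 q.2 = 0.
  by apply: filterS (near_TOmega0 dom Tw) => q /hf[].
split.
  rewrite -(is_diff_derive v d1) (near_eq_derive v n1).
  exact: is_diff_derive (is_diff_const 0 w).
have := is_diff_derive v d2; rewrite v0 dotp0r add0r => <-.
rewrite (near_eq_derive v n2).
exact: (is_diff_derive v (@is_diff_const R _ R^o 0 w)).
Qed.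

(** Allows [X, Y] to be replaced by a differentiable map that agrees with it only on the line along
    which it is differentiated. *)
Lemma derive_line (F : normedModType R) (f g : V * V -> F) w v :
  (\forall s \near (0 : R), f (s *: v + w) = g (s *: v + w)) -> 'D_v f w = 'D_v g w.
Proof.
move=> fg; have fg0 : f w = g w by have := nbhs_singleton fg; rewrite scale0r add0r.
rewrite /derive; congr (lim _); rewrite eqEsubset.
split; apply: near_eq_cvg; apply: cvg_within; apply: filterS fg => s /= fgs.
  by rewrite fgs fg0.
by rewrite fgs fg0.
Qed.

End VerticalFields.

(** * Brackets and the horizontal operator *)

Section HorizontalOperator.
Context {R : realType} {n : nat} (Omega : set 'rV[R]_n).
Hypothesis dom : strictly_convex_domain Omega.
Hypothesis C1 : gauge_C1 Omega.
Local Notation V := 'rV[R]_n.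
Local Notation tau := (tau Omega).
Local Notation hilb := (hilb Omega).
Local Notation gp := (tau_grad Omega).
Local Notation sig w := (tau (flip w)).
Local Notation gm w := (gp (flip w)).
Local Notation X := (Xfield Omega).
Local Notation speed := (speed Omega).
Local Notation dspeed := (dspeed Omega).
Implicit Types (x xi u c y : V) (s : R) (w q Z v : V * V)
  (Y : V * V -> V * V).

Lemma smooth_vertical_differentiable Y w : smooth_vertical_field Omega Y ->
  TOmega0 Omega w -> differentiable (Y \o @normalize R n) w.
Proof. by move=> [[_ sY] _] Tw; have [d _] := sY 1%N; exact: d. Qed.

Lemma smooth_vertical_differentiable2 Y w v : smooth_vertical_field Omega Y ->
  TOmega0 Omega w -> differentiable (fun q => 'D_v (Y \o @normalize R n) q) w.
Proof. by move=> [[_ sY] _] Tw; have [_ /(_ v)[d _]] := sY 2%N; exact: d. Qed.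

Lemma vertical_normalize Y q : smooth_vertical_field Omega Y -> TOmega0 Omega q ->
  ((Y \o @normalize R n) q).1 = 0 /\ dotp ((Y \o @normalize R n) q).2 q.2 = 0.
Proof.
move=> [_ vY] Tq; have [tq q1] := vY _ (normalize_HOmega Tq); split=> //.
have q0 : q.2 != 0 by case: Tq.
have e0 := enorm_gt0 q0; move: tq; rewrite /tangent /= dotpZr => /eqP.
by rewrite mulf_eq0 invr_eq0 gt_eqF // => /eqP.
Qed.

Lemma vertical_HOmega Y w : smooth_vertical_field Omega Y -> HOmega Omega w ->
  (Y w).1 = 0 /\ dotp (Y w).2 w.2 = 0.
Proof. by move=> [_ vY] Hw; have [tw w1] := vY _ Hw. Qed.

Definition yder Y w : V := ('D_((w.2, 0) : V * V) (Y \o @normalize R n) w).2.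

Lemma yder_orth Y w : smooth_vertical_field Omega Y -> TOmega0 Omega w ->
  dotp (yder Y w) w.2 = 0.
Proof.
move=> sY Tw; have [_] := derive_vertical dom (v := (w.2, 0)) Tw
  (fun q => @vertical_normalize Y q sY) erefl (smooth_vertical_differentiable sY Tw).
exact.
Qed.

Lemma bracketE Y w : smooth_vertical_field Omega Y -> HOmega Omega w ->
  bracket X Y w = (- (speed w *: (Y w).2 + dspeed w (Y w) *: w.2),
                   speed w *: yder Y w).
Proof.
move=> sY Hw; have Tw := HOmega_sub Hw.
have dY := smooth_vertical_differentiable sY Tw.
rewrite /bracket dH_Xfield // XfieldE // /dH.
have -> : (speed w *: w.2, 0) = speed w *: ((w.2, 0) : V * V).
  by congr (_, _); rewrite /= scaler0.
rewrite deriveE // linearZ -deriveE //.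
have [D1 _] := derive_vertical dom (v := (w.2, 0)) Tw
  (fun q => @vertical_normalize Y q sY) erefl dY.
have -> : 'D_((w.2, 0) : V * V) (Y \o @normalize R n) w = (0, yder Y w).
  by rewrite [LHS]surjective_pairing D1.
by congr (_, _); rewrite /= ?scaler0 ?sub0r // subr0.
Qed.

Lemma near_line w v (P : set (V * V)) : (\forall q \near w, P q) ->
  \forall s \near (0 : R), P (s *: v + w).
Proof.
move=> nP; have cf : {for (0 : R), continuous (fun s : R => s *: v + w)}.
  by apply: cont_add; [apply: cont_scale; [exact: cont_id|exact: cont_cst]|exact: cont_cst].
by apply: cf; rewrite scale0r add0r.
Qed.

(** On the line through [w], [gp] and [gm] are multiples of their values at [w], which turns [X, Y]
    into the differentiable map [W]. The multiple of [w.2] and the vertical part stay unspecified,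
    since [vertical_op] does not see them. *)
Lemma bracket2E Y w : smooth_vertical_field Omega Y -> HOmega Omega w ->
  exists (b : R) z, dotp z w.2 = 0 /\
    bracket X (bracket X Y) w =
      (b *: w.2 - speed w *: (dspeed w (w.2, 0) *: (Y w).2 + (2 * speed w) *: yder Y w), z).
Proof.
move=> sY Hw; have Tw := HOmega_sub Hw.
pose Yn := Y \o @normalize R n; pose e : V * V := (w.2, 0).
pose D1 q := 'D_e Yn q; pose v := speed w *: e.
have vE : v = (speed w *: w.2, 0) by congr (_, _); rewrite /= scaler0.
have Xw : X w = v by rewrite XfieldE.
have dY' := smooth_vertical_differentiable sY Tw.
have [dYw dY] : exists d, is_diff w Yn d by exists ('d Yn w); exact: differentiableP.
have Dv : dYw v = speed w *: D1 w.
  by rewrite -(is_diff_derive v dY) deriveE // linearZ -deriveE.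
have dD1' := smooth_vertical_differentiable2 e sY Tw.
have [dDw dD1] : exists d, is_diff w D1 d by exists ('d D1 w); exact: differentiableP.
have DDv : dDw v = 'D_v D1 w by rewrite (is_diff_derive v dD1).
have vert1 q : TOmega0 Omega q -> (D1 q).1 = 0 /\ dotp (D1 q).2 q.2 = 0.
  move=> Tq; apply: (derive_vertical dom Tq _ _ (smooth_vertical_differentiable sY Tq)) => //.
  by move=> p; exact: vertical_normalize.
have v20 : v.2 = 0 by rewrite vE.
have [dd1 dd2] := derive_vertical dom Tw vert1 v20 dD1'.
have t0 := tau_pos dom Tw; have s0 := sig_pos dom Tw; have h0 := hilb_pos dom Tw.
(* This is [dspeed q (Y q)] with [gp q] and [gm q] replaced by the values that [gp_shift] and
   [gm_shift] give on the line. *)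
pose A q : R := - (2 / hilb q ^+ 2) *
  (tau q / tau w * dotp (Yn q).2 (gp w) - tau (flip q) / sig w * dotp (Yn q).2 (gm w)).
have [dA hA] : exists dA, is_diff w A dA.
  have hn : hilb w ^+ 2 != 0 by rewrite expf_neq0 // gt_eqF.
  have dh := is_diff_hilb dom C1 Tw.
  have dh2 : is_diff w (fun q => hilb q ^+ 2) (fun Z => hilb w * (dtau Omega w Z + dsig Omega w Z) +
     (dtau Omega w Z + dsig Omega w Z) * hilb w).
    by have := is_diff_mul dh dh; apply: near_is_diff; near=> q; rewrite expr2.
  have cst (k : R) := @is_diff_const R _ R^o k w.
  have cstV (k : V) := is_diff_const k w.
  have i1 := @is_diff_opp R _ R^o _ _ _ (is_diff_mul (cst 2) (is_diff_inv (f := fun q => hilb q ^+ 2) hn dh2)).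
  have i2 := is_diff_mul (is_diff_mul (is_diff_tau_pair dom C1 Tw) (cst (tau w)^-1))
    (is_diff_dotp (is_diff_snd dY) (cstV (gp w))).
  have i3 := is_diff_mul (is_diff_mul (is_diff_sig dom C1 Tw) (cst (sig w)^-1))
    (is_diff_dotp (is_diff_snd dY) (cstV (gm w))).
  have i4 := is_diff_mul i1 (@is_diff_sub R _ R^o _ _ _ _ _ i2 i3).
  by eexists; exact: i4.
pose W q := (- (speed q *: (Yn q).2 + A q *: w.2), speed q *: (D1 q).2).
have dW : is_diff w W (fun Z => (- ((speed w *: (dYw Z).2 + dspeed w Z *: (Yn w).2)
     + (A w *: (0 : V) + dA Z *: w.2)),
     speed w *: (dDw Z).2 + dspeed w Z *: (D1 w).2)).
  have dS := is_diff_speed dom C1 Tw.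
  apply: is_diff_pair; last exact: (is_diff_scale dS (is_diff_snd dD1)).
  apply: is_diff_opp; apply: is_diff_add; first exact: (is_diff_scale dS (is_diff_snd dY)).
  exact: (is_diff_scale hA (is_diff_const w.2 w)).
have Wline : \forall s \near (0 : R), (bracket X Y \o @normalize R n) (s *: v + w) = W (s *: v + w).
  apply: filterS (near_line v (near_TOmega0 dom Tw)) => s Ts.
  set q := s *: v + w in Ts *.
  have qE : q = (w.1 + (s * speed w) *: w.2, w.2).
    rewrite /q vE; apply: injective_projections => /=; last by rewrite scaler0 add0r.
    by rewrite scalerA addrC.
  have Hq : HOmega Omega q by case: Ts => Oq _; split=> //; rewrite qE; case: Hw.
  have Oq : Omega (w.1 + (s * speed w) *: w.2) by case: Hq; rewrite qE.
  clearbody q; have nq := HOmega_id Hq; have YqE : Yn q = Y q by rewrite -{2}nq.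
  have -> : (bracket X Y \o @normalize R n) q = bracket X Y q by rewrite -{2}nq.
  rewrite (bracketE sY Hq) /W YqE.
  have [Yq1 _] := vertical_HOmega sY Hq.
  have q2 : q.2 = w.2 by rewrite qE.
  have -> : yder Y q = (D1 q).2 by rewrite /yder q2.
  rewrite q2; congr (- (_ + _ *: _), _); rewrite /A YqE.
  rewrite /dspeed /dtau /dsig Yq1 !dotp0l !mulr0 !addr0; congr (_ * (_ + _)).
    have -> : gp q = (tau q / tau w) *: gp w by rewrite qE; exact: gp_shift.
    by rewrite dotpZr.
  have fq : flip q = (w.1 + (s * speed w) *: w.2, - w.2) by rewrite qE.
  have -> : gm q = (sig q / sig w) *: gm w by rewrite fq; exact: gm_shift.
  by rewrite dotpZr.
rewrite {1}/bracket Xw {1}/dH (derive_line Wline) (is_diff_derive v dW).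
rewrite dH_Xfield // bracketE //.
have dsv : dspeed w v = speed w * dspeed w e.
  rewrite /dspeed /dtau /dsig vE /= !dotp0l !dotpZl; ring.
have yE : yder Y w = (D1 w).2 by [].
have Yw : Yn w = Y w by rewrite /Yn /= (HOmega_id Hw).
rewrite Dv dsv yE Yw.
exists (- (dA v + dspeed w (- (speed w *: (Y w).2 + dspeed w (Y w) *: w.2), speed w *: (D1 w).2))).
exists (speed w *: (dDw v).2 + (speed w * dspeed w e) *: (D1 w).2); split.
  have [_ o1] := vert1 w Tw.
  by rewrite dotpDl !dotpZl o1 mulr0 addr0 DDv dd2 mulr0.
congr (_, _); last by rewrite /= subr0.
rewrite /=; move: (dspeed w (_, _)) => d1.
by apply/rowP => i; rewrite !mxE; ring.
Unshelve. all: by end_near. Qed.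

(** The horizontal part of [X, Y] is [- speed] times Y modulo [w.2], and Y is orthogonal to [w.2].
    So the horizontal part of [Z] determines Y at [w], and any remaining tangent vertical vector is
    absorbed in [Y0]. *)
Lemma vertical_opE w Z (b : R) y : HOmega Omega w ->
  Z.1 = b *: w.2 - speed w *: y -> dotp y w.2 = 0 -> dotp Z.2 w.2 = 0 ->
  vertical_op Omega w Z = (0, - y).
Proof.
move=> Hw Z1 yw Zw; have Tw := HOmega_sub Hw; have m0 := speed_pos dom Tw.
have w1 : dotp w.2 w.2 = 1 by case: Hw => _; exact: unit_dotp.
have sv := vfield_smooth dom y; have vy := vfield_at yw.
apply: xget_unique.
  exists ((b + dspeed w (vfield y w)) / speed w), (0, Z.2 - speed w *: yder (vfield y) w), (vfield y).
  split=> //.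
  - split=> //; rewrite /tangent /= dotpBl dotpZl Zw (yder_orth sv Tw).
    by rewrite mulr0 subr0.
  - rewrite XfieldE // bracketE // vy [Z in LHS]surjective_pairing Z1.
    congr (_, _) => /=; last by rewrite scaler0 add0r subrK.
    rewrite scalerA divfK ?gt_eqF // addr0.
    by apply/rowP => i; rewrite !mxE; ring.
  - by rewrite vy; congr (_, _); rewrite /= oppr0.
move=> U [a [Y0 [Y [[_ Y01] sY ZE ->]]]].
have [Y1 Yw] := vertical_HOmega sY Hw.
move: Z1; rewrite ZE XfieldE // bracketE // /= Y01 addr0 => hh.
have yy : (Y w).2 = y.
  pose d := a * speed w - dspeed w (Y w) - b.
  have k : speed w *: ((Y w).2 - y) = d *: w.2.
    apply/rowP => i; have := congr1 (fun r : V => r 0 i) hh; rewrite !mxE /d.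
    move: (speed w) (dspeed w (Y w)) => m ds h; rewrite mulrBr.
    by move/eqP: h; rewrite -subr_eq0 => /eqP h; apply/eqP; rewrite -subr_eq0 -[X in _ == X]oppr0 -h; apply/eqP; ring.
  have d0 : d = 0.
    by have := congr1 (fun r => dotp r w.2) k; rewrite !dotpZl dotpBl Yw yw subrr mulr0 w1 mulr1.
  move/eqP: k; rewrite d0 scale0r scaler_eq0 gt_eqF //= subr_eq0 => /eqP.
  exact.
by rewrite [Y w]surjective_pairing Y1 yy; congr (_, _); rewrite /= oppr0.
Qed.

(** The factor 1/2 in H_X is what cancels the derivative [yder] of Y: [X, [X, Y]] contains it twice.
    What remains depends on the value of Y at [w] only. *)
Lemma horizontal_opE Y w : smooth_vertical_field Omega Y -> HOmega Omega w ->
  horizontal_op Omega Y w =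
    (speed w *: (Y w).2 + dspeed w (Y w) *: w.2, (dspeed w (w.2, 0) / 2) *: (Y w).2).
Proof.
move=> sY Hw; have Tw := HOmega_sub Hw; have [Y1 Yw] := vertical_HOmega sY Hw.
have [b [z [zw B2]]] := bracket2E sY Hw.
rewrite /horizontal_op B2 bracketE //.
rewrite (vertical_opE (b := b)
  (y := dspeed w (w.2, 0) *: (Y w).2 + (2 * speed w) *: yder Y w)) //; last first.
  by rewrite dotpDl !dotpZl Yw yder_orth // !mulr0 addr0.
congr (_, _) => /=; first by rewrite opprK scaler0 subr0.
by apply/rowP => i; rewrite !mxE; field.
Qed.

(** The direction of the hyperplane through the base point and the intersection of the tangent
    hyperplanes at the two end points of the line. *)
Definition horo w (z : V) : Prop := dotp z (gp w) = dotp z (gm w).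

Lemma dspeed_spray w : TOmega0 Omega w ->
  dspeed w (w.2, 0) = - (2 / hilb w ^+ 2) * (tau w ^+ 2 - sig w ^+ 2).
Proof.
move=> Tw; rewrite /dspeed /dtau /dsig /= !dotp0l gp_self // gm_self //; ring.
Qed.

Lemma dspeed_vertical w y : dspeed w (0, y) =
  - (2 / hilb w ^+ 2) * (dotp y (gp w) - dotp y (gm w)).
Proof. by rewrite /dspeed /dtau /dsig /= !dotp0l !mulr0 !addr0. Qed.

(* [r = 1] is the unstable case and [r = -1] the stable one. *)
Lemma vertical_horizontal (r : R) w Z : HOmega Omega w -> r ^+ 2 = 1 ->
  (exists2 Y, smooth_vertical_field Omega Y & Y w + r *: horizontal_op Omega Y w = Z) <->
  horo w Z.1 /\ Z.2 = ((tau w + sig w) / 2 * r - (tau w - sig w) / 2) *: orth w.2 Z.1.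
Proof.
move=> Hw r2; have Tw := HOmega_sub Hw.
have u1 : enorm w.2 = 1 by case: Hw.
have uu := unit_dotp u1.
have t0 := tau_pos dom Tw; have s0 := sig_pos dom Tw; have h0 := hilb_pos dom Tw.
have hE : hilb w = tau w + sig w by [].
have gp1 := gp_self dom C1 Tw; have gm1 := gm_self dom C1 Tw.
have rinv : r^-1 = r.
  have rn : r != 0 by apply: contra_eq_neq r2 => ->; rewrite expr0n eq_sym oner_eq0.
  by apply: (mulfI rn); rewrite mulfV // -expr2 r2.
split.
- move=> [Y sY <-]; rewrite horizontal_opE //; have [Y1 Yw] := vertical_HOmega sY Hw.
  have YE : Y w = (0, (Y w).2) by rewrite [LHS]surjective_pairing Y1.
  rewrite dspeed_spray // YE dspeed_vertical /=.
  move: (Y w).2 Yw => y yw; rewrite /horo add0r.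
  split.
    rewrite !dotpZl !dotpDl !dotpZl gp1 gm1 /speed hE.
    move: (tau w) (sig w) (dotp y _) (dotp y _) t0 s0 => t s g1 g2 t0 s0.
    by field; rewrite gt_eqF // addr_gt0.
  rewrite orth_unit // !dotpZl !dotpDl !dotpZl yw uu mulr0 add0r mulr1 /speed hE.
  move: (tau w) (sig w) (dotp y _) (dotp y _) t0 s0 => t s g1 g2 t0 s0.
  have ts : t + s != 0 by rewrite gt_eqF // addr_gt0.
  apply/rowP => i; rewrite !mxE; move: (y 0 i) (w.2 0 i) => a b.
  apply/eqP; rewrite -subr_eq0; apply/eqP.
  (* The two sides agree only modulo [r ^+ 2 = 1], so their difference is exhibited as a multiple of
     [r ^+ 2 - 1]. *)
  rewrite [LHS](_ : _ = (r ^+ 2 - 1) * - a); last by field.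
  by rewrite r2 subrr mul0r.
- case: Z => z b /= [hz ->].
  (* The horizontal part of Y + r H_X(Y) is [r * speed] times Y modulo [w.2]; solving for Y uses
     [r^-1 = r]. *)
  pose y := (r / speed w) *: orth w.2 z.
  have m0 := speed_pos dom Tw.
  have yw : dotp y w.2 = 0 by rewrite dotpZl orthP // mulr0.
  exists (vfield y); first exact: vfield_smooth.
  rewrite horizontal_opE //; last exact: vfield_smooth.
  rewrite vfield_at // dspeed_spray // dspeed_vertical /=.
  move: hz; rewrite /horo /y !dotpZl !orth_unit // !dotpBl !dotpZl gp1 gm1 /speed hE => hz.
  move: (dotp z (gm w)) (dotp z w.2) (tau w) (sig w) t0 s0 hz => g p t s t0 s0 ->.
  have ts : t + s != 0 by rewrite gt_eqF // addr_gt0.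
  congr (_, _); apply/rowP => i; rewrite !mxE; move: (z 0 i) (w.2 0 i) => c d.
    rewrite add0r; apply/eqP; rewrite -subr_eq0; apply/eqP.
    rewrite [LHS](_ : _ = (r ^+ 2 - 1) * c); first by rewrite r2 subrr mul0r.
    by field.
  apply/eqP; rewrite -subr_eq0; apply/eqP.
  rewrite [LHS](_ : _ = (r ^+ 2 - 1) * ((s - t) / 2 * (c - p * d))).
    by rewrite r2 subrr mul0r.
  by field.
Qed.

Lemma EuP w Z : HOmega Omega w ->
  Eu Omega w Z <-> horo w Z.1 /\ Z.2 = sig w *: orth w.2 Z.1.
Proof.
move=> Hw; have := vertical_horizontal Z Hw (expr1n R 2).
rewrite mulr1 (_ : _ / 2 - _ = sig w); last by field.
by move=> <-; split=> -[Y sY <-]; exists Y; rewrite ?scale1r.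
Qed.

Lemma EsP w Z : HOmega Omega w ->
  Es Omega w Z <-> horo w Z.1 /\ Z.2 = - tau w *: orth w.2 Z.1.
Proof.
move=> Hw; have := vertical_horizontal Z Hw (sqrr_sign R 1).
rewrite expr1 mulrN1 (_ : _ - _ = - tau w); last by field.
by move=> <-; split=> -[Y sY <-]; exists Y; rewrite ?scaleN1r.
Qed.

End HorizontalOperator.

(** * The geodesic flow in closed form *)

Section Curves.
Context {R : realType} {n : nat}.
Local Notation V := 'rV[R]_n.

Lemma is_derive_is_diff (E : normedModType R) (g : R^o -> E) (t : R^o) (d : E) :
  is_derive t (1 : R^o) g d <-> is_diff t g (fun r => r *: d).
Proof.
split=> [[dg <-]|dg].
  have dg' : differentiable g t by apply/derivable1_diffP.
  apply: DiffDef => //; apply/funext => h.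
  have -> : h = h *: (1 : R^o) by rewrite /GRing.scale /= mulr1.
  by rewrite linearZ -deriveE // /GRing.scale /= mulr1.
apply: DeriveDef; first by apply/derivable1_diffP; have [] := dg.
by rewrite (is_diff_derive _ dg) scale1r.
Qed.

(** The component of [g] orthogonal to [u] has zero derivative at every time; the speed [c] may
    depend on the time in any way. *)
Lemma straight_line (g : R -> V) (u : V) : enorm u = 1 ->
  (forall t : R, exists c : R, is_derive (t : R^o) (1 : R^o) (g : R^o -> V) (c *: u)) ->
  forall t, g t = g 0 + dotp (g t - g 0) u *: u.
Proof.
move=> u1 dg t; apply/rowP => i.
pose r (s : R) : R := dotp (g s) (delta_mx 0 i) - dotp (g s) u * u 0 i.
have r0 (s : R) : is_derive (s : R^o) (1 : R^o) (r : R^o -> R^o) 0.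
  have [c /is_derive_is_diff d] := dg s; apply/is_derive_is_diff.
  have cst (z : V) := is_diff_const z (s : R^o).
  have d1 := is_diff_dotp d (cst (delta_mx 0 i)).
  have d2 := is_diff_mul (is_diff_dotp d (cst u)) (@is_diff_const _ _ R^o (u 0 i) (s : R^o)).
  apply: (is_diff_eq (@is_diff_sub R _ R^o _ _ _ _ _ d1 d2)).
  apply/funext => h; rewrite !dotp0r !dotpZl unit_dotp // (dotpC u) dotp_delta.
  by rewrite /GRing.scale /=; ring.
have := @is_derive_0_is_cst R r t 0 r0; rewrite /r !(dotpC _ (delta_mx 0 i)) !dotp_delta => h.
by rewrite !mxE dotpBl mulrBl; move: h; move: (_ * _) (_ * _) => a b h; lra.
Qed.

End Curves.

(** * Chain rule on the bundle *)

Section DerivativeOnBundle.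
Context {R : realType} {n : nat} (Omega : set 'rV[R]_n).
Hypothesis dom : strictly_convex_domain Omega.
Local Notation V := 'rV[R]_n.
Implicit Types (w q Z : V * V) (f h : V * V -> V * V).

Lemma near_HOmega (P : V * V -> Prop) w : TOmega0 Omega w ->
  (forall q, HOmega Omega q -> P q) -> \forall q \near w, P (normalize q).
Proof.
by move=> Tw hP; apply: filterS (near_TOmega0 dom Tw) => q /normalize_HOmega/hP.
Qed.

Lemma dH_ext (E : normedModType R) (f h : V * V -> E) w Z : TOmega0 Omega w ->
  (forall q, HOmega Omega q -> f q = h q) -> dH f w Z = dH h w Z.
Proof. by move=> Tw fh; apply: near_eq_derive; exact: (near_HOmega Tw fh). Qed.

Lemma dH_id w Z : HOmega Omega w -> tangent w Z -> dH id w Z = Z.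
Proof.
move=> Hw tZ; have w1 : enorm w.2 = 1 by case: Hw.
have w0 : w.2 != 0 by exact: unit_neq0.
rewrite /dH (is_diff_derive Z (is_diff_normalize w0)) w1 invr1 scale1r orth_id //.
by case: Z tZ.
Qed.

Lemma dH_comp (E : normedModType R) (f : V * V -> E) h w Z : HOmega Omega w ->
  (forall q, HOmega Omega q -> HOmega Omega (h q)) ->
  differentiable (h \o @normalize R n) w ->
  differentiable (f \o @normalize R n) (h w) ->
  dH (f \o h) w Z = dH f (h w) (dH h w Z).
Proof.
move=> Hw hH dh df; have Tw := HOmega_sub Hw.
have hw : (h \o @normalize R n) w = h w by rewrite /= (HOmega_id Hw).
have dfh : is_diff ((h \o @normalize R n) w) (f \o @normalize R n) ('d (f \o @normalize R n) (h w)).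
  by rewrite hw; exact: differentiableP.
have d := is_diff_comp (differentiableP dh) dfh.
have E1 : \forall q \near w, (f \o h \o @normalize R n) q =
    ((f \o @normalize R n) \o (h \o @normalize R n)) q.
  apply: (near_HOmega (P := fun q => f (h q) = f (normalize (h q))) Tw) => q Hq.
  by rewrite (HOmega_id (hH _ Hq)).
rewrite /dH (near_eq_derive Z E1) (is_diff_derive Z d) /=.
by rewrite (deriveE (f := h \o _)) // (deriveE (f := f \o _)).
Qed.

(** Surjectivity comes from the inverse map, which also preserves [E]: by the chain rule its
    differential is a right inverse of that of [f] on tangent vectors. *)
Lemma invertible_image f h (E : V * V -> set (V * V)) w : HOmega Omega w ->
  (forall q, HOmega Omega q -> HOmega Omega (f q)) ->
  (forall q, HOmega Omega q -> HOmega Omega (h q)) ->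
  (forall q, HOmega Omega q -> f (h q) = q) -> h (f w) = w ->
  (forall q, HOmega Omega q -> differentiable (f \o @normalize R n) q) ->
  (forall q, HOmega Omega q -> differentiable (h \o @normalize R n) q) ->
  (forall q, HOmega Omega q -> E q `<=` tangent q) ->
  (forall q Z, HOmega Omega q -> E q Z -> E (f q) (dH f q Z)) ->
  (forall q Z, HOmega Omega q -> E q Z -> E (h q) (dH h q Z)) ->
  dH f w @` E w = E (f w).
Proof.
move=> Hw fH hH fh hf df dh Et Ef Eh; have Hfw := fH _ Hw.
apply/seteqP; split=> [_ [Z EZ <-]|Z EZ]; first exact: Ef.
exists (dH h (f w) Z); first by rewrite -{1}hf; exact: Eh.
rewrite -{1}hf -(dH_comp (f := f)) //; [|exact: dh|by rewrite hf; exact: df].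
rewrite (dH_ext (h := id) _ (HOmega_sub Hfw) fh).
by apply: dH_id => //; exact: Et EZ.
Qed.

End DerivativeOnBundle.

(** * The explicit flow and its differential *)

Section Flow.
Context {R : realType} {n : nat} (Omega : set 'rV[R]_n).
Hypothesis dom : strictly_convex_domain Omega.
Hypothesis C1 : gauge_C1 Omega.
Local Notation V := 'rV[R]_n.
Local Notation tau := (tau Omega).
Local Notation hilb := (hilb Omega).
Local Notation gp := (tau_grad Omega).
Local Notation sig w := (tau (flip w)).
Local Notation gm w := (gp (flip w)).
Local Notation X := (Xfield Omega).
Local Notation speed := (speed Omega).
Local Notation horo := (horo Omega).
Implicit Types (x xi u c y : V) (s t : R) (w q Z v : V * V).

(* Displacement along the line during time [t]: by integration of [s' = speed], the ratio of the distances to the two end points is multiplied by [exp (2 t)]. *)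
Definition advance t w : R := (expR (2 * t) - 1) / (sig w + tau w * expR (2 * t)).
Definition dadvance t w Z : R :=
  - (advance t w / (sig w + tau w * expR (2 * t))) *
    (dsig Omega w Z + expR (2 * t) * dtau Omega w Z).
Definition flow t w : V * V := (w.1 + advance t w *: w.2, w.2).
(** The ratio of the distances to x^+ after and before time [t]; [expan] is the same ratio for x^-.
    Their quotient is [expR (2 * t)], by [expanE]. *)
Definition contr t w : R := 1 - advance t w * tau w.
Definition expan t w : R := 1 + advance t w * sig w.

Lemma advance_den_gt0 t w : TOmega0 Omega w -> 0 < sig w + tau w * expR (2 * t).
Proof.
move=> Tw; apply: addr_gt0; first exact: sig_pos.
by apply: mulr_gt0; [exact: tau_pos|exact: expR_gt0].
Qed.

Lemma contrE t w : TOmega0 Omega w ->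
  contr t w = (sig w + tau w) / (sig w + tau w * expR (2 * t)).
Proof.
move=> Tw; have := advance_den_gt0 t Tw; rewrite /contr /advance.
by move: (tau w) (sig w) (expR _) => a b e d0; field; rewrite gt_eqF.
Qed.

Lemma expanE t w : TOmega0 Omega w -> expan t w = expR (2 * t) * contr t w.
Proof.
move=> Tw; rewrite contrE //; have := advance_den_gt0 t Tw; rewrite /expan /advance.
by move: (tau w) (sig w) (expR _) => a b e d0; field; rewrite gt_eqF.
Qed.

Lemma contr_gt0 t w : TOmega0 Omega w -> 0 < contr t w.
Proof.
move=> Tw; rewrite contrE // divr_gt0 ?advance_den_gt0 // addrC.
exact: hilb_pos.
Qed.

Lemma expan_gt0 t w : TOmega0 Omega w -> 0 < expan t w.
Proof. by move=> Tw; rewrite expanE // mulr_gt0 ?expR_gt0 // contr_gt0. Qed.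

Lemma flow_in t w : TOmega0 Omega w -> Omega (w.1 + advance t w *: w.2).
Proof.
move=> Tw; have := contr_gt0 t Tw; have := expan_gt0 t Tw; rewrite /contr /expan.
case: w Tw => x u [Ox u0] /= h1 h2; apply: tau_line_in => //; first by rewrite -subr_gt0.
by rewrite -subr_gt0 mulNr opprK.
Qed.

Lemma flow_TOmega0 t w : TOmega0 Omega w -> TOmega0 Omega (flow t w).
Proof. by move=> Tw; split; [exact: flow_in|case: Tw]. Qed.

Lemma flow_HOmega t w : HOmega Omega w -> HOmega Omega (flow t w).
Proof. by move=> Hw; split; [exact/flow_in/HOmega_sub|case: Hw]. Qed.

Lemma tau_flow t w : TOmega0 Omega w -> tau (flow t w) = tau w / contr t w.
Proof. by move=> Tw; have [] := tau_shift dom Tw (flow_in t Tw). Qed.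

Lemma sig_flow t w : TOmega0 Omega w -> sig (flow t w) = sig w / expan t w.
Proof. by move=> Tw; have [] := sig_shift dom Tw (flow_in t Tw). Qed.

Lemma gp_flow t w : TOmega0 Omega w -> gp (flow t w) = (contr t w)^-1 *: gp w.
Proof.
move=> Tw; rewrite /flow gp_shift //; last exact: flow_in.
rewrite -/(flow t w) tau_flow // mulrAC mulfV ?mul1r // gt_eqF //; exact: tau_pos.
Qed.

Lemma gm_flow t w : TOmega0 Omega w -> gm (flow t w) = (expan t w)^-1 *: gm w.
Proof.
move=> Tw; have -> : flip (flow t w) = (w.1 + advance t w *: w.2, - w.2) by [].
rewrite gm_shift //; last exact: flow_in.
have -> : (w.1 + advance t w *: w.2, - w.2) = flip (flow t w) by [].
rewrite sig_flow // mulrAC mulfV ?mul1r // gt_eqF //; exact: sig_pos.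
Qed.

Lemma advance_flowN t w : TOmega0 Omega w -> advance (- t) (flow t w) = - advance t w.
Proof.
move=> Tw; have d0 := advance_den_gt0 t Tw.
rewrite /advance tau_flow // sig_flow // expanE // contrE // mulrN expRN.
have e0 := expR_gt0 (2 * t); have t0 := tau_pos dom Tw; have s0 := sig_pos dom Tw.
move: (tau w) (sig w) (expR _) d0 e0 t0 s0 => a b e d0 e0 a0 b0.
have ab : b + a != 0 by rewrite gt_eqF // addr_gt0.
have e1 : e != 0 by rewrite gt_eqF.
have d1 : b + a * e != 0 by rewrite gt_eqF.
have -> : b / (e * ((b + a) / (b + a * e))) + a / ((b + a) / (b + a * e)) / e = (b + a * e) / e.
  by field; rewrite e1 d1 ab.
by field; rewrite e1 d1.
Qed.

Lemma flowNK t w : TOmega0 Omega w -> flow (- t) (flow t w) = w.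
Proof.
move=> Tw; rewrite {1}/flow advance_flowN //= scaleNr addrK.
by case: w {Tw}.
Qed.

Lemma flowKN t w : TOmega0 Omega w -> flow t (flow (- t) w) = w.
Proof. by move=> Tw; rewrite -[t in flow t _]opprK flowNK. Qed.

Lemma hilbertF_unit x u (c : R) : Omega x -> enorm u = 1 -> 0 < c ->
  hilbertF Omega x (c *: u) = c / speed (x, u).
Proof.
move=> Ox u1 c0; have u0 := unit_neq0 u1.
have cv0 (v : V) : v != 0 -> c *: v != 0 by move=> v0; rewrite scaler_eq0 negb_or gt_eqF.
have Nu0 : - u != 0 by rewrite oppr_eq0.
have tp := tau_gt0 dom Ox u0; have sp := tau_gt0 dom Ox Nu0.
rewrite /hilbertF -scalerN !exit_pointE ?cv0 // !tauZ //.
have e (v : V) (r : R) : enorm v = 1 -> 0 < r ->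
    enorm (x - (x + (c * r)^-1 *: (c *: v))) = r^-1.
  move=> v1 r0; rewrite opprD addNKr enormN scalerA invfM mulrAC mulVf ?gt_eqF // mul1r.
  by rewrite enormZ v1 mulr1 gtr0_norm // invr_gt0.
rewrite !e ?enormN // !invrK enormZ u1 mulr1 gtr0_norm //.
by rewrite /speed /hilb /= invf_div mulrCA mulrC mulrA.
Qed.

(** The displacement [s] satisfies an explicit scalar differential equation; a first integral
    determines its solution. *)
Lemma geodesic_flowE (phi : R -> V * V -> V * V) : hilbert_geodesic_flow Omega phi ->
  forall t w, HOmega Omega w -> phi t w = flow t w.
Proof.
move=> hphi t w Hw; have Tw := HOmega_sub Hw; have [phi0 hw] := hphi w Hw.
have u1 : enorm w.2 = 1 by case: Hw.
have t0 := tau_pos dom Tw; have s0 := sig_pos dom Tw.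
pose s (r : R) := dotp ((phi r w).1 - w.1) w.2.
have line r : (phi r w).1 = w.1 + s r *: w.2.
  rewrite (straight_line (g := fun r => (phi r w).1) u1); first by rewrite /s phi0.
  by move=> r'; have [_ _ [c [_ d _]]] := hw r'; exists c.
have On r : Omega (w.1 + s r *: w.2) by rewrite -line; have [[]] := hw r.
have ds r : is_diff (r : R^o) (s : R^o -> R)
    (fun h => h * (2 * (1 - s r * tau w) * (1 + s r * sig w) / (tau w + sig w))).
  have [[Or _] p2 [c [c0 /is_derive_is_diff d F1]]] := hw r.
  have [tE t1] := tau_shift dom Tw (On r).
  have [sE s1] := sig_shift dom Tw (On r).
  (* Unit Hilbert speed makes the Euclidean speed a function of the displacement [s r] alone, for a
     given [w]. *)
  have cE : c = 2 * (1 - s r * tau w) * (1 + s r * sig w) / (tau w + sig w).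
    move: F1; rewrite hilbertF_unit // line /speed /hilb /= tE sE => F1.
    have t1' : 0 < 1 - s r * tau w by rewrite subr_gt0.
    move: F1; move: (s r) (tau w) (sig w) t0 s0 t1' s1 => m a b a0 b0 t1' s1.
    have ab : a + b != 0 by rewrite gt_eqF // addr_gt0.
    have ma : 1 - m * a != 0 by rewrite gt_eqF.
    have mb : 1 + m * b != 0 by rewrite gt_eqF.
    have q0 : a / (1 - m * a) + b / (1 + m * b) = (a + b) / ((1 - m * a) * (1 + m * b)).
      by field; rewrite ma mb.
    rewrite q0 => F1; rewrite -[c](divfK (x := 2 / ((a + b) / ((1 - m * a) * (1 + m * b))))).
      by rewrite F1; field; rewrite ma mb ab.
    by rewrite !mulf_neq0 ?invr_neq0 // !mulf_neq0 ?invr_neq0 // mulf_neq0.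
  have cst (z : V) := is_diff_const z (r : R^o).
  apply: (is_diff_eq (is_diff_dotp (is_diff_sub d (cst w.1)) (cst w.2))).
  apply/funext => h; rewrite dotp0r add0r subr0 !dotpZl unit_dotp // mulr1 -cE.
  by [].
have sm r : s r * tau w < 1 by have [] := tau_shift dom Tw (On r).
have sp r : 0 < 1 + s r * sig w by have [] := sig_shift dom Tw (On r).
(* Up to its initial value, the ratio of the distances to x^- and x^+ times [expR (- 2 * r)]: it is
   constant, and solving [k t = 1] for [s t] gives [advance]. *)
pose k (r : R) : R := (1 + s r * sig w) * (1 - s r * tau w)^-1 * expR (- 2 * r).
have dk (r : R) : is_derive (r : R^o) (1 : R^o) (k : R^o -> R^o) 0.
  apply/is_derive_is_diff.
  have cst (z : R) := @is_diff_const _ _ R^o z (r : R^o).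
  have ma : 1 - s r * tau w != 0 by rewrite gt_eqF // subr_gt0.
  have d1 := @is_diff_add R _ R^o _ _ _ _ _ (cst 1) (is_diff_mul (ds r) (cst (sig w))).
  have d2 := @is_diff_sub R _ R^o _ _ _ _ _ (cst 1) (is_diff_mul (ds r) (cst (tau w))).
  have d3 := is_diff_inv (f := fun r => 1 - s r * tau w) ma d2.
  have dl : is_diff (r : R^o) (fun r : R^o => - 2 * r) (fun h => - 2 * h).
    apply: (is_diff_eq (is_diff_mul (cst (- 2)) (is_diff_idfun (r : R^o)))).
    by apply/funext => h; rewrite mul0r addr0.
  have de : is_diff ((- 2 * r) : R^o) (expR : R^o -> R^o) (fun h => h *: expR (- 2 * r)).
    by apply/is_derive_is_diff; exact: is_derive_expR.
  have d4 := is_diff_comp dl de.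
  apply: (is_diff_eq (is_diff_mul (is_diff_mul d1 d3) d4)).
  apply/funext => h; rewrite /= scaler0 /GRing.scale /=.
  move: (s r) (expR _) (tau w) (sig w) t0 s0 ma => m e a b a0 b0 ma.
  have ab : a + b != 0 by rewrite gt_eqF // addr_gt0.
  by field; rewrite ma ab.
have k1 : k t = 1.
  rewrite (@is_derive_0_is_cst R k t 0 dk) /k /s phi0 subrr dotp0l !mul0r addr0 subr0 mulr0.
  by rewrite expR0 invr1 !mulr1.
have sE : s t = advance t w.
  have d0 := advance_den_gt0 t Tw.
  move: k1; rewrite /k mulNr expRN /advance.
  have := sm t; have e0 := expR_gt0 (2 * t).
  move: (s t) (expR _) (tau w) (sig w) t0 s0 e0 d0 => m e a b a0 b0 e0 d0 ma h.
  have ma' : 1 - m * a != 0 by rewrite gt_eqF // subr_gt0.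
  have h2 : 1 + m * b = (1 - m * a) * e.
    have -> : 1 + m * b = (1 + m * b) / (1 - m * a) / e * ((1 - m * a) * e).
      by field; rewrite ma' gt_eqF.
    by rewrite h mul1r.
  apply: (mulIf (lt0r_neq0 d0)); rewrite divfK ?gt_eqF //.
  by move: h2; clear => h2; lra.
have [_ p2 _] := hw t.
by rewrite [LHS]surjective_pairing p2 line sE.
Qed.

Lemma advance_scale t x xi (c : R) : Omega x -> xi != 0 -> 0 < c ->
  advance t (x, c *: xi) = advance t (x, xi) / c.
Proof.
move=> Ox xi0 c0; have Tw : TOmega0 Omega (x, xi) by [].
have d0 := advance_den_gt0 t Tw.
have tE : tau (x, c *: xi) = c * tau (x, xi) := tau_scale dom Tw c0.
have sE : sig (x, c *: xi) = c * sig (x, xi) := sig_scale dom Tw c0.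
rewrite /advance tE sE.
move: (tau _) (tau _) (expR _) d0 => b a e d0.
have d1 : c * a + c * b * e != 0 by rewrite -mulrA -mulrDr mulf_neq0 // gt_eqF.
by field; rewrite d1 !gt_eqF.
Qed.

Lemma flow_normalize t q : TOmega0 Omega q ->
  flow t (normalize q) = (q.1 + advance t q *: q.2, (normalize q).2).
Proof.
case: q => x xi Tq; have [/= Ox xi0] := Tq.
have e0 := enorm_gt0 xi0; have i0 : 0 < (enorm xi)^-1 by rewrite invr_gt0.
rewrite /flow /normalize /= advance_scale //; congr (_ + _, _).
by rewrite scalerA divfK // gt_eqF.
Qed.

Lemma is_diff_advance t w : TOmega0 Omega w -> is_diff w (advance t) (dadvance t w).
Proof.
move=> Tw; have d0 := advance_den_gt0 t Tw.
have cst (z : R) := @is_diff_const R _ R^o z w.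
have ds := @is_diff_add R _ R^o _ _ _ _ _ (is_diff_sig dom C1 Tw)
  (is_diff_mul (is_diff_tau_pair dom C1 Tw) (cst (expR (2 * t)))).
have di := is_diff_inv (f := fun w => sig w + tau w * expR (2 * t)) (lt0r_neq0 d0) ds.
apply: (is_diff_eq (is_diff_mul (cst (expR (2 * t) - 1)) di)).
apply/funext => Z; rewrite /dadvance /advance /=.
move: (dsig _ _ _) (dtau _ _ _) (tau w) (sig w) (expR _) d0 => a b a' b' e d0.
by field; rewrite gt_eqF.
Qed.

Definition dflow t w Z : V * V :=
  (Z.1 + (advance t w *: Z.2 + dadvance t w Z *: w.2), (enorm w.2)^-1 *: orth w.2 Z.2).

Lemma is_diff_flow t w : TOmega0 Omega w ->
  is_diff w (flow t \o @normalize R n) (dflow t w).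
Proof.
move=> Tw; have w0 : w.2 != 0 by case: Tw.
have d2 := is_diff_snd (is_diff_idfun w).
have d1 := is_diff_add (is_diff_fst (is_diff_idfun w)) (is_diff_scale (is_diff_advance t Tw) d2).
have d := is_diff_pair d1 (is_diff_snd (is_diff_normalize w0)).
apply: near_is_diff d; apply: filterS (near_TOmega0 dom Tw) => q Tq.
by rewrite /= flow_normalize.
Qed.

Lemma dH_flow t w Z : HOmega Omega w -> tangent w Z ->
  dH (flow t) w Z = (Z.1 + (advance t w *: Z.2 + dadvance t w Z *: w.2), Z.2).
Proof.
move=> Hw tZ; rewrite /dH (is_diff_derive Z (is_diff_flow t (HOmega_sub Hw))) /dflow.
by have w1 : enorm w.2 = 1 by [case: Hw]; rewrite w1 invr1 scale1r orth_id.
Qed.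

Lemma dH_flow_X t w : HOmega Omega w -> dH (flow t) w (X w) = X (flow t w).
Proof.
move=> Hw; have Tw := HOmega_sub Hw; have Hf := flow_HOmega t Hw.
rewrite !XfieldE // dH_flow //=; last by rewrite /tangent /= dotp0l.
congr (_, _); rewrite scaler0 add0r -scalerDl; congr (_ *: _).
have d0 := advance_den_gt0 t Tw; have t0 := tau_pos dom Tw; have s0 := sig_pos dom Tw.
have e0 := expR_gt0 (2 * t).
have -> : speed (flow t w) = 2 / (tau w / contr t w + sig w / expan t w).
  by rewrite -tau_flow // -sig_flow.
rewrite expanE // contrE //.
rewrite /dadvance /advance /dsig /dtau /= !dotp0l !dotpZl gp_self // gm_self // /speed /hilb -/(flip w).
move: (tau w) (sig w) (expR _) d0 t0 s0 e0 => a b e d0 a0 b0 e0.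
have ab : a + b != 0 by rewrite gt_eqF // addr_gt0.
have ba : b + a != 0 by rewrite gt_eqF // addr_gt0.
have e1 : e != 0 by rewrite gt_eqF.
have d1 : b + a * e != 0 by rewrite gt_eqF.
have -> : a / ((b + a) / (b + a * e)) + b / (e * ((b + a) / (b + a * e))) =
    (b + a * e) ^+ 2 / (e * (b + a)) by field; rewrite e1 d1 ba.
by field; rewrite ?ab ?ba ?e1 ?d1.
Qed.

Lemma Es_tangent w : HOmega Omega w -> Es Omega w `<=` tangent w.
Proof.
move=> Hw Z /(EsP dom C1 Z Hw)[_ Z2]; rewrite /tangent /= Z2 dotpZl orthP ?mulr0 //.
by case: Hw.
Qed.

Lemma Eu_tangent w : HOmega Omega w -> Eu Omega w `<=` tangent w.
Proof.
move=> Hw Z /(EuP dom C1 Z Hw)[_ Z2]; rewrite /tangent /= Z2 dotpZl orthP ?mulr0 //.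
by case: Hw.
Qed.

(** Subtracting the multiple of [w.2] multiplies the two forms by [contr] and [expan], exactly what
    they lose in [gp_flow] and [gm_flow]. Both thus keep their common value, up to the factor
    [k]. *)
Lemma horo_flow t w (z : V) (k : R) : TOmega0 Omega w -> horo w z ->
  horo (flow t w) (k *: (z - (advance t w * dotp z (gp w)) *: w.2)).
Proof.
move=> Tw hz; rewrite /horo gp_flow // gm_flow // !dotpZr !dotpZl !dotpBl !dotpZl.
rewrite gp_self // gm_self // -hz.
have c0 := contr_gt0 t Tw; have x0 := expan_gt0 t Tw.
have cE : contr t w = 1 - advance t w * tau w by [].
have xE : expan t w = 1 + advance t w * sig w by [].
have -> : dotp z (gp w) - advance t w * dotp z (gp w) * tau w = contr t w * dotp z (gp w).
  by rewrite cE; ring.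
have -> : dotp z (gp w) - advance t w * dotp z (gp w) * - sig w = expan t w * dotp z (gp w).
  by rewrite xE; ring.
move: (dotp _ _) (contr t w) (expan t w) c0 x0 => r c e c0 e0.
by field; rewrite !gt_eqF.
Qed.

Lemma orth_flow (u z : V) (k a : R) : enorm u = 1 -> orth u (k *: (z - a *: u)) = k *: orth u z.
Proof.
move=> u1; rewrite !orth_unit // dotpZl dotpBl dotpZl unit_dotp //.
by apply/rowP => i; rewrite !mxE; ring.
Qed.

(** With [Z.2] equal to [- tau] times the projection of [Z.1], the first component becomes [contr]
    times [Z.1] modulo [w.2], and [dadvance] supplies the multiple of [w.2] that keeps it in
    [horo]. *)
Lemma dH_flow_Es t w Z : HOmega Omega w -> Es Omega w Z ->
  Es Omega (flow t w) (dH (flow t) w Z) /\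
  (dH (flow t) w Z).1 = contr t w *: (Z.1 - (advance t w * dotp Z.1 (gp w)) *: w.2).
Proof.
move=> Hw EZ; have Tw := HOmega_sub Hw; have tZ := Es_tangent Hw EZ.
have [hz Z2] := (EsP dom C1 Z Hw).1 EZ; have w1 : enorm w.2 = 1 by case: Hw.
have c0 := contr_gt0 t Tw.
have E1 : (dH (flow t) w Z).1 = contr t w *: (Z.1 - (advance t w * dotp Z.1 (gp w)) *: w.2).
  rewrite dH_flow //= Z2 orth_unit // /dadvance /dsig /dtau Z2 orth_unit //.
  rewrite !dotpZl !dotpBl !dotpZl gp_self // gm_self // -hz.
  have d0 := advance_den_gt0 t Tw; rewrite /contr /advance.
  move: (dotp _ _) (dotp _ _) (tau w) (sig w) (expR _) d0 => r p a b e d0.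
  by apply/rowP => i; rewrite !mxE; field; rewrite gt_eqF.
split=> //; apply/(EsP dom C1 _ (flow_HOmega t Hw)); rewrite E1; split.
  exact: horo_flow.
rewrite dH_flow //= Z2 orth_flow // tau_flow // scalerA; congr (_ *: _).
by rewrite mulNr divfK // gt_eqF.
Qed.

Lemma dH_flow_Eu t w Z : HOmega Omega w -> Eu Omega w Z ->
  Eu Omega (flow t w) (dH (flow t) w Z) /\
  (dH (flow t) w Z).1 = expan t w *: (Z.1 - (advance t w * dotp Z.1 (gp w)) *: w.2).
Proof.
move=> Hw EZ; have Tw := HOmega_sub Hw; have tZ := Eu_tangent Hw EZ.
have [hz Z2] := (EuP dom C1 Z Hw).1 EZ; have w1 : enorm w.2 = 1 by case: Hw.
have c0 := expan_gt0 t Tw.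
have E1 : (dH (flow t) w Z).1 = expan t w *: (Z.1 - (advance t w * dotp Z.1 (gp w)) *: w.2).
  rewrite dH_flow //= Z2 orth_unit // /dadvance /dsig /dtau Z2 orth_unit //.
  rewrite !dotpZl !dotpBl !dotpZl gp_self // gm_self // -hz.
  have d0 := advance_den_gt0 t Tw; rewrite /expan /advance.
  move: (dotp _ _) (dotp _ _) (tau w) (sig w) (expR _) d0 => r p a b e d0.
  by apply/rowP => i; rewrite !mxE; field; rewrite gt_eqF.
split=> //; apply/(EuP dom C1 _ (flow_HOmega t Hw)); rewrite E1; split.
  exact: horo_flow.
rewrite dH_flow //= Z2 orth_flow // sig_flow // scalerA; congr (_ *: _).
by rewrite divfK // gt_eqF.
Qed.

Lemma flow_invariant t : invariant_under Omega (flow t) X (Es Omega) (Eu Omega).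
Proof.
move=> w Hw; split; first exact: dH_flow_X.
- apply: (invertible_image dom (h := flow (- t)) Hw) => //.
  + by move=> q; exact: flow_HOmega.
  + by move=> q; exact: flow_HOmega.
  + by move=> q /HOmega_sub; exact: flowKN.
  + exact/flowNK/HOmega_sub.
  + by move=> q /HOmega_sub/(is_diff_flow t)[].
  + by move=> q /HOmega_sub/(is_diff_flow (- t))[].
  + by move=> q; exact: Es_tangent.
  + by move=> q Z Hq EZ; have [] := dH_flow_Es t Hq EZ.
  + by move=> q Z Hq EZ; have [] := dH_flow_Es (- t) Hq EZ.
- apply: (invertible_image dom (h := flow (- t)) Hw) => //.
  + by move=> q; exact: flow_HOmega.
  + by move=> q; exact: flow_HOmega.
  + by move=> q /HOmega_sub; exact: flowKN.
  + exact/flowNK/HOmega_sub.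
  + by move=> q /HOmega_sub/(is_diff_flow t)[].
  + by move=> q /HOmega_sub/(is_diff_flow (- t))[].
  + by move=> q; exact: Eu_tangent.
  + by move=> q Z Hq EZ; have [] := dH_flow_Eu t Hq EZ.
  + by move=> q Z Hq EZ; have [] := dH_flow_Eu (- t) Hq EZ.
Qed.

End Flow.

(** * Equivariance under projective maps *)

Section ProjectiveActionOnBundle.
Context {R : realType} {n : nat} (Omega : set 'rV[R]_n).
Hypothesis dom : strictly_convex_domain Omega.
Hypothesis C1 : gauge_C1 Omega.
Variable g : 'M[R]_(n + 1).
Hypotheses (gu : g \in unitmx) (pg : preserved Omega g) (pg' : preserved Omega (invmx g)).
Local Notation V := 'rV[R]_n.
Local Notation tau := (tau Omega).
Local Notation hilb := (hilb Omega).
Local Notation gp := (tau_grad Omega).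
Local Notation dirD := (dirD Omega).
Local Notation X := (Xfield Omega).
Local Notation speed := (speed Omega).
Local Notation horo := (horo Omega).
Implicit Types (x xi u y a b : V) (s t : R) (w q Z v : V * V).

Lemma dpactD x a b : dpact g x (a + b) = dpact g x a + dpact g x b.
Proof. by have := dpact_linear g x 1 a b; rewrite !scale1r. Qed.

Lemma dpact0 x : dpact g x 0 = 0.
Proof. by have := dpact_linear g x (-1) 0 0; rewrite scaler0 addr0 scaleN1r addNr. Qed.

Lemma dpactZ x s a : dpact g x (s *: a) = s *: dpact g x a.
Proof. by have := dpact_linear g x s a 0; rewrite dpact0 !addr0. Qed.

Lemma dpactN x a : dpact g x (- a) = - dpact g x a.
Proof. by rewrite -scaleN1r dpactZ scaleN1r. Qed.

Lemma dpactB x a b : dpact g x (a - b) = dpact g x a - dpact g x b.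
Proof. by rewrite dpactD dpactN. Qed.

Lemma kapD x a b : kap g x (a + b) = kap g x a + kap g x b.
Proof. by have := kap_linear g x 1 a b; rewrite scale1r => ->; rewrite /GRing.scale /= mul1r. Qed.

Lemma kap0 x : kap g x 0 = 0.
Proof.
have := kap_linear g x (-1) 0 0; rewrite scaler0 addr0 /GRing.scale /= mulN1r => h.
by rewrite h addNr.
Qed.

Lemma kapZ x s a : kap g x (s *: a) = s * kap g x a.
Proof. by have := kap_linear g x s a 0; rewrite kap0 !addr0. Qed.

Lemma kapN x a : kap g x (- a) = - kap g x a.
Proof. by rewrite -scaleN1r kapZ mulN1r. Qed.

Lemma tau_g x a : Omega x -> tau (pact g x, dpact g x a) = tau (x, a) + kap g x a.
Proof. exact: tau_pact. Qed.

Lemma hilb_g x a : Omega x -> hilb (pact g x, dpact g x a) = hilb (x, a).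
Proof.
move=> Ox; rewrite /hilb /= -dpactN !tau_g // kapN.
by rewrite addrACA subrr addr0.
Qed.

Lemma dpact_neq0 x xi : Omega x -> xi != 0 -> dpact g x xi != 0.
Proof.
move=> Ox xi0; have [d0 _] := pg Ox; apply: contraNneq xi0 => h.
rewrite -(dpact_inv xi gu d0) h; apply/eqP.
have := dpact_linear (invmx g) (pact g x) (-1) 0 0.
by rewrite scaler0 addr0 scaleN1r addNr.
Qed.

Lemma dirD_g x xi a : Omega x ->
  dirD (pact g x) (dpact g x xi) (dpact g x a) = dirD x xi a + kap g x a.
Proof.
move=> Ox; have [_ Ogx] := pg Ox.
have qE s : 0 < s -> quot Omega (pact g x) (dpact g x xi) (dpact g x a) s =
    quot Omega x xi a s + kap g x a.
  move=> s0; rewrite /quot -dpactZ -dpactD !tau_g // kapD kapZ.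
  move: (tau _) (tau _) (kap g x _) (kap g x _) => p q k l.
  by field; rewrite gt_eqF.
apply/eqP; rewrite eq_le; apply/andP; split.
- rewrite -lerBlDr; apply: le_dirD => s s0; rewrite lerBlDr -qE //.
  exact: dirD_le_quot.
- by apply: le_dirD => s s0; rewrite qE // lerD2r; exact: dirD_le_quot.
Qed.

Lemma gp_g x xi a : Omega x -> xi != 0 ->
  dotp (dpact g x a) (gp (pact g x, dpact g x xi)) = dotp a (gp (x, xi)) + kap g x a.
Proof.
move=> Ox xi0; have [_ Ogx] := pg Ox.
by rewrite -!dirD_grad // ?dirD_g //; exact: dpact_neq0.
Qed.

Lemma gp_scale x xi s : Omega x -> 0 < s -> gp (x, s *: xi) = gp (x, xi).
Proof. by move=> Ox s0; apply/rowP => i; rewrite !mxE /= dirD_scale_base. Qed.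

(** The action on tangent vectors before normalisation, for which differentials are explicit. *)
Definition lift_act w : V * V := (pact g w.1, dpact g w.1 w.2).

Lemma hact_lift w : Omega w.1 -> hact g w = normalize (lift_act w).
Proof.
move=> Ow; have [d0 _] := pg Ow; rewrite /hact /lift_act; congr (normalize (_, _)).
exact: is_diff_derive (is_diff_pact d0).
Qed.

Lemma lift_TOmega0 w : TOmega0 Omega w -> TOmega0 Omega (lift_act w).
Proof. by case=> Ow w0; split; [have [] := pg Ow|exact: dpact_neq0]. Qed.

Lemma hact_HOmega w : HOmega Omega w -> HOmega Omega (hact g w).
Proof.
move=> Hw; have Tw := HOmega_sub Hw; rewrite hact_lift; last by case: Tw.
exact/normalize_HOmega/lift_TOmega0.
Qed.

Lemma hact_normalize q : TOmega0 Omega q -> hact g (normalize q) = normalize (lift_act q).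
Proof.
case: q => x xi [/= Ox xi0]; rewrite hact_lift // /lift_act /= dpactZ.
by apply: normalize_scale; rewrite invr_gt0 enorm_gt0.
Qed.

(** The two [kap] terms are the second derivative of the projective map, evaluated on [w.2] and
    [Z.1]. *)
Definition dlift w Z : V * V :=
  (dpact g w.1 Z.1, dpact g w.1 Z.2 - kap g w.1 w.2 *: dpact g w.1 Z.1 -
                    kap g w.1 Z.1 *: dpact g w.1 w.2).

Lemma is_diff_lift w : Omega w.1 -> is_diff w lift_act (dlift w).
Proof.
move=> Ow; have [d0 _] := pg Ow.
have d1 := is_diff_fst (is_diff_idfun w); have d2 := is_diff_snd (is_diff_idfun w).
have p1 : is_diff w (fun q => pact g q.1) (fun Z => dpact g w.1 Z.1).
  exact: (is_diff_comp d1 (is_diff_pact d0)).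
have n1 : is_diff w (fun q => den g q.1) (fun Z => denlin g Z.1).
  exact: (is_diff_comp d1 (is_diff_den g w.1)).
have l1 : is_diff w (fun q => lsubmx (lin_part g q.2)) (fun Z => lsubmx (lin_part g Z.2)).
  have dl : is_diff (w.2) (fun y => lsubmx (lin_part g y)) (fun y => lsubmx (lin_part g y)).
    by apply: is_diff_linear_rV => s a b; rewrite lin_part_linear linearD linearZ.
  exact: (is_diff_comp d2 dl).
have k1 : is_diff w (fun q => denlin g q.2) (fun Z => denlin g Z.2).
  have dl : is_diff (w.2) (denlin g : V -> R^o) (denlin g).
    by apply: (@is_diff_linear_rV R n R^o); exact: denlin_linear.
  exact: (is_diff_comp d2 dl).
have di := is_diff_inv (f := fun q => den g q.1) d0 n1.
apply: (is_diff_eq (is_diff_pair p1 (is_diff_scale di (is_diff_sub l1 (is_diff_scale k1 p1))))).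
apply/funext => Z; congr (_, _); rewrite /dpact /kap /=.
move: (lsubmx _) (lsubmx _) (lsubmx _) (pact g w.1) => A B C P.
move: (den g w.1) (denlin g _) (denlin g _) (denlin g _) d0 => d k l m d0.
by apply/rowP => i; rewrite !mxE; field.
Qed.

Lemma is_diff_hact w : TOmega0 Omega w ->
  is_diff w (hact g \o @normalize R n)
    (fun Z => ((dlift w Z).1,
      (enorm (lift_act w).2)^-1 *: orth (lift_act w).2 (dlift w Z).2)).
Proof.
move=> Tw; have Ow : Omega w.1 by case: Tw.
have [_ l0] := lift_TOmega0 Tw.
apply: near_is_diff (is_diff_comp (is_diff_lift Ow) (is_diff_normalize l0)).
by apply: filterS (near_TOmega0 dom Tw) => q Tq; rewrite /= hact_normalize.
Qed.

Lemma orth_sub_self u y s : u != 0 -> orth u (y - s *: u) = orth u y.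
Proof.
move=> u0; have uu : dotp u u != 0 by apply: contraNneq u0 => /dotp_eq0 ->.
rewrite /orth dotpBl dotpZl; apply/rowP => i; rewrite !mxE; by field.
Qed.

Lemma dH_hact w Z : HOmega Omega w ->
  dH (hact g) w Z = (dpact g w.1 Z.1, (enorm (lift_act w).2)^-1 *: orth (lift_act w).2
     (dpact g w.1 Z.2 - kap g w.1 w.2 *: dpact g w.1 Z.1)).
Proof.
move=> Hw; have Tw := HOmega_sub Hw; have [_ l0] := lift_TOmega0 Tw.
have l0' : dpact g w.1 w.2 != 0 by exact: l0.
have E := orth_sub_self (dpact g w.1 Z.2 - kap g w.1 w.2 *: dpact g w.1 Z.1) (kap g w.1 Z.1) l0'.
by rewrite /dH (is_diff_derive Z (is_diff_hact Tw)) /lift_act /dlift /= E.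
Qed.

Lemma orthZ u y s : orth u (s *: y) = s *: orth u y.
Proof. by rewrite /orth dotpZl; apply/rowP => i; rewrite !mxE; ring. Qed.

Lemma horo_hact w Z : HOmega Omega w ->
  horo w Z.1 -> horo (hact g w) (dH (hact g) w Z).1.
Proof.
move=> Hw; have Tw := HOmega_sub Hw; case: w Hw Tw => x u Hw [/= Ox u0].
have [_ Ogx] := pg Ox; have l0 := dpact_neq0 Ox u0.
have e0 : 0 < (enorm (dpact g x u))^-1 by rewrite invr_gt0 enorm_gt0.
rewrite dH_hact //= /horo hact_lift //= /normalize /lift_act /flip /= -scalerN.
rewrite !(gp_scale _ Ogx e0) -dpactN !gp_g ?oppr_eq0 //.
by move=> ->.
Qed.

Lemma hactE x u : Omega x ->
  hact g (x, u) = (pact g x, (enorm (dpact g x u))^-1 *: dpact g x u).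
Proof. by move=> Ox; rewrite hact_lift. Qed.

(** The second derivative of the projective map contributes [- kap] times the image of [Z.1],
    precisely the amount by which [tau_g] changes the slope [- tau] of the graph. *)
Lemma hact_Es w Z : HOmega Omega w -> Es Omega w Z ->
  Es Omega (hact g w) (dH (hact g) w Z).
Proof.
move=> Hw EZ; have [hz Z2] := (EsP dom C1 Z Hw).1 EZ.
apply/(EsP dom C1 _ (hact_HOmega Hw)); split; first exact: horo_hact.
have Tw := HOmega_sub Hw; have w1 : enorm w.2 = 1 by case: Hw.
rewrite (dH_hact Z Hw) Z2 (orth_unit Z.1 w1).
case: w Hw Tw w1 {EZ hz Z2} => x u Hw Tw w1; have Ox : Omega x by case: Tw.
have u0 : u != 0 by case: Tw.
have [_ Ogx] := pg Ox.
have l0 := dpact_neq0 Ox u0; have e0 : 0 < (enorm (dpact g x u))^-1 by rewrite invr_gt0 enorm_gt0.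
rewrite (hactE u Ox) [(_, _).2]/= [(_, _).2]/= (tauZ dom _ Ogx e0) (tau_g u Ox) (orth_scale _ _ (lt0r_neq0 e0)).
rewrite dpactZ dpactB dpactZ /=.
have -> : - tau (x, u) *: (dpact g x Z.1 - dotp Z.1 u *: dpact g x u) - kap g x u *: dpact g x Z.1 =
    (- (tau (x, u) + kap g x u)) *: dpact g x Z.1 - (- (tau (x, u) * dotp Z.1 u)) *: dpact g x u.
  by apply/rowP => i; rewrite !mxE; ring.
by rewrite (orth_sub_self _ _ l0) orthZ scalerA mulrN.
Qed.

Lemma hact_Eu w Z : HOmega Omega w -> Eu Omega w Z ->
  Eu Omega (hact g w) (dH (hact g) w Z).
Proof.
move=> Hw EZ; have [hz Z2] := (EuP dom C1 Z Hw).1 EZ.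
apply/(EuP dom C1 _ (hact_HOmega Hw)); split; first exact: horo_hact.
have Tw := HOmega_sub Hw; have w1 : enorm w.2 = 1 by case: Hw.
rewrite (dH_hact Z Hw) Z2 (orth_unit Z.1 w1).
case: w Hw Tw w1 {EZ hz Z2} => x u Hw Tw w1; have Ox : Omega x by case: Tw.
have u0 : u != 0 by case: Tw.
have [_ Ogx] := pg Ox.
have l0 := dpact_neq0 Ox u0; have e0 : 0 < (enorm (dpact g x u))^-1 by rewrite invr_gt0 enorm_gt0.
have fE : flip (hact g (x, u)) = (pact g x, (enorm (dpact g x u))^-1 *: dpact g x (- u)).
  by rewrite (hactE u Ox) /flip /= dpactN scalerN.
rewrite fE (hactE u Ox) [(_, _).2]/= [(_, _).2]/= (tauZ dom _ Ogx e0) (tau_g (- u) Ox) (orth_scale _ _ (lt0r_neq0 e0)).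
rewrite dpactZ dpactB dpactZ kapN /= /flip /=.
have -> : tau (x, - u) *: (dpact g x Z.1 - dotp Z.1 u *: dpact g x u) - kap g x u *: dpact g x Z.1 =
    (tau (x, - u) - kap g x u) *: dpact g x Z.1 - (tau (x, - u) * dotp Z.1 u) *: dpact g x u.
  by apply/rowP => i; rewrite !mxE; ring.
by rewrite (orth_sub_self _ _ l0) orthZ scalerA.
Qed.

Lemma hact_X w : HOmega Omega w -> dH (hact g) w (X w) = X (hact g w).
Proof.
move=> Hw; have Tw := HOmega_sub Hw; have Hg := hact_HOmega Hw.
rewrite (XfieldE dom Hw) (XfieldE dom Hg) (dH_hact _ Hw).
case: w Hw Tw Hg => x u Hw Tw Hg; have Ox : Omega x by case: Tw.
have u0 : u != 0 by case: Tw.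
have [_ Ogx] := pg Ox.
have l0 := dpact_neq0 Ox u0; have e0 : 0 < (enorm (dpact g x u))^-1 by rewrite invr_gt0 enorm_gt0.
have Tg : TOmega0 Omega (pact g x, dpact g x u) by [].
have sE : speed (hact g (x, u)) = speed (x, u) / (enorm (dpact g x u))^-1.
  by rewrite (hactE u Ox) (speed_scale dom Tg e0) /speed hilb_g.
rewrite sE (hactE u Ox) dpactZ dpact0 sub0r /=; congr (_, _).
  by rewrite [RHS]scalerA divfK ?gt_eqF.
by rewrite scalerA -scaleNr orthZ (orth_self l0) !scaler0.
Qed.

Lemma hact_flow t w : HOmega Omega w -> flow Omega t (hact g w) = hact g (flow Omega t w).
Proof.
move=> Hw; have Tw := HOmega_sub Hw; have Tf := flow_TOmega0 dom t Tw.
have Of : Omega (flow Omega t w).1 by case: Tf.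
rewrite (hact_lift Of) hact_lift; last by case: Tw.
rewrite (flow_normalize dom t (lift_TOmega0 Tw)).
case: w Hw Tw Tf Of => x u Hw Tw Tf /= Of; have [/= Ox u0] := Tw.
have [d0 Ogx] := pg Ox; have [d1 _] := pg Of.
have dE : den g (x + advance Omega t (x, u) *: u) = den g x * (1 + advance Omega t (x, u) * kap g x u).
  by rewrite den_line /kap; field.
have k0 : 1 + advance Omega t (x, u) * kap g x u != 0.
  by move: d1; rewrite dE mulf_eq0 negb_or => /andP[].
rewrite /lift_act /= (pact_line d0 k0).
(* The forward and backward gauges change by [kap] and [- kap], so the displacement changes by the
   homography of [pact_line]. *)
have sE : advance Omega t (pact g x, dpact g x u) =
    advance Omega t (x, u) / (1 + advance Omega t (x, u) * kap g x u).
  have c0 := advance_den_gt0 dom t Tw.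
  move: k0; rewrite /advance /flip /= -dpactN !tau_g // kapN.
  move: c0; rewrite /flip /=; move: (tau _) (tau _) (kap _ _ _) (expR _) => b a k e c0 k0.
  have c1 : a + b * e != 0 by rewrite gt_eqF.
  have kE : 1 + (e - 1) / (a + b * e) * k = (a - k + (b + k) * e) / (a + b * e) by field.
  rewrite kE; move: k0; rewrite kE mulf_eq0 negb_or => /andP[k0 _].
  by field; rewrite k0 c1.
(* The image direction at the new point is a positive multiple of the one at [x], hence equal to it
   after normalisation. *)
have dpE : dpact g (x + advance Omega t (x, u) *: u) u =
    (1 + advance Omega t (x, u) * kap g x u) ^- 2 *: dpact g x u.
  rewrite [LHS]/dpact pact_line // dE.
  have -> : lsubmx (lin_part g u) = den g x *: dpact g x u + denlin g u *: pact g x.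
    by rewrite /dpact scalerA mulfV // scale1r subrK.
  have -> : denlin g u = kap g x u * den g x by rewrite /kap divfK.
  move: (dpact g x u) (pact g x) (kap g x u) (advance _ _ _) (den g x) k0 d0 => A P k s d k0 d0.
  by apply/rowP => i; rewrite !mxE; field; rewrite k0 d0.
have c0 : 0 < (1 + advance Omega t (x, u) * kap g x u) ^- 2 by rewrite invr_gt0 exprn_even_gt0.
by rewrite sE dpE (normalize_scale _ (dpact g x u) c0).
Qed.

End ProjectiveActionOnBundle.

(** * Invariance under the group *)

Section GroupInvariance.
Context {R : realType} {n : nat} (Omega : set 'rV[R]_n) (Gamma : set 'M[R]_(n + 1)).
Hypothesis dom : strictly_convex_domain Omega.
Hypothesis C1 : gauge_C1 Omega.
Hypothesis gam : PGL_subgroup Gamma.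
Hypothesis pres : preserves Gamma Omega.
Local Notation V := 'rV[R]_n.
Implicit Types (w q Z : V * V) (g : 'M[R]_(n + 1)).

Lemma hact_inv g w : Gamma g -> HOmega Omega w -> hact (invmx g) (hact g w) = w.
Proof.
move=> Gg Hw; have gu := gamma_unit gam Gg; have Gg' := gamma_inv gam Gg.
have pg := gamma_preserved pres Gg; have pg' := gamma_preserved pres Gg'.
have Tw := HOmega_sub Hw; have Ow : Omega w.1 by case: Tw.
have [d0 _] := pg _ Ow.
have Tl := lift_TOmega0 gu pg Tw.
rewrite (hact_lift pg Ow) (hact_normalize pg' Tl).
by rewrite /lift_act /= pact_inv // dpact_inv // -[RHS](HOmega_id Hw); case: (w).
Qed.

Lemma hact_invariant g : Gamma g ->
  invariant_under Omega (hact g) (Xfield Omega) (Es Omega) (Eu Omega).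
Proof.
move=> Gg w Hw; have gu := gamma_unit gam Gg; have Gg' := gamma_inv gam Gg.
have gu' := gamma_unit gam Gg'.
have pg := gamma_preserved pres Gg; have pg' := gamma_preserved pres Gg'.
have pg'' : preserved Omega (invmx (invmx g)) by rewrite invmxK.
have hK q : HOmega Omega q -> hact g (hact (invmx g) q) = q.
  by move=> Hq; rewrite -{1}[g]invmxK; exact: hact_inv.
have H1 q : HOmega Omega q -> HOmega Omega (hact g q) by exact: hact_HOmega.
have H2 q : HOmega Omega q -> HOmega Omega (hact (invmx g) q) by exact: hact_HOmega.
have D1 q : HOmega Omega q -> differentiable (hact g \o @normalize R n) q.
  by move=> /HOmega_sub/(is_diff_hact dom gu pg)[].
have D2 q : HOmega Omega q -> differentiable (hact (invmx g) \o @normalize R n) q.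
  by move=> /HOmega_sub/(is_diff_hact dom gu' pg')[].
split; first exact: hact_X.
- apply: (invertible_image dom (h := hact (invmx g)) Hw) => //.
  + exact: hact_inv.
  + by move=> q; exact: Es_tangent.
  + by move=> q Z; exact: hact_Es.
  + by move=> q Z; exact: hact_Es.
- apply: (invertible_image dom (h := hact (invmx g)) Hw) => //.
  + exact: hact_inv.
  + by move=> q; exact: Eu_tangent.
  + by move=> q Z; exact: hact_Eu.
  + by move=> q Z; exact: hact_Eu.
Qed.

End GroupInvariance.

(** * Uniform contraction *)

Section CompactZeros.
Context {R : realType}.

(** A cluster point of the zero set is a zero, since otherwise [f] would not vanish nearby. *)
Lemma compact_zeros (T : topologicalType) (B : set T) (f : T -> R) :
  compact B -> (forall a, B a -> {for a, continuous f}) ->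
  compact [set a | B a /\ f a = 0].
Proof.
move=> cB cf F PF FA.
have FB : F B by apply: filterS FA => a [].
have [p [Bp clp]] := cB F PF FB; exists p; split=> //; split=> //.
apply: contrapT => /eqP fp.
by have [a [[_ fa]]] := clp _ _ FA (near_neq0 (cf p Bp) fp); rewrite /= fa eqxx.
Qed.

Lemma compact_unit_sphere (n : nat) : compact [set u : 'rV[R]_n | enorm u = 1].
Proof.
have -> : [set u : 'rV[R]_n | enorm u = 1] =
    [set u | [set u : 'rV[R]_n | 0 <= `|u| /\ `|u| <= 1] u /\ dotp u u - 1 = 0].
  apply/seteqP; split=> u /= [].
    move=> u1; have uu := unit_dotp u1; split; last by rewrite uu subrr.
    split=> //; rewrite [leLHS]/Num.Def.normr /= mx_normrE; apply: bigmax_le => // -[i j] _ /=.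
    rewrite (ord1 i) -(expr_le1 (n := 2)) // real_normK ?num_real //.
    rewrite -uu dotpE (bigD1 j) //= -expr2 lerDl sumr_ge0 // => k _.
    by rewrite -expr2 sqr_ge0.
  by move=> _ /eqP; rewrite subr_eq0 /enorm => /eqP ->; rewrite sqrtr1.
apply: (@compact_zeros _ _ (fun u => dotp u u - 1)); first exact: compact_shell.
move=> u _; apply: (@cont_sub R); last exact: cont_cst.
apply: (@cont_comp _ _ _ (fun u : 'rV[R]_n => (u, u)) (fun p => dotp p.1 p.2)).
  by apply: cont_pair; exact: cont_id.
exact: dotp_continuous.
Qed.

End CompactZeros.

(** * Strict contraction in positive time *)

Section Contraction.
Context {R : realType} {n : nat} (Omega : set 'rV[R]_n).
Hypothesis dom : strictly_convex_domain Omega.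
Hypothesis C1 : gauge_C1 Omega.
Local Notation V := 'rV[R]_n.
Local Notation tau := (tau Omega).
Local Notation hilb := (hilb Omega).
Local Notation gp := (tau_grad Omega).
Local Notation sig w := (tau (flip w)).
Local Notation horo := (horo Omega).
Implicit Types (x xi u y z p : V) (s t th : R) (w q Z : V * V).

(** Equality would make [tau] additive on [xi] and [z], because the supporting form bounds
    [tau (x, xi + z)] from below. This contradicts [tau_strict], as the exit points differ. *)
Lemma dotp_grad_lt x xi z : Omega x -> xi != 0 -> (forall c, z != c *: xi) ->
  dotp z (gp (x, xi)) < tau (x, z).
Proof.
move=> Ox xi0 nz; have z0 : z != 0 by have := nz 0; rewrite scale0r.
rewrite lt_neqAle dotp_grad_le // andbT; apply/eqP => E.
have zt := tau_gt0 dom Ox z0; have xt := tau_gt0 dom Ox xi0.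
have ne : (tau (x, xi))^-1 *: xi != (tau (x, z))^-1 *: z.
  apply: contra (nz (tau (x, z) / tau (x, xi))) => /eqP h.
  by rewrite -scalerA h scalerA mulfV ?gt_eqF // scale1r.
have := tau_strict dom Ox xi0 z0 ne; rewrite ltNge => /negP; apply.
rewrite -E -(dotp_grad_self dom C1 Ox xi0) -dotpDl; exact: dotp_grad_le.
Qed.

(* The new exit point in direction [z] lies on the segment from the old one to [p], hence inside [Omega]. *)
Lemma tau_contract x p z th (v : R) : Omega x -> closure Omega p -> z != 0 ->
  0 < th -> th < 1 -> v < tau (x, z) -> x + (tau (x, z))^-1 *: z != p ->
  tau ((1 - th) *: x + th *: p, (1 - th) *: (z - (v * th) *: (p - x))) <
    tau (x, z) - th * v.
Proof.
move=> Ox Op z0 th0 th1 va yp; have a0 := tau_gt0 dom Ox z0.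
have Oy : closure Omega (x + (tau (x, z))^-1 *: z) by exact/tau_leP.
move: (tau (x, z)) va yp a0 Oy => a va yp a0 Oy.
have T0 : 0 < a - th * v by nra.
have Oxt : Omega ((1 - th) *: x + th *: p) by apply: domain_star => //; exact: ltW.
apply/(tau_ltP dom _ Oxt T0).
have -> : (1 - th) *: x + th *: p + (a - th * v)^-1 *: ((1 - th) *: (z - (v * th) *: (p - x))) =
    (1 - th * (a - v) / (a - th * v)) *: (x + a^-1 *: z) + (th * (a - v) / (a - th * v)) *: p.
  by apply/rowP => i; rewrite !mxE; field; rewrite !gt_eqF.
apply: segment_inside => //.
  by rewrite divr_gt0 // mulr_gt0 // subr_gt0.
rewrite ltr_pdivrMr // mul1r; nra.
Qed.

(** [tau_contract] is applied to [z] and [- z], with [p] the end point of the geodesic and [v] the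
    value of the supporting form. The corrections [th * v] are opposite and cancel in the sum. *)
Lemma hilb_contract x xi z th : Omega x -> xi != 0 -> (forall c, z != c *: xi) ->
  0 < th -> th < 1 ->
  hilb (x + (th / tau (x, xi)) *: xi,
        (1 - th) *: (z - (dotp z (gp (x, xi)) * (th / tau (x, xi))) *: xi)) < hilb (x, z).
Proof.
move=> Ox xi0 nz th0 th1; have xt := tau_gt0 dom Ox xi0.
have z0 : z != 0 by have := nz 0; rewrite scale0r.
have nNz c : - z != c *: xi by rewrite eqr_oppLR -scaleNr.
have Nz0 : - z != 0 by rewrite oppr_eq0.
pose p := x + (tau (x, xi))^-1 *: xi.
have Op : closure Omega p by exact/tau_leP.
have np y : (forall c, y != c *: xi) -> x + (tau (x, y))^-1 *: y != p.
  move=> ny; rewrite /p (inj_eq (addrI x)); apply: contra (ny (tau (x, y) / tau (x, xi))) => /eqP h.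
  have y0 : y != 0 by have := ny 0; rewrite scale0r.
  by rewrite -scalerA -h scalerA mulfV ?scale1r // gt_eqF // tau_gt0.
have h1 := tau_contract Ox Op z0 th0 th1 (dotp_grad_lt Ox xi0 nz) (np _ nz).
have h2 := tau_contract Ox Op Nz0 th0 th1 (dotp_grad_lt Ox xi0 nNz) (np _ nNz).
have xE : (1 - th) *: x + th *: p = x + (th / tau (x, xi)) *: xi.
  by rewrite /p; apply/rowP => i; rewrite !mxE; ring.
have zE c : (1 - th) *: (c *: z - (dotp (c *: z) (gp (x, xi)) * th) *: (p - x)) =
    c *: ((1 - th) *: (z - (dotp z (gp (x, xi)) * (th / tau (x, xi))) *: xi)).
  by rewrite /p dotpZl; apply/rowP => i; rewrite !mxE; ring.
have := zE 1; rewrite !scale1r => zE1.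
have := zE (-1); rewrite !scaleN1r => zE2.
move: h1 h2; rewrite xE zE1 zE2 dotpNl /hilb /= => h1 h2.
apply: lt_le_trans (ltrD h1 h2) _; rewrite le_eqVlt; apply/orP; left; apply/eqP.
move: (tau _) (tau _) (dotp _ _) => a b c; ring.
Qed.

Lemma horo_transverse w z : TOmega0 Omega w -> horo w z -> z != 0 -> forall c, z != c *: w.2.
Proof.
move=> Tw hz z0 c; apply: contraNneq z0 => zE; move: hz; rewrite /horo zE !dotpZl.
rewrite gp_self // gm_self // => /eqP; rewrite -subr_eq0 -mulrBr opprK mulf_eq0.
by rewrite (gt_eqF (hilb_pos dom Tw)) orbF => /eqP ->; rewrite scale0r.
Qed.

(** The action of the flow on the base component, common to both subbundles: [k] is [contr] on E^s
    and [expan] on E^u. *)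
Definition push (k : R -> V * V -> R) t w z : V :=
  k t w *: (z - (advance Omega t w * dotp z (gp w)) *: w.2).

Lemma advance_ge0 t w : TOmega0 Omega w -> 0 < t -> 0 < advance Omega t w.
Proof.
move=> Tw t0; rewrite /advance divr_gt0 ?advance_den_gt0 // subr_gt0.
by rewrite -expR0 ltr_expR mulr_gt0.
Qed.

Lemma advance_le0 t w : TOmega0 Omega w -> 0 < t -> advance Omega (- t) w < 0.
Proof.
move=> Tw t0; rewrite /advance pmulr_llt0 ?invr_gt0 ?advance_den_gt0 // subr_lt0.
by rewrite -expR0 ltr_expR mulrN oppr_lt0 mulr_gt0.
Qed.

Lemma push_contr_lt t w z : TOmega0 Omega w -> 0 < t -> horo w z -> z != 0 ->
  hilb ((flow Omega t w).1, push (contr Omega) t w z) < hilb (w.1, z).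
Proof.
move=> Tw t0 hz z0; have a0 := advance_ge0 Tw t0; have tp := tau_pos dom Tw.
have c0 := contr_gt0 dom t Tw; have nz := horo_transverse Tw hz z0.
have Ow : Omega w.1 by case: Tw.
have w0 : w.2 != 0 by case: Tw.
have wE : (w.1, w.2) = w by case: (w).
have th1 : advance Omega t w * tau w < 1 by rewrite -subr_gt0.
have := hilb_contract Ow w0 nz (mulr_gt0 a0 tp) th1.
by rewrite wE mulfK ?gt_eqF // [dotp _ _ * _]mulrC.
Qed.

(** In negative time the motion goes towards x^-, so [hilb_contract] is used in the direction
    [- w.2]; [horo] exchanges the form at x^- for the one at x^+ that occurs in [push]. *)
Lemma push_expan_lt t w z : TOmega0 Omega w -> 0 < t -> horo w z -> z != 0 ->
  hilb ((flow Omega (- t) w).1, push (expan Omega) (- t) w z) < hilb (w.1, z).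
Proof.
move=> Tw t0 hz z0; have a0 := advance_le0 Tw t0; have sp := sig_pos dom Tw.
have c0 := expan_gt0 dom (- t) Tw; have nz := horo_transverse Tw hz z0.
have Ow : Omega w.1 by case: Tw.
have w0 : - w.2 != 0 by case: Tw; rewrite oppr_eq0.
have nz' c : z != c *: - w.2 by rewrite scalerN -scaleNr.
have th0 : 0 < - advance Omega (- t) w * sig w by rewrite mulr_gt0 // oppr_gt0.
have th1 : - advance Omega (- t) w * sig w < 1.
  by rewrite -subr_gt0 mulNr opprK.
have := hilb_contract Ow w0 nz' th0 th1.
rewrite -/(flip w) mulfK ?gt_eqF // !scalerN !scaleNr mulrN scaleNr !opprK -hz.
by rewrite [dotp _ _ * _]mulrC mulNr opprK.
Qed.

Lemma push0 k t w : push k t w 0 = 0.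
Proof. by rewrite /push dotp0l mulr0 scale0r subr0 scaler0. Qed.

Lemma pushZ k t w s z : push k t w (s *: z) = s *: push k t w z.
Proof. by rewrite /push dotpZl; apply/rowP => i; rewrite !mxE; ring. Qed.

Lemma advanceD s t w : TOmega0 Omega w ->
  advance Omega (s + t) w = advance Omega t w + advance Omega s (flow Omega t w).
Proof.
move=> Tw; have d0 := advance_den_gt0 dom t Tw; have d1 := advance_den_gt0 dom (s + t) Tw.
have e0 := expR_gt0 (2 * t); have e1 := expR_gt0 (2 * s).
have t0 := tau_pos dom Tw; have s0 := sig_pos dom Tw.
move: d1; rewrite /advance tau_flow // sig_flow // expanE // contrE // mulrDr expRD.
move: (tau w) (sig w) (expR _) (expR _) d0 e0 e1 t0 s0 => a b f e d0 f0 e0 a0 b0 d1.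
have ab : b + a != 0 by rewrite gt_eqF // addr_gt0.
have e1 : e != 0 by rewrite gt_eqF.
have d0' : b + a * e != 0 by move: d0; rewrite lt0r => /andP[].
have d1' : b + a * (f * e) != 0 by move: d1; rewrite lt0r => /andP[].
have -> : b / (e * ((b + a) / (b + a * e))) + a / ((b + a) / (b + a * e)) * f =
    (b + a * e) * (b + a * (f * e)) / (e * (b + a)) by field; rewrite ?d0' ?ab ?e1.
by field; rewrite ?d1' ?d0' ?e1 ?ab.
Qed.

End Contraction.

Section Continuity.
Context {R : realType} {n : nat} (Omega : set 'rV[R]_n).
Hypothesis dom : strictly_convex_domain Omega.
Hypothesis C1 : gauge_C1 Omega.
Local Notation V := 'rV[R]_n.
Local Notation gp := (tau_grad Omega).
Implicit Types (w q Z : V * V) (t : R).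

Lemma cont_dotp (T : topologicalType) (f g : T -> V) a :
  {for a, continuous f} -> {for a, continuous g} ->
  {for a, continuous (fun y => dotp (f y) (g y))}.
Proof.
move=> cf cg; apply: (@cont_comp _ _ _ (fun y => (f y, g y)) (fun p => dotp p.1 p.2)).
  exact: cont_pair.
exact: dotp_continuous.
Qed.

Lemma gp_continuous w : TOmega0 Omega w -> {for w, continuous gp}.
Proof. by case: w => x u [Ox u0]; exact: tau_grad_continuous. Qed.

Lemma flip_continuous w : {for w, continuous (@flip R n)}.
Proof. by apply: differentiable_continuous; have [] := is_diff_flip w. Qed.

Lemma gm_continuous w : TOmega0 Omega w -> {for w, continuous (fun q => gp (flip q))}.
Proof.
move=> /TOmega0_flip Tf; apply: cont_comp; first exact: flip_continuous.
exact: gp_continuous.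
Qed.

Lemma is_diff_continuous (U W : normedModType R) (f : U -> W) df (p : U) :
  is_diff p f df -> {for p, continuous f}.
Proof. by case=> d _; exact: differentiable_continuous. Qed.

Lemma advance_continuous t w : TOmega0 Omega w -> {for w, continuous (advance Omega t)}.
Proof. by move=> /(is_diff_advance dom C1 t)/is_diff_continuous. Qed.

Lemma contr_continuous t w : TOmega0 Omega w -> {for w, continuous (contr Omega t)}.
Proof.
move=> Tw; apply: (@cont_sub R); first exact: cont_cst.
apply: cont_mul; first exact: advance_continuous.
exact: is_diff_continuous (is_diff_tau_pair dom C1 Tw).
Qed.

Lemma expan_continuous t w : TOmega0 Omega w -> {for w, continuous (expan Omega t)}.
Proof.
move=> Tw; apply: (@cont_add R); first exact: cont_cst.
apply: cont_mul; first exact: advance_continuous.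
exact: is_diff_continuous (is_diff_sig dom C1 Tw).
Qed.

End Continuity.

(** * Exponential decay of the Hilbert norm *)

Section UniformContraction.
Context {R : realType} {n : nat} (Omega : set 'rV[R]_n) (Gamma : set 'M[R]_(n + 1)).
Hypothesis dom : strictly_convex_domain Omega.
Hypothesis C1 : gauge_C1 Omega.
Hypothesis gam : PGL_subgroup Gamma.
Hypothesis pres : preserves Gamma Omega.
Local Notation V := 'rV[R]_n.
Local Notation hilb := (hilb Omega).
Local Notation gp := (tau_grad Omega).
Local Notation gm w := (gp (flip w)).
Local Notation horo := (horo Omega).
Local Notation flow := (flow Omega).
Local Notation push := (push Omega).
Implicit Types (x u z : V) (w q Z : V * V) (s t : R).

(** Twice the Hilbert norm of the base component: a norm on each of the two subbundles, as they are
    graphs over that component. *)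
Definition hnorm w Z : R := hilb (w.1, Z.1).

Lemma flowD s t w : TOmega0 Omega w -> flow (s + t) w = flow s (flow t w).
Proof.
by move=> Tw; rewrite /flow (advanceD dom) //= scalerDl addrA.
Qed.

Lemma flow0 w : flow 0 w = w.
Proof. by rewrite /flow /advance mulr0 expR0 subrr mul0r scale0r addr0; case: w. Qed.

Lemma dH_flowD s t w Z : HOmega Omega w ->
  dH (flow (s + t)) w Z = dH (flow s) (flow t w) (dH (flow t) w Z).
Proof.
move=> Hw; have Tw := HOmega_sub Hw.
rewrite -(dH_comp (f := flow s) dom Z Hw).
- apply: (dH_ext (f := flow (s + t)) (h := flow s \o flow t) dom Z Tw) => q Hq.
  exact: (flowD s t (HOmega_sub Hq)).
- by move=> q; exact: flow_HOmega.
- by have [] := is_diff_flow dom C1 t Tw.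
- by have [] := is_diff_flow dom C1 s (flow_TOmega0 dom t Tw).
Qed.

Lemma hnorm_hact g w Z : Gamma g -> HOmega Omega w ->
  hnorm (hact g w) (dH (hact g) w Z) = hnorm w Z.
Proof.
move=> Gg Hw; have gu := gamma_unit gam Gg.
have pg := gamma_preserved pres Gg; have pg' := gamma_preserved pres (gamma_inv gam Gg).
have Ow : Omega w.1 by case: Hw.
rewrite /hnorm (dH_hact dom gu pg) // (hact_lift pg) //=.
exact: (hilb_g dom gu pg pg').
Qed.

Lemma dH_hact_flow g t w Z : Gamma g -> HOmega Omega w ->
  dH (flow t) (hact g w) (dH (hact g) w Z) = dH (hact g) (flow t w) (dH (flow t) w Z).
Proof.
move=> Gg Hw; have gu := gamma_unit gam Gg; have Tw := HOmega_sub Hw.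
have pg := gamma_preserved pres Gg; have pg' := gamma_preserved pres (gamma_inv gam Gg).
rewrite -(dH_comp (f := flow t) dom Z Hw).
- rewrite -(dH_comp (f := hact g) dom Z Hw).
  + apply: (dH_ext (f := flow t \o hact g) (h := hact g \o flow t) dom Z Tw) => q Hq.
    exact: (hact_flow dom gu pg pg' t Hq).
  + by move=> q; exact: flow_HOmega.
  + by have [] := is_diff_flow dom C1 t Tw.
  + by have [] := is_diff_hact dom gu pg (flow_TOmega0 dom t Tw).
- by move=> q; exact: hact_HOmega.
- by have [] := is_diff_hact dom gu pg Tw.
- by have [] := is_diff_flow dom C1 t (HOmega_sub (hact_HOmega gu pg Hw)).
Qed.

(** Both subbundles are treated at once: E^s with [k = contr] and [e = 1], E^u with [k = expan] and
    [e = -1]. *)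
Variables (E : V * V -> set (V * V)) (k : R -> V * V -> R) (e : R).
Hypothesis E_tangent : forall w, HOmega Omega w -> E w `<=` tangent w.
Hypothesis E_horo : forall w Z, HOmega Omega w -> E w Z -> horo w Z.1.
Hypothesis E_flow : forall t w Z, HOmega Omega w -> E w Z ->
  E (flow t w) (dH (flow t) w Z) /\ (dH (flow t) w Z).1 = push k t w Z.1.
Hypothesis E_hact : forall g w Z, Gamma g -> HOmega Omega w -> E w Z ->
  E (hact g w) (dH (hact g) w Z).
Hypothesis k_continuous : forall t w, TOmega0 Omega w -> {for w, continuous (k t)}.
Hypothesis push_lt : forall t w z, TOmega0 Omega w -> 0 < t -> horo w z -> z != 0 ->
  hilb ((flow (e * t) w).1, push k (e * t) w z) < hilb (w.1, z).

Lemma push_continuous t (p : (V * V) * V) : TOmega0 Omega p.1 ->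
  {for p, continuous (fun p : (V * V) * V => hilb ((flow t p.1).1, push k t p.1 p.2))}.
Proof.
move=> Tp; have cp1 := @cont_fst _ _ _ (fun p => p) p (@cont_id _ _).
have cz := @cont_snd _ _ _ (fun p => p) p (@cont_id _ _).
have ca : {for p, continuous (fun p : (V * V) * V => advance Omega t p.1)}.
  by apply: cont_comp cp1 _; exact: advance_continuous.
have cu : {for p, continuous (fun p : (V * V) * V => p.1.2)} by exact: cont_snd.
have cx : {for p, continuous (fun p : (V * V) * V => p.1.1)} by exact: cont_fst.
apply: (@cont_comp _ _ _ (fun p : (V * V) * V => ((flow t p.1).1, push k t p.1 p.2)) hilb).
  have cg := cont_comp cp1 (gp_continuous dom C1 Tp).
  have ck := cont_comp cp1 (@k_continuous t p.1 Tp).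
  have cs := cont_scale (cont_mul ca (cont_dotp cz cg)) cu.
  exact: (cont_pair (cont_add cx (cont_scale ca cu)) (cont_scale ck (cont_sub cz cs))).
by apply: hilb_continuous => //; exact: flow_in.
Qed.

Variable K : set V.
Hypotheses (cK : compact K) (KO : K `<=` Omega).
Hypothesis K_meets : forall x, Omega x -> exists2 g, Gamma g & K (pact g x).

(** The vectors [z] of sup norm 1 in [horo], over unit vectors based in [K], form a compact set on
    which the decrease of N has a positive minimum [d]; homogeneity in [z] does the rest. *)
Lemma push_uniform : exists2 a : R, 0 < a & forall w z, K w.1 -> enorm w.2 = 1 -> horo w z ->
  hilb ((flow e w).1, push k e w z) <= expR (- a) * hilb (w.1, z).
Proof.
pose B := [set p : (V * V) * V | ([set w : V * V | K w.1 /\ enorm w.2 = 1] p.1) /\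
                                 (1 <= `|p.2| /\ `|p.2| <= 1)].
have cB : compact B.
  have h : compact [set w : V * V | K w.1 /\ enorm w.2 = 1].
    by have := compact_setX cK (@compact_unit_sphere R n); congr compact.
  by have := compact_setX h (@compact_shell R n 1 1); congr compact.
have BT p : B p -> TOmega0 Omega p.1.
  by move=> [[/KO Op p1] _]; split=> //; exact: unit_neq0.
pose f (p : (V * V) * V) := dotp p.2 (gp p.1) - dotp p.2 (gm p.1).
have cA := @compact_zeros R _ B f cB.
have {}cA : compact [set p | B p /\ f p = 0].
  apply: cA => p Bp; have Tp := BT _ Bp.
  have cp1 := @cont_fst _ _ _ (fun p => p) p (@cont_id _ _).
  have cz := @cont_snd _ _ _ (fun p => p) p (@cont_id _ _).
  have cg := cont_dotp cz (cont_comp cp1 (gp_continuous dom C1 Tp)).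
  have cm := cont_dotp cz (cont_comp cp1 (gm_continuous dom C1 Tp)).
  exact: (@cont_sub R _ R^o _ _ _ cg cm).
have nc p : B p -> {for p, continuous (fun p : (V * V) * V => hilb (p.1.1, p.2))}.
  move=> Bp; have [Op _] := BT _ Bp.
  apply: (@cont_comp _ _ _ (fun p : (V * V) * V => (p.1.1, p.2)) hilb).
    apply: cont_pair; last by apply: cont_snd; exact: cont_id.
    by apply: cont_fst; apply: cont_fst; exact: cont_id.
  exact: hilb_continuous.
have [d d0 hd] : exists2 d : R, 0 < d & forall p, B p /\ f p = 0 ->
    d <= hilb (p.1.1, p.2) - hilb ((flow e p.1).1, push k e p.1 p.2).
  apply: (compact_lower (f := fun p => hilb (p.1.1, p.2) - hilb ((flow e p.1).1, push k e p.1 p.2)) cA) => p [Bp fp].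
    exact: (@cont_sub R _ R^o _ _ _ (nc p Bp) (push_continuous (t := e) (BT _ Bp))).
  have h : horo p.1 p.2 by apply/eqP; rewrite -subr_eq0; apply/eqP.
  have z0 : p.2 != 0 by rewrite -normr_gt0; case: Bp => _ [/(lt_le_trans ltr01)].
  by have := push_lt (BT _ Bp) ltr01 h z0; rewrite mulr1 subr_gt0.
have [C C0 hC] := compact_upper (f := fun p : (V * V) * V => hilb (p.1.1, p.2)) cB nc.
(* N is at most [C] on this set, so a loss of [d] is at least the fraction [d / C] of N, and
   [1 - d / C <= expR (- (d / C))]. *)
exists (d / C); first exact: divr_gt0.
have unitC w z : K w.1 -> enorm w.2 = 1 -> horo w z -> `|z| = 1 ->
    hilb ((flow e w).1, push k e w z) <= expR (- (d / C)) * hilb (w.1, z).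
  move=> Kw w1 hz z1; have Bp : B (w, z) by split; rewrite //= z1.
  have fp : f (w, z) = 0 by rewrite /f hz subrr.
  have := hd (w, z) (conj Bp fp); have := hC (w, z) Bp; have := expR_ge1Dx (- (d / C)).
  have := hilb_ge0 Omega (w.1, z); rewrite /=.
  move: (hilb (w.1, z)) (hilb (_, push k e w z)) (expR _) => a b q a0 qd aC ab.
  have h1 : (1 - d / C) * a <= q * a by rewrite ler_wpM2r.
  apply: le_trans h1; rewrite mulrBl mul1r lerBrDl -lerBrDr.
  apply: le_trans _ ab; rewrite mulrAC ler_pdivrMr // ler_pM2l //.
move=> w z Kw w1 hz; have Tw : TOmega0 Omega w by split; [exact: KO|exact: unit_neq0].
have Of := flow_in dom e Tw; have Ow : Omega w.1 by exact: KO.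
have [->|z0] := eqVneq z 0; first by rewrite push0 !hilb0 // mulr0.
have n0 : 0 < `|z| by rewrite normr_gt0.
have [y y1 zE] : exists2 y : V, `|y| = 1 & z = `|z| *: y.
  exists (`|z|^-1 *: z); last by rewrite scalerA mulfV ?gt_eqF // scale1r.
  by rewrite normrZ ger0_norm ?invr_ge0 ?ltW // mulVf // gt_eqF.
move: n0 zE hz {z0}; move: `|z| => r r0 -> hz.
rewrite pushZ (hilbZ dom _ Of r0) (hilbZ dom _ Ow r0) mulrCA (ler_pM2l r0); apply: unitC => //.
by move: hz; rewrite /horo !dotpZl => /(mulfI (lt0r_neq0 r0)).
Qed.

Lemma hnorm_uniform : exists2 a : R, 0 < a & forall w Z, HOmega Omega w -> E w Z ->
  hnorm (flow e w) (dH (flow e) w Z) <= expR (- a) * hnorm w Z.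
Proof.
have [a a0 ha] := push_uniform; exists a => // w Z Hw EZ.
have [g Gg Kg] : exists2 g, Gamma g & K (pact g w.1) by apply: K_meets; case: Hw.
have gu := gamma_unit gam Gg; have pg := gamma_preserved pres Gg.
have Hg : HOmega Omega (hact g w) by exact: hact_HOmega.
have pg' := gamma_preserved pres (gamma_inv gam Gg).
rewrite -(hnorm_hact Z Gg Hw) -(hnorm_hact (dH (flow e) w Z) Gg (flow_HOmega dom e Hw)).
rewrite -dH_hact_flow // -(hact_flow dom gu pg pg') //.
have EZ' := E_hact Gg Hw EZ.
rewrite {1}/hnorm (E_flow e Hg EZ').2; apply: ha.
- by rewrite (hact_lift pg) //; case: Hw.
- by case: Hg.
- exact: E_horo.
Qed.

Lemma hnorm_mono t w Z : 0 <= t -> HOmega Omega w -> E w Z ->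
  hnorm (flow (e * t) w) (dH (flow (e * t)) w Z) <= hnorm w Z.
Proof.
move=> t0 Hw EZ; have Tw := HOmega_sub Hw; have Ow : Omega w.1 by case: Hw.
move: t0; rewrite le_eqVlt => /orP[/eqP <-|t0].
  rewrite mulr0 flow0 (dH_ext dom (h := id) _ Tw) => [|q _]; last exact: flow0.
  by rewrite (dH_id Hw) //; exact: E_tangent EZ.
rewrite /hnorm (E_flow (e * t) Hw EZ).2.
have [->|z0] := eqVneq Z.1 0.
  by rewrite push0 !hilb0 //; exact: flow_in.
by apply/ltW/push_lt => //; exact: E_horo.
Qed.

Lemma hnorm_decay : exists2 a : R, 0 < a & forall t w Z, 0 <= t -> HOmega Omega w -> E w Z ->
  hnorm (flow (e * t) w) (dH (flow (e * t)) w Z) <= expR a * expR (- a * t) * hnorm w Z.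
Proof.
have [a a0 ha] := hnorm_uniform; exists a => //.
(* The time is any [t >= m] instead of [m] itself, so that [hnorm_mono] absorbs the fractional part
   at the base of the induction. *)
have iter (m : nat) t w Z : m%:R <= t -> HOmega Omega w -> E w Z ->
    hnorm (flow (e * t) w) (dH (flow (e * t)) w Z) <= expR (- a * m%:R) * hnorm w Z.
  elim: m t w Z => [|m IH] t w Z mt Hw EZ; first by rewrite mulr0 expR0 mul1r hnorm_mono.
  have mt' : m%:R <= t - 1 by rewrite lerBrDr natr1.
  have tE : e * t = e * (t - 1) + e by rewrite mulrBr mulr1 subrK.
  rewrite tE flowD; last exact: HOmega_sub.
  rewrite dH_flowD //.
  apply: le_trans (IH _ _ _ mt' (flow_HOmega dom e Hw) (E_flow e Hw EZ).1) _.
  have -> : - a * m.+1%:R = - a * m%:R + - a by rewrite -natr1 mulrDr mulr1.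
  by rewrite expRD -mulrA ler_pM2l ?expR_gt0 //; exact: ha.
move=> t w Z t0 Hw EZ.
(* Only the integer part of [t] contracts; as it exceeds [t - 1], this costs the factor [expR a]. *)
have /andP[m1 m2] := truncn_itv t0.
apply: le_trans (iter _ _ _ _ m1 Hw EZ) _.
apply: ler_wpM2r; first exact: hilb_ge0.
rewrite -expRD ler_expR; move: m2; rewrite -natr1; move: (_%:R) => m m2.
nra.
Qed.

End UniformContraction.

(** * Comparison with a Riemannian metric *)

Section MetricComparison.
Context {R : realType} {n : nat} (Omega : set 'rV[R]_n) (Gamma : set 'M[R]_(n + 1)).
Hypothesis dom : strictly_convex_domain Omega.
Hypothesis C1 : gauge_C1 Omega.
Hypothesis gam : PGL_subgroup Gamma.
Hypothesis pres : preserves Gamma Omega.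
Local Notation V := 'rV[R]_n.
Variable G : V * V -> V * V -> V * V -> R.
Hypothesis RM : riemannian_metric Omega Gamma G.
Local Notation hilb := (hilb Omega).
Local Notation hnorm := (hnorm Omega).
Implicit Types (x u z c : V) (w q Z : V * V) (s t : R).

Let Gsym := let: And5 h _ _ _ _ := RM in h.
Let Glin := let: And5 _ h _ _ _ := RM in h.
Let Gpos := let: And5 _ _ h _ _ := RM in h.
Let Gsmooth := let: And5 _ _ _ h _ := RM in h.
Let Ginv := let: And5 _ _ _ _ h := RM in h.

Lemma tangent0 w : tangent w 0.
Proof. exact: dotp0l. Qed.

Lemma tangent_comb w s Z1 Z2 : tangent w Z1 -> tangent w Z2 -> tangent w (s *: Z1 + Z2).
Proof. by rewrite /tangent /= dotpDl dotpZl => -> ->; rewrite mulr0 addr0. Qed.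

Lemma metric0r w Z : HOmega Omega w -> tangent w Z -> G w Z 0 = 0.
Proof.
move=> Hw tZ; have t0 := tangent0 w.
by have := Glin (-1) Hw tZ t0 t0; rewrite scaler0 addr0 mulN1r addNr.
Qed.

Lemma metric_sumr (I : Type) (r : seq I) (a : I -> R) (T : I -> V * V) w Z :
  HOmega Omega w -> tangent w Z -> (forall i, tangent w (T i)) ->
  tangent w (\sum_(i <- r) a i *: T i) /\
  G w Z (\sum_(i <- r) a i *: T i) = \sum_(i <- r) a i * G w Z (T i).
Proof.
move=> Hw tZ tT; elim: r => [|i r [IH1 IH2]].
  by rewrite !big_nil metric0r //; split=> //; exact: tangent0.
rewrite !big_cons; split; first exact: tangent_comb.
by rewrite Glin // IH2.
Qed.

Lemma metricZ w Z s : HOmega Omega w -> tangent w Z ->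
  G w (s *: Z) (s *: Z) = s ^+ 2 * G w Z Z.
Proof.
move=> Hw tZ; have t0 := tangent0 w.
have tsZ : tangent w (s *: Z) by have := tangent_comb s tZ t0; rewrite addr0.
have h Z' : tangent w Z' -> G w Z' (s *: Z) = s * G w Z' Z.
  by move=> tZ'; have := Glin s Hw tZ' tZ t0; rewrite addr0 metric0r // addr0.
by rewrite h // Gsym // h // mulrA expr2.
Qed.

(** A spanning family of smooth fields, not a basis: 2n fields in dimension 2n - 1. Being globally
    defined, they turn the smoothness of [G] on pairs of smooth fields into continuity of its
    coefficients. *)
Definition frame (a : 'I_n + 'I_n) : V * V -> V * V :=
  match a with inl i => fun=> (delta_mx 0 i, 0) | inr i => vfield (delta_mx 0 i) end.

Definition frame_coord (a : 'I_n + 'I_n) Z : R :=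
  match a with inl i => dotp Z.1 (delta_mx 0 i) | inr i => dotp Z.2 (delta_mx 0 i) end.

Lemma frame_smooth a : smooth_field Omega (frame a).
Proof.
by case: a => i; [exact: const_field_smooth|have [] := vfield_smooth dom (delta_mx 0 i)].
Qed.

Lemma frame_sum w Z : tangent w Z -> Z = \sum_a frame_coord a Z *: frame a w.
Proof.
move=> tZ; rewrite big_sumType /=.
have E1 (F : 'I_n -> V * V) : \sum_i F i = (\sum_i (F i).1, \sum_i (F i).2).
  by rewrite [LHS]surjective_pairing; congr (_, _);
    [exact: (big_morph (fun p : V * V => p.1))|exact: (big_morph (fun p : V * V => p.2))].
have E2 (y : V) : \sum_i dotp y (delta_mx 0 i) *: delta_mx 0 i = y.
  by rewrite [RHS]row_sum_delta; apply: eq_bigr => i _; rewrite dotpC dotp_delta.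
rewrite !E1 {1}[Z]surjective_pairing; congr (_, _) => /=.
  by rewrite E2 [X in _ + X]big1 ?addr0 // => i _; rewrite scaler0.
rewrite big1 ?add0r => [|i _]; last by rewrite scaler0.
under eq_bigr do rewrite scalerBr scalerA.
rewrite sumrB E2 -scaler_suml.
(* Projecting the coordinate vectors to the orthogonal of [w.2] subtracts in total [dotp Z.2 w.2]
   times [w.2], which is 0 by tangency. *)
have -> : \sum_i dotp Z.2 (delta_mx 0 i) * dotp (delta_mx 0 i) w.2 = dotp Z.2 w.2.
  by rewrite dotpE; apply: eq_bigr => i _; rewrite dotpC !dotp_delta.
by rewrite tZ scale0r subr0.
Qed.

Definition metric_coef (a b : 'I_n + 'I_n) q : R :=
  ((fun w => G w (frame a w) (frame b w)) \o @normalize R n) q.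

Lemma metric_coef_continuous a b w : TOmega0 Omega w -> {for w, continuous (metric_coef a b)}.
Proof. by move=> Tw; have := Gsmooth (frame_smooth a) (frame_smooth b) 0%N w Tw. Qed.

Lemma metric_frame w Z : HOmega Omega w -> tangent w Z ->
  G w Z Z = \sum_a \sum_b frame_coord a Z * (frame_coord b Z * metric_coef a b w).
Proof.
move=> Hw tZ; have tF a : tangent w (frame a w) by have [+ _] := frame_smooth a; apply.
rewrite {2}(frame_sum tZ) (metric_sumr _ _ Hw tZ tF).2; apply: eq_bigr => a _.
rewrite -mulr_sumr; congr (_ * _); rewrite Gsym // {1}(frame_sum tZ).
rewrite (metric_sumr _ _ Hw (tF a) tF).2; apply: eq_bigr => b _.
by rewrite /metric_coef /= (HOmega_id Hw).
Qed.

Lemma cont_sum (T : topologicalType) (I : Type) (r : seq I) (f : I -> T -> R) p :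
  (forall i, {for p, continuous (f i)}) ->
  {for p, continuous (fun y => \sum_(i <- r) f i y)}.
Proof.
move=> cf; elim: r => [|i r IH].
  have -> : (fun y => \sum_(i <- [::]) f i y) = (fun=> 0) by apply/funext => y; rewrite big_nil.
  exact: cont_cst.
have -> : (fun y => \sum_(j <- i :: r) f j y) = (fun y => f i y + \sum_(j <- r) f j y).
  by apply/funext => y; rewrite big_cons.
exact: (@cont_add R _ R^o _ _ _ (cf i) IH).
Qed.

Variables (E : V * V -> set (V * V)) (m : V * V -> R).
Hypothesis E_tangent : forall w, HOmega Omega w -> E w `<=` tangent w.
Hypothesis E_graph : forall w Z, HOmega Omega w -> E w Z -> Z.2 = m w *: orth w.2 Z.1.
Hypothesis E_hact : forall g w Z, Gamma g -> HOmega Omega w -> E w Z ->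
  E (hact g w) (dH (hact g) w Z).
Hypothesis m_continuous : forall w, TOmega0 Omega w -> {for w, continuous m}.

Variable K : set V.
Hypotheses (cK : compact K) (KO : K `<=` Omega).
Hypothesis K_meets : forall x, Omega x -> exists2 g, Gamma g & K (pact g x).

Definition graph w z : V * V := (z, m w *: orth w.2 z).

Lemma graph_tangent w z : HOmega Omega w -> tangent w (graph w z).
Proof. by case=> _ w1; rewrite /tangent /= dotpZl orthP ?mulr0. Qed.

Lemma graph_metric_continuous (p : (V * V) * V) : TOmega0 Omega p.1 ->
  {for p, continuous (fun p : (V * V) * V => \sum_a \sum_b
     frame_coord a (graph p.1 p.2) * (frame_coord b (graph p.1 p.2) * metric_coef a b p.1))}.
Proof.
move=> Tp; have cp1 := @cont_fst _ _ _ (fun p => p) p (@cont_id _ _).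
have cz := @cont_snd _ _ _ (fun p => p) p (@cont_id _ _).
have cu : {for p, continuous (fun p : (V * V) * V => p.1.2)} by exact: cont_snd.
have d0 : dotp p.1.2 p.1.2 != 0.
  by case: Tp => _; apply: contraNneq => /dotp_eq0 ->.
have cm := cont_comp cp1 (m_continuous Tp).
have co : {for p, continuous (fun p : (V * V) * V => orth p.1.2 p.2)}.
  have ci := @cont_inv R _ (fun p : (V * V) * V => dotp p.1.2 p.1.2) p d0 (cont_dotp cu cu).
  exact: (cont_sub cz (cont_scale (cont_mul (cont_dotp cz cu) ci) cu)).
have cc a : {for p, continuous (fun p : (V * V) * V => frame_coord a (graph p.1 p.2))}.
  have k (z : V) : {for p, continuous (fun _ : (V * V) * V => z)} by exact: cont_cst.
  case: a => i; first exact: (cont_dotp cz (k (delta_mx 0 i))).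
  exact: (cont_dotp (cont_scale cm co) (k (delta_mx 0 i))).
have cab a b : {for p, continuous (fun p : (V * V) * V => metric_coef a b p.1)}.
  exact: (cont_comp cp1 (metric_coef_continuous (a := a) (b := b) Tp)).
have cf a b : {for p, continuous (fun p : (V * V) * V =>
    frame_coord a (graph p.1 p.2) * (frame_coord b (graph p.1 p.2) * metric_coef a b p.1))}.
  exact: (cont_mul (cc a) (cont_mul (cc b) (cab a b))).
by apply: cont_sum => a; apply: cont_sum => b; exact: cf.
Qed.

(** Both quadratic quantities are positive and continuous for [z] of sup norm 1 over [K], and
    homogeneous of degree 2 in [z]: the bounds are the extrema of their quotient on a compact
    set. *)
Lemma graph_metric_bounds : exists c C : R, [/\ 0 < c, 0 < C &
  forall w z, K w.1 -> enorm w.2 = 1 ->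
    c * hilb (w.1, z) ^+ 2 <= G w (graph w z) (graph w z) <= C * hilb (w.1, z) ^+ 2].
Proof.
pose B := [set p : (V * V) * V | ([set w : V * V | K w.1 /\ enorm w.2 = 1] p.1) /\
                                 (1 <= `|p.2| /\ `|p.2| <= 1)].
have cB : compact B.
  have h : compact [set w : V * V | K w.1 /\ enorm w.2 = 1].
    by have := compact_setX cK (@compact_unit_sphere R n); congr compact.
  by have := compact_setX h (@compact_shell R n 1 1); congr compact.
have BH p : B p -> HOmega Omega p.1 by move=> [[/KO Op p1] _].
have Bz p : B p -> p.2 != 0.
  by case=> _ [h _]; rewrite -normr_gt0 (lt_le_trans ltr01 h).
pose Q (p : (V * V) * V) := \sum_a \sum_b
     frame_coord a (graph p.1 p.2) * (frame_coord b (graph p.1 p.2) * metric_coef a b p.1).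
pose h (p : (V * V) * V) := hilb (p.1.1, p.2).
have h0 p : B p -> 0 < h p by move=> Bp; apply: hilb_gt0 => //; [have [] := BH _ Bp|exact: Bz].
have ch p : B p -> {for p, continuous h}.
  move=> Bp; have [Op _] := BH _ Bp.
  apply: (@cont_comp _ _ _ (fun p : (V * V) * V => (p.1.1, p.2)) hilb).
    apply: cont_pair; last by apply: cont_snd; exact: cont_id.
    by apply: cont_fst; apply: cont_fst; exact: cont_id.
  exact: hilb_continuous.
pose f p := Q p / h p ^+ 2.
have cf p : B p -> {for p, continuous f}.
  move=> Bp; have hp : h p ^+ 2 != 0 by rewrite gt_eqF // exprn_gt0 // h0.
  have cQ := graph_metric_continuous (HOmega_sub (BH _ Bp)).
  have ch2 : {for p, continuous (fun p => h p ^+ 2)} := cont_mul (ch p Bp) (ch p Bp).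
  have ci := @cont_inv R _ (fun p => h p ^+ 2) p hp ch2.
  exact: (cont_mul cQ ci).
have QE p : B p -> Q p = G p.1 (graph p.1 p.2) (graph p.1 p.2).
  by move=> Bp; rewrite metric_frame //; [exact: BH|exact/graph_tangent/BH].
have f0 p : B p -> 0 < f p.
  move=> Bp; rewrite divr_gt0 ?exprn_gt0 ?h0 // QE //; apply: Gpos.
  - exact: BH.
  - exact/graph_tangent/BH.
  - by apply: contraNneq (Bz _ Bp) => -[-> _].
have [c c0 hc] := compact_lower cB cf f0.
have [C C0 hC] := compact_upper cB cf.
exists c, C; split=> // w z Kw w1; have Ow : Omega w.1 by exact: KO.
have Hw : HOmega Omega w by [].
have [->|z0] := eqVneq z 0.
  have -> : graph w 0 = 0 by rewrite /graph -[in orth _ _](scale0r (0 : V)) orthZ scale0r scaler0.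
  by rewrite hilb0 // expr0n /= !mulr0 metric0r ?lexx //; exact: tangent0.
have n0 : 0 < `|z| by rewrite normr_gt0.
have [y y1 zE] : exists2 y : V, `|y| = 1 & z = `|z| *: y.
  exists (`|z|^-1 *: z); last by rewrite scalerA mulfV ?gt_eqF // scale1r.
  by rewrite normrZ ger0_norm ?invr_ge0 ?ltW // mulVf // gt_eqF.
move: n0 zE {z0}; move: `|z| => r r0 ->.
have -> : graph w (r *: y) = r *: graph w y.
  by rewrite /graph orthZ scalerA mulrC -scalerA.
have ty := graph_tangent y Hw.
have By : B (w, y) by split; rewrite //= y1.
rewrite (hilbZ dom _ Ow r0) exprMn (metricZ r Hw ty) ![_ * (r ^+ 2 * _)]mulrCA.
rewrite !ler_pM2l ?exprn_gt0 //; have := hc _ By; have := hC _ By.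
have hp : 0 < h (w, y) ^+ 2 by rewrite exprn_gt0 // h0.
rewrite /f QE // ler_pdivrMr // ler_pdivlMr // => u1 u2.
by apply/andP.
Qed.

Lemma rnorm_hact g w Z : Gamma g -> HOmega Omega w -> tangent w Z ->
  rnorm G (hact g w) (dH (hact g) w Z) = rnorm G w Z.
Proof. by move=> Gg Hw tZ; rewrite /rnorm Ginv. Qed.

(** Both norms are invariant under the group, so the vector may be moved over [K]; the square roots
    come from comparing squares there. *)
Lemma rnorm_hnorm : exists c C : R, [/\ 0 < c, 0 < C &
  forall w Z, HOmega Omega w -> E w Z -> c * hnorm w Z <= rnorm G w Z <= C * hnorm w Z].
Proof.
have [c [C [c0 C0 h]]] := graph_metric_bounds.
exists (Num.sqrt c), (Num.sqrt C); rewrite !sqrtr_gt0; split=> // w Z Hw EZ.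
have [g Gg Kg] : exists2 g, Gamma g & K (pact g w.1) by apply: K_meets; case: Hw.
have gu := gamma_unit gam Gg; have pg := gamma_preserved pres Gg.
have Hg : HOmega Omega (hact g w) by exact: hact_HOmega.
rewrite -(hnorm_hact dom gam pres Z Gg Hw) -(rnorm_hact Gg Hw); last exact: E_tangent EZ.
have EZ' := E_hact Gg Hw EZ; move: (dH _ _ _) EZ' => Z' EZ'.
have -> : Z' = graph (hact g w) Z'.1.
  by rewrite /graph -(E_graph Hg EZ'); case: (Z').
have Kg' : K (hact g w).1 by rewrite (hact_lift pg) //; case: Hw.
have g1 : enorm (hact g w).2 = 1 by case: Hg.
have /andP[h1 h2] := h (hact g w) Z'.1 Kg' g1.
rewrite /rnorm /hnorm /=; have p0 := hilb_ge0 Omega ((hact g w).1, Z'.1).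
have sE d : 0 <= d -> Num.sqrt d * hilb ((hact g w).1, Z'.1) =
    Num.sqrt (d * hilb ((hact g w).1, Z'.1) ^+ 2).
  by move=> d0; rewrite sqrtrM // sqrtr_sqr ger0_norm.
by rewrite (sE _ (ltW c0)) (sE _ (ltW C0)); apply/andP; split; exact: ler_wsqrtr.
Qed.

End MetricComparison.

(** * The Anosov splitting *)

Section Splitting.
Context {R : realType} {n : nat} (Omega : set 'rV[R]_n).
Hypothesis dom : strictly_convex_domain Omega.
Hypothesis C1 : gauge_C1 Omega.
Local Notation V := 'rV[R]_n.
Local Notation tau := (tau Omega).
Local Notation gp := (tau_grad Omega).
Local Notation sig w := (tau (flip w)).
Local Notation gm w := (gp (flip w)).
Local Notation horo := (horo Omega).
Local Notation hilb := (hilb Omega).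
Local Notation speed := (speed Omega).
Implicit Types (x u z y : V) (w q Z : V * V) (s t : R).

Definition gap w z : R := dotp z (gp w) - dotp z (gm w).

Lemma gap_comb w s z y : gap w (s *: z + y) = s * gap w z + gap w y.
Proof. by rewrite /gap !dotpDl !dotpZl; ring. Qed.

Lemma gapD w z y : gap w (z + y) = gap w z + gap w y.
Proof. by have := gap_comb w 1 z y; rewrite scale1r mul1r. Qed.

Lemma gapN w z : gap w (- z) = - gap w z.
Proof. by rewrite /gap !dotpNl; ring. Qed.

Lemma gapZ w s z : gap w (s *: z) = s * gap w z.
Proof. by rewrite /gap !dotpZl; ring. Qed.

Lemma horo_gap w z : horo w z <-> gap w z = 0.
Proof. by rewrite /gap /horo; split=> [->|/eqP]; [rewrite subrr|rewrite subr_eq0 => /eqP]. Qed.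

Lemma gap_self w : TOmega0 Omega w -> gap w w.2 = hilb w.
Proof. by move=> Tw; rewrite /gap gp_self // gm_self // opprK. Qed.

(** The projection to [horo] along [w.2]; restricted to the orthogonal of [w.2], it is the inverse
    of [orth w.2] on [horo]. *)
Definition horo_lift w y : V := y - (gap w y / hilb w) *: w.2.

Lemma horo_liftP w y : TOmega0 Omega w -> gap w (horo_lift w y) = 0.
Proof.
move=> Tw; rewrite /horo_lift gapD gapN gapZ gap_self // divfK ?subrr //.
by rewrite gt_eqF // hilb_pos.
Qed.

Lemma orth_lift w y : HOmega Omega w -> dotp y w.2 = 0 -> orth w.2 (horo_lift w y) = y.
Proof.
case=> _ w1 yu; rewrite /horo_lift orth_sub_self ?unit_neq0 //; exact: orth_id.
Qed.

Lemma horo_liftE w z : HOmega Omega w -> gap w z = 0 -> z = horo_lift w (orth w.2 z).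
Proof.
move=> Hw hz; have Tw := HOmega_sub Hw; have w1 : enorm w.2 = 1 by case: Hw.
have h0 : hilb w != 0 by rewrite gt_eqF // hilb_pos.
rewrite /horo_lift orth_unit // gapD gapN gapZ hz gap_self // add0r mulNr mulfK //.
by rewrite scaleNr opprK subrK.
Qed.

Lemma graph_subspace w (E : set (V * V)) s : HOmega Omega w ->
  (forall Z, E Z <-> horo w Z.1 /\ Z.2 = s *: orth w.2 Z.1) -> linear_subspace w E.
Proof.
move=> Hw EP; have w1 : enorm w.2 = 1 by case: Hw.
have orth0 : orth w.2 0 = 0 by rewrite /orth dotp0l mul0r scale0r subr0.
split=> [Z /EP[_ Z2]||c Z Z' /EP[/horo_gap h1 e1] /EP[/horo_gap h2 e2]].
- by rewrite /tangent /= Z2 dotpZl orthP ?mulr0.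
- apply/EP; split; last by rewrite /= orth0 scaler0.
  by rewrite /horo /= !dotp0l.
- apply/EP; split; first by apply/horo_gap; rewrite /= gap_comb h1 h2 mulr0 addr0.
  have -> : (c *: Z + Z').2 = c *: Z.2 + Z'.2 by [].
  have -> : (c *: Z + Z').1 = c *: Z.1 + Z'.1 by [].
  rewrite e1 e2 (orth_linear w.2 c Z.1 Z'.1); move: (orth _ _) (orth _ _) => o o'.
  by apply/rowP => i; rewrite !mxE; ring.
Qed.

Lemma direct_sum w : HOmega Omega w ->
  direct_sum_at w (Xfield Omega w) (Es Omega w) (Eu Omega w).
Proof.
move=> Hw; have Tw := HOmega_sub Hw; have w1 : enorm w.2 = 1 by case: Hw.
have h0 : hilb w != 0 by rewrite gt_eqF // hilb_pos.
have sv : speed w * hilb w = 2 by rewrite /speed divfK.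
have hE : hilb w = tau w + sig w by [].
have sP := @EsP _ _ _ dom C1 w; have uP := @EuP _ _ _ dom C1 w.
split.
- by rewrite XfieldE // /tangent /= dotp0l.
- by apply: graph_subspace => // Z; exact: sP.
- by apply: graph_subspace => // Z; exact: uP.
move=> Z tZ; rewrite XfieldE //.
(* The form [gap] vanishes on the base components of E^s and E^u and equals 2 on that of X. *)
pose c := gap w Z.1 / 2.
pose z0 := Z.1 - (c * speed w) *: w.2.
have gz0 : gap w z0 = 0.
  by rewrite /z0 gapD gapN gapZ gap_self // -mulrA sv /c divfK ?subrr // pnatr_eq0.
(* The projection of the unstable base component: eliminating the stable one from the two graph
   equations leaves [tau + sig], that is [hilb], times it on the left. *)
pose y := (hilb w)^-1 *: (Z.2 + tau w *: orth w.2 z0).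
have yu : dotp y w.2 = 0 by rewrite /y dotpZl dotpDl dotpZl orthP // tZ mulr0 addr0 mulr0.
pose zu := horo_lift w y; pose zs := z0 - zu.
have gu : gap w zu = 0 by exact: horo_liftP.
have gs : gap w zs = 0 by rewrite /zs gapD gapN gz0 gu subrr.
have ou : orth w.2 zu = y by exact: orth_lift.
have os : orth w.2 zs = orth w.2 z0 - y.
  have := orth_linear w.2 (-1) zu z0; rewrite !scaleN1r ou => oE.
  by rewrite /zs addrC oE addrC.
exists (c, ((zs, - tau w *: orth w.2 zs), (zu, sig w *: orth w.2 zu))); split.
  split=> /=; first by apply/sP => //; split=> //; apply/horo_gap.
    by apply/uP => //; split=> //; apply/horo_gap.
  rewrite [LHS]surjective_pairing; congr (_, _) => /=.
    by rewrite -addrA /zs subrK /z0 scalerA addrC subrK.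
  rewrite scaler0 add0r os ou.
  have -> : Z.2 = hilb w *: y - tau w *: orth w.2 z0.
    by rewrite /y scalerA mulfV // scale1r addrK.
  rewrite hE; move: (tau w) (sig w) (orth _ _) => a b o.
  by apply/rowP => i; rewrite !mxE; ring.
case=> c' [[zs' bs] [zu' bu]] /= [/(sP _ Hw)/= [/horo_gap gs' ->] /(uP _ Hw)/= [/horo_gap gu' ->]] ZE.
have Z1 : Z.1 = (c' * speed w) *: w.2 + zs' + zu' by rewrite ZE /= scalerA.
have Z2 : Z.2 = - tau w *: orth w.2 zs' + sig w *: orth w.2 zu' by rewrite ZE /= scaler0 add0r.
have cE : c = c'.
  by rewrite /c Z1 !gapD gs' gu' gapZ gap_self // !addr0 -[c' * _ * _]mulrA sv mulfK // pnatr_eq0.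
have z0E : z0 = zs' + zu'.
  rewrite /z0 Z1 cE; move: (_ *: w.2) => p.
  by apply/rowP => i; rewrite !mxE; ring.
have yE : y = orth w.2 zu'.
  have oD : orth w.2 z0 = orth w.2 zs' + orth w.2 zu'.
    by have := orth_linear w.2 1 zs' zu'; rewrite !scale1r z0E.
  rewrite /y Z2 oD -[RHS]scale1r -(mulVf h0) -scalerA; congr (_ *: _).
  rewrite hE; move: (tau w) (sig w) (orth _ _) (orth _ _) => a b o o'.
  by apply/rowP => i; rewrite !mxE; ring.
have zuE : zu = zu' by rewrite /zu yE -horo_liftE.
have zsE : zs = zs' by rewrite /zs zuE z0E addrK.
by rewrite cE zuE zsE.
Qed.

End Splitting.

Section GeodesicFlow.
Context {R : realType} {n : nat} (Omega : set 'rV[R]_n).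
Hypothesis dom : strictly_convex_domain Omega.
Local Notation V := 'rV[R]_n.

Lemma geodesic_generator (phi : R -> V * V -> V * V) : hilbert_geodesic_flow Omega phi ->
  forall (w : V * V) (t : R), HOmega Omega w ->
  is_derive (t : R^o) (1 : R^o) (fun s : R^o => phi s w) (Xfield Omega (phi t w)).
Proof.
move=> hphi w t Hw; have [_ hw] := hphi w Hw.
have [Ht p2 [c [c0 /is_derive_is_diff d F1]]] := hw t.
have u1 : enorm w.2 = 1 by case: Hw.
have Ot : Omega (phi t w).1 by case: Ht.
have cE : c = speed Omega (phi t w).
  have sp := speed_pos dom (HOmega_sub Ht).
  move: F1; rewrite hilbertF_unit // -p2 -surjective_pairing => /divr1_eq.
  by [].
apply/is_derive_is_diff.
have -> : (fun s : R^o => phi s w) = (fun s : R^o => ((phi s w).1, w.2)).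
  by apply/funext => s; have [_ <- _] := hw s; rewrite -surjective_pairing.
apply: (is_diff_eq (is_diff_pair d (is_diff_const w.2 (t : R^o)))).
apply/funext => h; rewrite (XfieldE dom Ht) p2 -cE.
by congr (_, _); rewrite /= ?scaler0.
Qed.

End GeodesicFlow.

Lemma compact_quotient_C1 (R : realType) (n : nat) (Omega : set 'rV[R]_n)
    (Gamma : set 'M[R]_(n + 1)) : compact_strictly_convex_projective Omega Gamma ->
  gauge_C1 Omega.
Proof.
move=> [dom [gam pres] _ _ cq].
have [K [cK KO K_meets]] := cocompact dom gam pres cq.
apply: (cocompact_gauge_C1 dom cK KO) => x Ox; have [g Gg Kg] := K_meets x Ox.
exists (pact g x), (dpact g x); split=> //; first exact: dpact_linear.
move=> v; have pg := gamma_preserved pres Gg.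
have pg' := gamma_preserved pres (gamma_inv gam Gg).
exact: (hilb_g dom (gamma_unit gam Gg) pg pg').
Qed.

Theorem theorem4p1 (R : realType) (n : nat) (Omega : set 'rV[R]_n)
    (Gamma : set 'M[R]_(n + 1))
    (phi : R -> 'rV[R]_n * 'rV[R]_n -> 'rV[R]_n * 'rV[R]_n)
    (G : 'rV[R]_n * 'rV[R]_n -> 'rV[R]_n * 'rV[R]_n ->
         'rV[R]_n * 'rV[R]_n -> R) :
  compact_strictly_convex_projective Omega Gamma ->
  hilbert_geodesic_flow Omega phi ->
  riemannian_metric Omega Gamma G ->
  [/\ (* X is the generator of phi, and each phi t is differentiable *)
      forall w (t : R), HOmega Omega w ->
        is_derive (t : R^o) (1 : R^o) (fun s : R^o => phi s w)
          (Xfield Omega (phi t w)) /\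
        differentiable (phi t \o @normalize R n) w,
      (* the flow and the decomposition descend to HM *)
      forall g, Gamma g ->
        (forall w (t : R), HOmega Omega w ->
           phi t (hact g w) = hact g (phi t w)) /\
        invariant_under Omega (hact g) (Xfield Omega) (Es Omega) (Eu Omega),
      forall w, HOmega Omega w ->
        direct_sum_at w (Xfield Omega w) (Es Omega w) (Eu Omega w),
      forall t : R,
        invariant_under Omega (phi t) (Xfield Omega) (Es Omega) (Eu Omega) &
      exists C alpha beta : R, [/\ 0 < C, 0 < alpha, 0 < beta &
        forall w (t : R), HOmega Omega w -> 0 <= t ->
          (forall Zs, Es Omega w Zs ->
             rnorm G (phi t w) (dH (phi t) w Zs) <=
               C * expR (- alpha * t) * rnorm G w Zs) /\
          (forall Zu, Eu Omega w Zu ->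
             rnorm G (phi (- t) w) (dH (phi (- t)) w Zu) <=
               C * expR (- beta * t) * rnorm G w Zu)]].
Proof.
move=> hM hphi RM; have C1 := compact_quotient_C1 hM.
have [dom [gam pres] _ _ cq] := hM.
have [K [cK KO K_meets]] := cocompact dom gam pres cq.
have phiE t w : HOmega Omega w -> phi t w = flow Omega t w.
  by move=> Hw; exact: (geodesic_flowE dom hphi t Hw).
have dphiE t w Z : HOmega Omega w -> dH (phi t) w Z = dH (flow Omega t) w Z.
  move=> Hw; apply: (dH_ext dom Z (HOmega_sub Hw)) => q Hq; exact: phiE.
have stableg g w : Gamma g -> HOmega Omega w -> HOmega Omega (hact g w).
  by move=> Gg; exact: (hact_HOmega (gamma_unit gam Gg) (gamma_preserved pres Gg)).
split.
- move=> w t Hw; split; first exact: (geodesic_generator dom hphi).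
  have dE := near_HOmega (P := fun q => flow Omega t q = phi t q) dom (HOmega_sub Hw)
    (fun q Hq => esym (phiE t q Hq)).
  by have [] := near_is_diff dE (is_diff_flow dom C1 t (HOmega_sub Hw)).
- move=> g Gg; split; last exact: (hact_invariant dom C1 gam pres Gg).
  move=> w t Hw; rewrite (phiE t w Hw) (phiE t _ (stableg g w Gg Hw)).
  exact: (hact_flow dom (gamma_unit gam Gg) (gamma_preserved pres Gg)
            (gamma_preserved pres (gamma_inv gam Gg)) t Hw).
- by move=> w; exact: direct_sum.
- move=> t w Hw; have [h1 h2 h3] := flow_invariant dom C1 t Hw.
  have dE : dH (phi t) w = dH (flow Omega t) w by apply/funext => Z; exact: dphiE.
  by rewrite dE (phiE t w Hw); exact: (And3 h1 h2 h3).
have s_hact g w Z : Gamma g -> HOmega Omega w -> Es Omega w Z ->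
    Es Omega (hact g w) (dH (hact g) w Z).
  move=> Gg; exact: (hact_Es dom C1 (gamma_unit gam Gg) (gamma_preserved pres Gg)
            (gamma_preserved pres (gamma_inv gam Gg))).
have u_hact g w Z : Gamma g -> HOmega Omega w -> Eu Omega w Z ->
    Eu Omega (hact g w) (dH (hact g) w Z).
  move=> Gg; exact: (hact_Eu dom C1 (gamma_unit gam Gg) (gamma_preserved pres Gg)
            (gamma_preserved pres (gamma_inv gam Gg))).
have s_horo w Z : HOmega Omega w -> Es Omega w Z -> horo Omega w Z.1.
  by move=> Hw /(EsP dom C1 Z Hw)[].
have u_horo w Z : HOmega Omega w -> Eu Omega w Z -> horo Omega w Z.1.
  by move=> Hw /(EuP dom C1 Z Hw)[].
have [cs [Cs [cs0 Cs0 hs]]] : exists c C : R, [/\ 0 < c, 0 < C &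
    forall w Z, HOmega Omega w -> Es Omega w Z ->
      c * hnorm Omega w Z <= rnorm G w Z <= C * hnorm Omega w Z].
  apply: (rnorm_hnorm dom gam pres RM (E := Es Omega) (m := fun w => - tau Omega w) _ _ s_hact _ cK KO K_meets).
  + by move=> w; exact: Es_tangent.
  + by move=> w Z Hw /(EsP dom C1 Z Hw)[].
  + move=> w Tw; have d := is_diff_tau_pair dom C1 Tw.
    exact: (@cont_opp R _ R^o _ _ (is_diff_continuous d)).
have [cu [Cu [cu0 Cu0 hu]]] : exists c C : R, [/\ 0 < c, 0 < C &
    forall w Z, HOmega Omega w -> Eu Omega w Z ->
      c * hnorm Omega w Z <= rnorm G w Z <= C * hnorm Omega w Z].
  apply: (rnorm_hnorm dom gam pres RM (E := Eu Omega) (m := fun w => tau Omega (flip w)) _ _ u_hact _ cK KO K_meets).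
  + by move=> w; exact: Eu_tangent.
  + by move=> w Z Hw /(EuP dom C1 Z Hw)[].
  + by move=> w Tw; exact: (is_diff_continuous (is_diff_sig dom C1 Tw)).
have [a a0 ha] : exists2 a : R, 0 < a & forall t w Z, 0 <= t -> HOmega Omega w -> Es Omega w Z ->
    hnorm Omega (flow Omega (1 * t) w) (dH (flow Omega (1 * t)) w Z) <=
      expR a * expR (- a * t) * hnorm Omega w Z.
  apply: (hnorm_decay dom C1 gam pres (E := Es Omega) (k := contr Omega) _ s_horo _ s_hact _ _ cK KO K_meets).
  + by move=> w; exact: Es_tangent.
  + by move=> t w Z; exact: dH_flow_Es.
  + by move=> t w; exact: contr_continuous.
  + by move=> t w z Tw t0; rewrite mul1r; exact: push_contr_lt.
have [b b0 hb] : exists2 b : R, 0 < b & forall t w Z, 0 <= t -> HOmega Omega w -> Eu Omega w Z ->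
    hnorm Omega (flow Omega (-1 * t) w) (dH (flow Omega (-1 * t)) w Z) <=
      expR b * expR (- b * t) * hnorm Omega w Z.
  apply: (hnorm_decay dom C1 gam pres (E := Eu Omega) (k := expan Omega) _ u_horo _ u_hact _ _ cK KO K_meets).
  + by move=> w; exact: Eu_tangent.
  + by move=> t w Z; exact: dH_flow_Eu.
  + by move=> t w; exact: expan_continuous.
  + by move=> t w z Tw t0; rewrite mulN1r; exact: push_expan_lt.
(* Passing from [hnorm] to [rnorm] at both ends costs the factor [C / c]; the slack [D] allows one
   constant for both subbundles. *)
have key (c C r D : R) (p q : R) w Z w' Z' :
    0 < c -> 0 < C -> C / c * expR r <= D -> 0 < p ->
    c * hnorm Omega w Z <= q ->
    hnorm Omega w' Z' <= expR r * p * hnorm Omega w Z ->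
    rnorm G w' Z' <= C * hnorm Omega w' Z' ->
    rnorm G w' Z' <= D * p * q.
  move=> c0 C0 hD p0 h1 h2 h3; apply: le_trans h3 _.
  have D0 : 0 <= D by apply: le_trans hD; rewrite mulr_ge0 ?expR_ge0 // divr_ge0 // ltW.
  apply: (le_trans (y := C / c * expR r * p * (c * hnorm Omega w Z))).
    have -> : C / c * expR r * p * (c * hnorm Omega w Z) = C * (expR r * p * hnorm Omega w Z).
      by field; rewrite gt_eqF.
    by rewrite ler_pM2l.
  have n0 : 0 <= c * hnorm Omega w Z by apply: mulr_ge0; [exact: ltW|exact: hilb_ge0].
  apply: ler_pM => //; last by rewrite ler_pM2r.
  by rewrite !mulr_ge0 ?expR_ge0 ?invr_ge0 ?ltW.
exists (Num.max (Cs / cs * expR a) (Cu / cu * expR b)), a, b; split=> //.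
  by rewrite lt_max mulr_gt0 ?expR_gt0 ?divr_gt0.
move=> w t Hw t0; split=> Z EZ; rewrite dphiE // phiE //.
  have := ha t w Z t0 Hw EZ; rewrite mul1r => h.
  have [EZ' _] := dH_flow_Es dom C1 t Hw EZ.
  have /andP[_ h3] := hs _ _ (flow_HOmega dom t Hw) EZ'.
  have /andP[h1 _] := hs _ _ Hw EZ.
  by apply: (key _ _ _ _ _ _ _ _ _ _ cs0 Cs0 _ (expR_gt0 _) h1 h h3); rewrite le_max lexx.
have := hb t w Z t0 Hw EZ; rewrite mulN1r => h.
have [EZ' _] := dH_flow_Eu dom C1 (- t) Hw EZ.
have /andP[_ h3] := hu _ _ (flow_HOmega dom (- t) Hw) EZ'.
have /andP[h1 _] := hu _ _ Hw EZ.
by apply: (key _ _ _ _ _ _ _ _ _ _ cu0 Cu0 _ (expR_gt0 _) h1 h h3); rewrite le_max lexx orbT.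
Qed.
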